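(* Let $\alpha\ge1$ and let $\mathbf{X}_1,\dots,\mathbf{X}_n\in\mathbb{H}(d)$ be i.i.d. random matrices with $$\boldsymbol{\Sigma}=\mathbb{E}(\mathbf{X}_1-\mathbb{E}\mathbf{X}_1)^2,\qquad\lambda_{\max}(\boldsymbol{\Sigma})\le\sigma^2,\qquad\big\|\,\|\mathbf{X}_1-\mathbb{E}\mathbf{X}_1\|\,\big\|_{\psi_\alpha}\le K,$$ where $\sigma,K>0$. Denote $$\bar{\mathbf{X}}=\frac1n\sum_{i=1}^n\mathbf{X}_i,\qquad\hat{\boldsymbol{\Sigma}}=\frac1n\sum_{i=1}^n(\mathbf{X}_i-\bar{\mathbf{X}})^2,\qquad\hat\sigma^2=\lambda_{\max}(\hat{\boldsymbol{\Sigma}}),\qquad\hat z=\left(4\,\underline{\log}\frac{Ke}{\hat\sigma}\right)^{1/\alpha}.$$ Then for any $\mathrm{x}>0$ such that $n\ge8\mathrm{x}$, with probability at least $1-3de^{-\mathrm{x}}$, $$\|\bar{\mathbf{X}}-\mathbb{E}\mathbf{X}_1\|\le\hat\sigma\sqrt{2\frac{\mathrm{x}}{n}}+15K\hat z\,\frac{\mathrm{x}}{n}.$$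
   Context: $\mathbb{H}(d)$ is the space of $d\times d$ Hermitian matrices, $\lambda_{\max}$ the largest eigenvalue, $\|\cdot\|$ the operator norm, $\underline{\log}\,x=\max(\ln x,1)$; $\hat\sigma\ge0$, and $\hat z=+\infty$ when $\hat\sigma=0$. With $\psi_\alpha(x)=e^{x^\alpha}-1$, the Orlicz norm of a real random variable $X$ is $\|X\|_{\psi_\alpha}=\inf\{t>0:\mathbb{E}\,\psi_\alpha(|X|/t)\le1\}$. *)

(* Defs.v *)
From mathcomp Require Import all_boot all_order all_algebra.
From mathcomp Require Import complex.
From mathcomp Require Import all_classical all_reals all_analysis.

Set Implicit Arguments.
Unset Strict Implicit.
Unset Printing Implicit Defensive.

Import Order.TTheory GRing.Theory Num.Theory.
Import numFieldNormedType.Exports.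

Local Open Scope classical_set_scope.
Local Open Scope ring_scope.
Local Open Scope complex_scope.

Definition norm2 (R : realType) (d : nat) (v : 'cV[R[i]]_d) : R :=
  Num.sqrt (\sum_(j < d) (complex.Re (v j 0) ^+ 2 + complex.Im (v j 0) ^+ 2)).

(* The operator norm for the Euclidean norm on C^d; the library norm on
   matrices is the entrywise max norm. *)
Definition opnorm (R : realType) (d : nat) (A : 'M[R[i]]_d) : R :=
  sup [set norm2 (A *m v) | v in [set v : 'cV[R[i]]_d | norm2 v <= 1]].

(* For a Hermitian A and 0 < d the set of real eigenvalues is finite and
   nonempty, so that the supremum is the largest eigenvalue. *)
Definition lambda_max (R : realType) (d : nat) (A : 'M[R[i]]_d) : R :=
  sup [set a : R | eigenvalue A a%:C].

(* Re and Im of the entries of a matrix generate the Borel sigma-algebra. *)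
Definition mx_borel (R : realType) (d : nat) : set (set 'M[R[i]]_d) :=
  <<s [set B | exists j k, exists2 A : set R, measurable A &
         B = [set M : 'M[R[i]]_d | A (complex.Re (M j k))] \/
         B = [set M : 'M[R[i]]_d | A (complex.Im (M j k))]] >>.

Definition random_mx (disp : measure_display) (T : measurableType disp)
    (R : realType) (d : nat) (X : T -> 'M[R[i]]_d) : Prop :=
  forall B, mx_borel B -> measurable (X @^-1` B).

Definition identically_distributed (disp : measure_display)
    (T : measurableType disp) (R : realType) (P : probability T R) (n d : nat)
    (X : 'I_n -> T -> 'M[R[i]]_d) : Prop :=
  forall i j B, mx_borel B -> P (X i @^-1` B) = P (X j @^-1` B).

Definition mutually_independent (disp : measure_display)
    (T : measurableType disp) (R : realType) (P : probability T R) (n d : nat)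
    (X : 'I_n -> T -> 'M[R[i]]_d) : Prop :=
  forall (J : {set 'I_n}) (B : 'I_n -> set 'M[R[i]]_d),
    (forall i, mx_borel (B i)) ->
    P (\bigcap_(i in [set i | i \in J]) (X i @^-1` B i)) =
    (\prod_(i in J) P (X i @^-1` B i))%E.

(* Entrywise expectation; meaningful when all entries are integrable. *)
Definition expectation_mx (disp : measure_display) (T : measurableType disp)
    (R : realType) (P : probability T R) (d : nat)
    (X : T -> 'M[R[i]]_d) : 'M[R[i]]_d :=
  \matrix_(j, k) (fine 'E_P[fun w => complex.Re (X w j k)] +i*
                  fine 'E_P[fun w => complex.Im (X w j k)]).

Definition psi (R : realType) (alpha x : R) : R := expR (x `^ alpha) - 1.

(* Equal to +oo when no t is admissible. *)
Definition orlicz_norm (disp : measure_display) (T : measurableType disp)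
    (R : realType) (P : probability T R) (alpha : R) (X : T -> R) : \bar R :=
  ereal_inf [set t%:E | t in
    [set t : R | 0 < t /\ ('E_P[fun w => psi alpha (`|X w| / t)] <= 1)%E]].

Definition ulog (R : realType) (x : R) : R := Num.max (ln x) 1.

Definition sample_mean (R : realType) (n d : nat)
    (x : 'I_n -> 'M[R[i]]_d) : 'M[R[i]]_d :=
  n%:R^-1 *: \sum_(i < n) x i.

Definition sample_cov (R : realType) (n d : nat)
    (x : 'I_n -> 'M[R[i]]_d) : 'M[R[i]]_d :=
  n%:R^-1 *: \sum_(i < n) (x i - sample_mean x) ^+ 2.

Definition sigma_hat (R : realType) (n d : nat)
    (x : 'I_n -> 'M[R[i]]_d) : R :=
  Num.sqrt (lambda_max (sample_cov x)).

Definition z_hat (R : realType) (alpha K : R) (n d : nat)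
    (x : 'I_n -> 'M[R[i]]_d) : \bar R :=
  if sigma_hat x == 0 then +oo%E
  else ((4 * ulog (K * expR 1 / sigma_hat x)) `^ alpha^-1)%:E.

(* Main.v *)
(** With [Y_i = X_i - E X_i] and [W = ||Y_1||], the Orlicz condition reads
    [E exp ((W / K) ^ alpha) <= 2]. Since the sample is i.i.d., the matrix Laplace
    transform method needs only the Golden-Thompson inequality: conditioning on
    the past gives [E tr exp (c (Y_1 + .. + Y_n)) <= d * m ^ n], where [m] is the
    largest eigenvalue of [E exp (c Y_1)]. Golden-Thompson follows from
    [tr (XY) ^ (2 ^ k) <= tr (X ^ (2 ^ k) Y ^ (2 ^ k))] and the limit
    [(1 + A / m) ^ m -> exp A].

    The moment generating function is bounded eigenvalue by eigenvalue. Eigenvalues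
    below [Z = K * L ^ (1 / alpha)], [L = 4 ulog (K e / s)], obey the Bernstein
    estimate with range [Z]; larger ones are dominated by
    [exp (- L) * exp ((W / K) ^ alpha)], and [exp (- L) <= s ^ 2 / (2 Z ^ 2)]. This
    gives [||mean - E X_1|| <= s sqrt (2 x / n) + Z x / n] with probability at least
    [1 - 2 d e ^ (- x)], for every [s] above the true standard deviation.

    One more event, of probability at least [1 - e ^ (- x)], bounds
    [n ^ -1 sum |Y_i v| ^ 2] from below for the top eigenvector [v] of the covariance,
    hence [sigma_hat] from below. Taking [s = max (sigma, K sqrt (x / n))], a
    deterministic comparison then replaces [s] and [Z] by their empirical
    counterparts. *)

From HB Require Import structures.
Require Import Defs.
From mathcomp Require Import all_boot all_order all_algebra.
From mathcomp Require Import complex.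
From mathcomp Require Import all_classical all_reals all_analysis.
From mathcomp Require Import measurable_realfun ring lra.

Set Implicit Arguments.
Unset Strict Implicit.
Unset Printing Implicit Defensive.

Import Order.TTheory GRing.Theory Num.Theory.
Import numFieldNormedType.Exports.

Local Open Scope classical_set_scope.
Local Open Scope ring_scope.

(** * Trace inequalities for powers *)

(** The final bound is not monotone in the empirical deviation [h]: its main term grows with [h],
    while [plug_level h] shrinks. A lower bound on [h] still suffices. If [h] exceeds [s], either
    the two logarithms differ by a factor at most 15, or [h] is exponentially larger than [s] and
    the main term alone pays for the range term. If [h < s], the level can only grow, and the loss
    [sqrt 2 * (s - h)] has to fit into the spare [14 * Z * eps], where [eps = sqrt (x / n)]. This
    calls for [h ^ 2 >= s ^ 2 - O (s * Z * eps)], with an error proportional to [s]; hence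
    [E |Y_i v| ^ 4] has to be of order [Z ^ 2 * s ^ 2], which a split at the same level [Z]
    provides.

    No matrix is truncated. The split takes place inside pointwise inequalities between scalar
    functions, so the centring of [Y_i] is never disturbed. *)

Section trace_inequalities.
Local Open Scope sesquilinear_scope.
Context {C : numClosedFieldType} {n : nat}.
Implicit Types A B M X Y : 'M[C]_n.

Lemma adjmxM A B : (A * B)^t* = B^t* * A^t*.
Proof. by rewrite trmx_mul map_mxM. Qed.

Lemma adjmxX A k : (A ^+ k)^t* = (A^t*) ^+ k.
Proof.
elim: k => [|k IH]; first by rewrite !expr0 trmx1 map_mx1.
by rewrite exprS exprSr adjmxM IH.
Qed.

Lemma adjmxD A B : (A + B)^t* = A^t* + B^t*.
Proof. by rewrite linearD /= map_mxD. Qed.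

Lemma hermsymmxP A : reflect (A^t* = A) (A \is hermsymmx).
Proof.
apply: (iffP (is_hermitianmxP _ _ _)); rewrite expr0 scale1r => AE.
  by rewrite [in RHS]AE.
by rewrite AE.
Qed.

Lemma mxtrace_mulrC A B : \tr (A * B) = \tr (B * A).
Proof. exact: mxtrace_mulC. Qed.

Lemma mxtrace_mulXC A B k : \tr ((A * B) ^+ k) = \tr ((B * A) ^+ k).
Proof.
case: k => [|k]; first by rewrite !expr0.
have mulXC j : (A * B) ^+ j * A = A * (B * A) ^+ j.
  elim: j => [|j IH]; first by rewrite !expr0 mul1r mulr1.
  by rewrite exprS -mulrA IH exprS !mulrA.
by rewrite exprSr mulrA mulXC -mulrA mxtrace_mulrC -mulrA -exprSr.
Qed.

Lemma mxtrace_mul_adj A : \tr (A * A^t*) = \sum_i \sum_j `|A i j| ^+ 2.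
Proof.
apply: eq_bigr => i _; rewrite mxE; apply: eq_bigr => j _.
by rewrite !mxE normCK.
Qed.

(** Cauchy-Schwarz for the Hilbert-Schmidt product, weakened by the arithmetic-geometric mean.
    Nothing is lost below, where the two traces on the right coincide. *)
Lemma norm_mxtrace_mul A B :
  `|\tr (A * B)| <= (\tr (A * A^t*) + \tr (B * B^t*)) / 2.
Proof.
have -> : \tr (B * B^t*) = \sum_i \sum_j `|B j i| ^+ 2.
  by rewrite mxtrace_mul_adj exchange_big.
rewrite mxtrace_mul_adj -big_split /= mulr_suml.
apply: le_trans (ler_norm_sum _ _ _) _; apply: ler_sum => i _.
rewrite -big_split /= mulr_suml mxE.
apply: le_trans (ler_norm_sum _ _ _) _; apply: ler_sum => j _.
rewrite normrM ler_pdivlMr ?ltr0n // -subr_ge0.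
have -> : `|A i j| ^+ 2 + `|B j i| ^+ 2 - `|A i j| * `|B j i| * 2 =
          (`|A i j| - `|B j i|) ^+ 2 by ring.
by rewrite real_exprn_even_ge0 // realB ?normr_real.
Qed.

Lemma mxtrace_adj A : \tr (A^t*) = (\tr A)^*.
Proof. by rewrite rmorph_sum; apply: eq_bigr => i _; rewrite !mxE. Qed.

(* Both inequalities are needed to climb from [2 ^ k] to [2 ^ k.+1]. *)
Lemma mxtrace_exp2_le k :
  (forall M, \tr (M ^+ (2 ^ k) * (M^t*) ^+ (2 ^ k)) <=
             \tr ((M * M^t*) ^+ (2 ^ k))) /\
  (forall X Y, X^t* = X -> Y^t* = Y ->
     \tr ((X * Y) ^+ (2 ^ k)) <= \tr (X ^+ (2 ^ k) * Y ^+ (2 ^ k))).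
Proof.
elim: k => [|k [IHQ IHG]]; first by split=> *; rewrite !expr1.
split=> [M|X Y hX hY]; rewrite expnS; set m := (2 ^ k)%N in IHQ IHG *.
  rewrite (exprM M) (exprM (M^t*)) -(adjmxX M 2); apply: le_trans (IHQ _) _.
  have hl : (M^t* * M)^t* = M^t* * M by rewrite adjmxM trmxCK.
  have hr : (M * M^t*)^t* = M * M^t* by rewrite adjmxM trmxCK.
  (* Moving one factor around the trace exposes a product of the two Hermitian matrices [hl] and
     [hr] speak of, to which the second induction hypothesis applies. *)
  have -> : \tr ((M ^+ 2 * (M ^+ 2)^t*) ^+ m) =
            \tr ((M^t* * M * (M * M^t*)) ^+ m).
    by rewrite -[M^t* * M * _]mulrA [RHS]mxtrace_mulXC adjmxX !expr2 !mulrA.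
  apply: le_trans (IHG _ _ hl hr) _.
  have real_tr : \tr ((M^t* * M) ^+ m * (M * M^t*) ^+ m) <=
      `|\tr ((M^t* * M) ^+ m * (M * M^t*) ^+ m)|.
    apply: real_ler_norm; apply/CrealP.
    by rewrite -mxtrace_adj adjmxM !adjmxX hl hr mxtrace_mulrC.
  apply: le_trans real_tr _; apply: le_trans (norm_mxtrace_mul _ _) _.
  rewrite !adjmxX hl hr -!exprD addnn -mul2n (mxtrace_mulXC (M^t*)).
  by rewrite mulrDl -splitr.
have hM : (X * Y)^t* = Y * X by rewrite adjmxM hX hY.
have real_tr : \tr ((X * Y) ^+ (2 * m)) <= `|\tr ((X * Y) ^+ (2 * m))|.
  apply: real_ler_norm; apply/CrealP.
  by rewrite -mxtrace_adj adjmxX hM mxtrace_mulXC.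
apply: le_trans real_tr _; rewrite mulnC [in X in X <= _]exprM expr2.
apply: le_trans (norm_mxtrace_mul _ _) _.
rewrite mulrDl -splitr adjmxX.
apply: le_trans (IHQ _) _; rewrite hM.
(* Cyclically, [X Y Y X] is [X ^ 2 Y ^ 2]: the squares take the place of [X] and [Y] in the second
   induction hypothesis, which doubles the exponent. *)
have -> : \tr ((X * Y * (Y * X)) ^+ m) = \tr ((X ^+ 2 * Y ^+ 2) ^+ m).
  by rewrite -[X * Y * _]mulrA [LHS]mxtrace_mulXC [RHS]mxtrace_mulXC !mulrA.
apply: le_trans (IHG _ _ _ _) _; rewrite ?adjmxX ?hX ?hY //.
by rewrite -!exprM mulnC.
Qed.
End trace_inequalities.

(** * Row-sum bounds and the error of the Lie product formula *)

Section row_sum_bound.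
Context {F : numDomainType} {n : nat}.
Implicit Types A B : 'M[F]_n.

(** A bound on the maximal row sum, the operator norm for the sup norm. It is submultiplicative by
    elementary manipulations of sums, which is all that the Lie product formula requires. *)
Definition row_bounded (c : F) A := forall i, \sum_j `|A i j| <= c.

Lemma row_bounded_sum A : row_bounded (\sum_i \sum_j `|A i j|) A.
Proof.
move=> i; rewrite [leRHS](bigD1 i) //= lerDl; apply: sumr_ge0 => k _.
by apply: sumr_ge0 => j _.
Qed.

Lemma row_bounded1 : row_bounded 1 1.
Proof.
move=> i; rewrite (bigD1 i) //= big1 ?addr0 => [|j ji]; rewrite mxE.
  by rewrite eqxx normr1.
by rewrite eq_sym (negbTE ji) normr0.
Qed.

Lemma row_boundedZ k c A : row_bounded c A -> row_bounded (`|k| * c) (k *: A).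
Proof.
move=> Ac i; under eq_bigr do rewrite mxE normrM.
by rewrite -mulr_sumr ler_wpM2l.
Qed.

Lemma row_boundedD a b A B :
  row_bounded a A -> row_bounded b B -> row_bounded (a + b) (A + B).
Proof.
move=> Aa Bb i; apply: le_trans (lerD (Aa i) (Bb i)); rewrite -big_split /=.
by apply: ler_sum => j _; rewrite mxE ler_normD.
Qed.

Lemma row_boundedM a b A B : 0 <= b ->
  row_bounded a A -> row_bounded b B -> row_bounded (a * b) (A * B).
Proof.
move=> b0 Aa Bb i; apply: (@le_trans _ _ (\sum_j \sum_k `|A i k| * `|B k j|)).
  apply: ler_sum => j _; rewrite mxE; apply: le_trans (ler_norm_sum _ _ _) _.
  by apply: ler_sum => k _; rewrite normrM.
rewrite exchange_big /=.
apply: (@le_trans _ _ (\sum_k `|A i k| * b)).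
  by apply: ler_sum => k _; rewrite -mulr_sumr ler_wpM2l.
by rewrite -mulr_suml ler_wpM2r.
Qed.

Lemma row_boundedX a A k : 0 <= a ->
  row_bounded a A -> row_bounded (a ^+ k) (A ^+ k).
Proof.
move=> a0 Aa; elim: k => [|k IH]; first by rewrite !expr0; exact: row_bounded1.
by rewrite !exprSr; exact: row_boundedM.
Qed.

Lemma row_bounded_le a b A : a <= b -> row_bounded a A -> row_bounded b A.
Proof. by move=> ab Aa i; exact: le_trans (Aa i) ab. Qed.

(** Telescoping: [A ^ k.+1 - B ^ k.+1 = A ^ k (A - B) + (A ^ k - B ^ k) B]. Since [1 <= M], both
    terms fit under the power [M ^ k.+1]. *)
Lemma row_bounded_subX M e A B k : 1 <= M -> 0 <= e ->
  row_bounded M A -> row_bounded M B -> row_bounded e (A - B) ->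
  row_bounded (k%:R * M ^+ k * e) (A ^+ k - B ^+ k).
Proof.
move=> M1 e0 AM BM ABe; have M0 : 0 <= M by exact: le_trans M1.
elim: k => [|k IH].
  by rewrite !expr0 subrr !mul0r => i; rewrite big1 // => j _; rewrite mxE normr0.
have -> : A ^+ k.+1 - B ^+ k.+1 = A ^+ k * (A - B) + (A ^+ k - B ^+ k) * B.
  by rewrite !exprSr mulrBr mulrBl addrA subrK.
have := row_boundedD (row_boundedM e0 (row_boundedX k M0 AM) ABe)
                     (row_boundedM M0 IH BM).
apply: row_bounded_le; rewrite -natr1 !mulrDl mul1r addrC.
rewrite exprSr; set q := M ^+ k.
have q0 : 0 <= q by exact: exprn_ge0.
rewrite lerD //; first by rewrite -!mulrA (mulrC e).
by rewrite ler_wpM2r // ler_peMr.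
Qed.

Lemma row_bounded_mxtrace a A : row_bounded a A -> `|\tr A| <= n%:R * a.
Proof.
move=> Aa; apply: le_trans (ler_norm_sum _ _ _) _.
apply: (@le_trans _ _ (\sum_(i < n) a)); last first.
  by rewrite sumr_const card_ord mulr_natl.
apply: ler_sum => i _; apply: le_trans (Aa i).
by rewrite (bigD1 i) //= lerDl sumr_ge0.
Qed.

(** The two bases differ by exactly [t ^ 2 A B], and taking [m]-th powers costs a factor [m]. For
    [m t = 1] the error is of order [t]. *)
Lemma row_bounded_trotter (t a b : F) A B m : 0 <= t <= 1 ->
  0 <= a -> 0 <= b -> row_bounded a A -> row_bounded b B ->
  `|\tr ((1 + t *: (A + B)) ^+ m - ((1 + t *: A) * (1 + t *: B)) ^+ m)| <=
  n%:R * (m%:R * (1 + t * (a + b + a * b)) ^+ m * (t ^+ 2 * (a * b))).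
Proof.
move=> /andP[t0 t1] a0 b0 aA bB; apply: row_bounded_mxtrace.
have tZ c D : row_bounded c D -> row_bounded (t * c) (t *: D).
  by move=> /(row_boundedZ t); rewrite ger0_norm.
apply: row_bounded_subX.
- by rewrite lerDl mulr_ge0 // !addr_ge0 // mulr_ge0.
- by rewrite !mulr_ge0 // exprn_ge0.
- have := row_boundedD row_bounded1 (tZ _ _ (row_boundedD aA bB)).
  apply: row_bounded_le; rewrite lerD2l.
  by rewrite ler_wpM2l // lerDl mulr_ge0.
- have tb0 : 0 <= 1 + t * b by rewrite addr_ge0 // mulr_ge0.
  have := row_boundedM tb0 (row_boundedD row_bounded1 (tZ _ _ aA))
                           (row_boundedD row_bounded1 (tZ _ _ bB)).
  apply: row_bounded_le.
  have -> : (1 + t * a) * (1 + t * b) = 1 + t * (a + b + t * (a * b)) by ring.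
  by rewrite lerD2l ler_wpM2l // lerD2l ler_piMl // mulr_ge0.
have -> : 1 + t *: (A + B) - (1 + t *: A) * (1 + t *: B) =
          (- t ^+ 2) *: (A * B).
  rewrite mulrDl mulrDr mulr1 mul1r -[t *: A * _]/(_ *m _).
  rewrite mulmxDr mulmx1 -scalemxAl -scalemxAr scalerA -expr2 scaleNr scalerDr.
  by rewrite [1 + _ + (_ + _)]addrACA !addrA opprD addrA subrr add0r.
have := row_boundedZ (- t ^+ 2) (row_boundedM b0 aA bB).
by rewrite normrN ger0_norm // exprn_ge0.
Qed.

End row_sum_bound.

Section exponential_limit.
Context {R : realType}.

Lemma cvg_pow2V : (2 ^- k : R) @[k --> \oo] --> 0.
Proof.
have -> : (fun k => 2 ^- k) = GRing.exp (2^-1 : R).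
  by apply/funext => k; rewrite exprVn.
by apply: cvg_expr; rewrite ger0_norm ?invr_ge0 //; lra.
Qed.

(** With [y = a / 2 ^ k], the squeeze [expR (y / (1 + y)) <= 1 + y <= expR y] is raised to the power
    [2 ^ k]. Both halves are [1 + x <= expR x], taken at [- y / (1 + y)] and at [y]. *)
Lemma cvg_expR_pow2 (a : R) :
  (1 + 2 ^- k * a) ^+ (2 ^ k) @[k --> \oo] --> expR a.
Proof.
have ya : 2 ^- k * a @[k --> \oo] --> 0.
  rewrite -(mul0r a); apply: cvgMr_tmp; exact: cvg_pow2V.
have y1a : a / (1 + 2 ^- k * a) @[k --> \oo] --> a.
  suff : a / (1 + 2 ^- k * a) @[k --> \oo] --> a / (1 + 0).
    by rewrite addr0 divr1.
  apply: cvgM; first exact: cvg_cst.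
  apply: cvgV; first by rewrite addr0 oner_neq0.
  by apply: cvgD => //; exact: cvg_cst.
have lower : expR (a / (1 + 2 ^- k * a)) @[k --> \oo] --> expR a.
  exact: (cvg_comp _ _ y1a (@continuous_expR R a)).
apply: squeeze_cvgr lower (@cvg_cst _ _ _ _ _).
near=> k.
have : `|2 ^- k * a| < 1.
  by near: k; apply: (cvgr0_norm_lt _ ya).
set y := 2 ^- k * a => y1; have y0 : 0 < 1 + y.
  by move: y1; rewrite ltr_norml => /andP[? _]; lra.
have e2 : a = (2 ^ k)%:R * y.
  by rewrite /y natrX mulrA divff ?mul1r // expf_neq0 // pnatr_eq0.
rewrite [X in expR (X / _)]e2 [X in _ <= _ <= expR X]e2 -[_ * y / _]mulrA.
rewrite !expRM_natl; apply/andP; split; last first.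
  by apply: lerXn2r; rewrite ?nnegrE ?expR_ge0 ?(ltW y0) // expR_ge1Dx.
apply: lerXn2r; rewrite ?nnegrE ?expR_ge0 ?(ltW y0) //.
have := expR_ge1Dx (- (y / (1 + y))); rewrite expRN.
have -> : 1 + - (y / (1 + y)) = (1 + y)^-1.
  by field; rewrite gt_eqF.
by rewrite lef_pV2 ?posrE ?expR_gt0.
Unshelve. all: by end_near. Qed.

End exponential_limit.

(** * Spectral calculus and the Golden-Thompson inequality *)

Section complex_parts.
Context {R : realType}.
Implicit Types x y : R[i].

Lemma ReD x y : complex.Re (x + y) = complex.Re x + complex.Re y.
Proof. by case: x; case: y. Qed.

Lemma ImD x y : complex.Im (x + y) = complex.Im x + complex.Im y.
Proof. by case: x; case: y. Qed.

Lemma ReN x : complex.Re (- x) = - complex.Re x.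
Proof. by case: x. Qed.

Lemma ImN x : complex.Im (- x) = - complex.Im x.
Proof. by case: x. Qed.

Lemma ReM x y : complex.Re (x * y) =
  complex.Re x * complex.Re y - complex.Im x * complex.Im y.
Proof. by case: x; case: y. Qed.

Lemma ImM x y : complex.Im (x * y) =
  complex.Re x * complex.Im y + complex.Im x * complex.Re y.
Proof. by case: x; case: y. Qed.

Lemma ReC x : complex.Re x^* = complex.Re x.
Proof. by case: x. Qed.

Lemma ImC x : complex.Im x^* = - complex.Im x.
Proof. by case: x. Qed.

Lemma Re_sum (I : finType) (F : I -> R[i]) :
  complex.Re (\sum_i F i) = \sum_i complex.Re (F i).
Proof. exact: (big_morph _ ReD). Qed.

Lemma Im_sum (I : finType) (F : I -> R[i]) :
  complex.Im (\sum_i F i) = \sum_i complex.Im (F i).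
Proof. exact: (big_morph _ ImD). Qed.

Definition sqmod (x : R[i]) : R := complex.Re x ^+ 2 + complex.Im x ^+ 2.

Lemma sqmod_ge0 x : 0 <= sqmod x.
Proof. by rewrite addr_ge0 // sqr_ge0. Qed.

Lemma sqmodE x : sqmod x = complex.Re (x^* * x).
Proof. by case: x => a b; rewrite /sqmod /=; ring. Qed.

Lemma sqmodZ (a : R) x : sqmod (a%:C%C * x) = a ^+ 2 * sqmod x.
Proof. by case: x => u v; rewrite /sqmod /=; ring. Qed.

End complex_parts.

Section spectral_calculus.
Local Open Scope sesquilinear_scope.
Local Open Scope complex_scope.
Context {R : realType} {n : nat}.
Implicit Types (A B : 'M[R[i]]_n) (v : 'cV[R[i]]_n) (f g : R -> R).

Definition speig A (i : 'I_n) : R := complex.Re (spectral_diag A 0 i).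

Definition spmx A (D : 'rV[R[i]]_n) : 'M[R[i]]_n :=
  (spectralmx A)^t* *m diag_mx D *m spectralmx A.

(** Functional calculus in the chosen spectral basis. That basis is unitary for every [A], so the
    algebraic rules hold without restriction; only the link with [A] itself, [mxfun_id], requires
    [A] to be Hermitian. *)
Definition mxfun f A : 'M[R[i]]_n := spmx A (\row_i (f (speig A i))%:C).

Definition mxexp A := mxfun expR A.

Lemma spectral_mulCV A : spectralmx A *m (spectralmx A)^t* = 1%:M.
Proof. exact/unitarymxP/spectral_unitarymx. Qed.

Lemma spectral_mulVC A : (spectralmx A)^t* *m spectralmx A = 1%:M.
Proof. exact/mulmx1C/spectral_mulCV. Qed.

Lemma mxfun_id A : A \is hermsymmx -> mxfun id A = A.
Proof.
move=> hA; have /orthomx_spectralP := hermitian_normalmx hA.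
rewrite (invmx_unitary (spectral_unitarymx A)) => AE; rewrite [RHS]AE.
rewrite -[RHS]/(spmx _ _) /mxfun; congr spmx.
apply/rowP => i; rewrite mxE /speig.
have /mxOverP /(_ 0 i) := hermitian_spectral_diag_real hA.
by move=> /RRe_real.
Qed.

Lemma mxfunD f g A : mxfun f A + mxfun g A = mxfun (f \+ g) A.
Proof.
rewrite /mxfun /spmx -mulmxDl -mulmxDr -linearD /= -[LHS]/(spmx _ _).
rewrite -[RHS]/(spmx _ _); congr spmx; apply/rowP => i.
by rewrite !mxE rmorphD.
Qed.

Lemma mxfunM f g A : mxfun f A * mxfun g A = mxfun (f \* g) A.
Proof.
rewrite /mxfun; set D := \row_i _; set E := \row_i _; set G := \row_i _.
have -> : G = \row_i (D 0 i * E 0 i).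
  by apply/rowP => i; rewrite !mxE rmorphM.
rewrite -[LHS]/(_ *m _) /spmx !mulmxA -(mulmxA (_ *m diag_mx D)).
by rewrite spectral_mulCV mulmx1 -(mulmxA _ (diag_mx D)) mulmx_diag.
Qed.

Lemma mxfun_cst c A : mxfun (fun=> c) A = c%:C%:M.
Proof.
rewrite /mxfun /spmx.
have -> : diag_mx (\row_(i < n) c%:C) = c%:C%:M.
  by rewrite -diag_const_mx; congr diag_mx; apply/rowP => i; rewrite !mxE.
by rewrite mul_mx_scalar -scalemxAl spectral_mulVC scalemx1.
Qed.

Lemma mxfun1 A : mxfun (fun=> 1) A = 1.
Proof. by rewrite mxfun_cst. Qed.

Lemma mxfunX f A k : mxfun f A ^+ k = mxfun (fun a => f a ^+ k) A.
Proof.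
elim: k => [|k IH]; first by rewrite expr0 -(mxfun1 A).
by rewrite exprS IH mxfunM; congr mxfun; apply/funext => a; rewrite exprS.
Qed.

Lemma mxfun_affine t A : A \is hermsymmx ->
  1 + t%:C *: A = mxfun (fun a => 1 + t * a) A.
Proof.
move=> hA; rewrite -{1}(mxfun1 A) -{2}(mxfun_id hA).
have -> : t%:C *: mxfun id A = mxfun (fun a => t * a) A.
  have -> : mxfun (fun a => t * a) A = mxfun (fun=> t) A * mxfun id A.
    by rewrite mxfunM.
  by rewrite mxfun_cst -[RHS]/(_ *m _) mul_scalar_mx.
by rewrite mxfunD.
Qed.

Lemma mxfun_herm f A : mxfun f A \is hermsymmx.
Proof.
apply/hermsymmxP; rewrite /mxfun; set D := \row_i _.
have DE : D ^ Num.conj = D.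
  by apply/rowP => i; rewrite !mxE; exact: conjc_real.
rewrite /spmx !trmx_mul !map_mxM /= trmxCK mulmxA.
by rewrite tr_diag_mx map_diag_mx DE.
Qed.

Lemma mxtrace_mxfun f A : \tr (mxfun f A) = (\sum_i f (speig A i))%:C.
Proof.
rewrite /mxfun /spmx mxtrace_mulC mulmxA spectral_mulCV mul1mx mxtrace_diag.
by rewrite rmorph_sum; apply: eq_bigr => i _; rewrite mxE.
Qed.

Lemma mxfunE f A j k : mxfun f A j k =
  \sum_i (f (speig A i))%:C * ((spectralmx A i j)^* * spectralmx A i k).
Proof.
rewrite /mxfun /spmx mxE; apply: eq_bigr => i _.
by rewrite mul_mx_diag !mxE mulrAC mulrC.
Qed.

Definition qform A v : R := complex.Re ((v^t* *m A *m v) 0 0).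

Lemma norm2E v : norm2 v ^+ 2 = \sum_j sqmod (v j 0).
Proof. by rewrite sqr_sqrtr // sumr_ge0 // => j _; exact: sqmod_ge0. Qed.

Lemma norm2_ge0 v : 0 <= norm2 v.
Proof. exact: sqrtr_ge0. Qed.

Lemma qform_adj A v : qform (A^t* *m A) v = norm2 (A *m v) ^+ 2.
Proof.
rewrite norm2E /qform mulmxA -map_mxM -trmx_mul -mulmxA mxE Re_sum.
by apply: eq_bigr => i _; rewrite sqmodE !mxE.
Qed.

Lemma qform1 v : qform 1%:M v = norm2 v ^+ 2.
Proof. by rewrite -[v in RHS]mul1mx -qform_adj trmx1 map_mx1 mul1mx. Qed.

Lemma qformE A v : qform A v =
  \sum_j \sum_k complex.Re (A j k * ((v j 0)^* * v k 0)).
Proof.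
rewrite /qform mxE Re_sum exchange_big /=; apply: eq_bigr => k _.
rewrite mxE mulr_suml Re_sum; apply: eq_bigr => j _.
by rewrite !mxE mulrA (mulrC (A j k)).
Qed.

Lemma qformD A B v : qform (A + B) v = qform A v + qform B v.
Proof. by rewrite /qform mulmxDr mulmxDl mxE ReD. Qed.

Lemma qformN A v : qform (- A) v = - qform A v.
Proof. by rewrite /qform mulmxN mulNmx mxE ReN. Qed.

Lemma qformZ a A v : qform (a%:C *: A) v = a * qform A v.
Proof. by rewrite /qform -scalemxAr -scalemxAl mxE ReM mul0r subr0. Qed.

(** The spectral measure of [A] at [v]: its mass is [norm2 v ^+ 2], and integrating [f] against it
    gives the quadratic form of [mxfun f A]. Scalar inequalities thereby become inequalities between
    quadratic forms. *)
Definition spweight A v i : R := sqmod ((spectralmx A *m v) i 0).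

Lemma spweight_ge0 A v i : 0 <= spweight A v i.
Proof. exact: sqmod_ge0. Qed.

Lemma qform_mxfun f A v :
  qform (mxfun f A) v = \sum_i f (speig A i) * spweight A v i.
Proof.
rewrite /qform /mxfun /spmx !mulmxA -map_mxM -trmx_mul -mulmxA mxE Re_sum.
apply: eq_bigr => i _; rewrite /spweight sqmodE mul_mx_diag !mxE mulrAC.
by rewrite ReM mulrC /= mulr0 subr0.
Qed.

Lemma sum_spweight A v : \sum_i spweight A v i = norm2 v ^+ 2.
Proof.
rewrite -qform1 -(mxfun_cst 1 A) qform_mxfun.
by apply: eq_bigr => i _; rewrite mul1r.
Qed.

Lemma qform_eig A v : A \is hermsymmx ->
  qform A v = \sum_i speig A i * spweight A v i.
Proof. by move=> hA; rewrite -{1}(mxfun_id hA) qform_mxfun. Qed.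

Lemma norm2_eig A v : A \is hermsymmx ->
  norm2 (A *m v) ^+ 2 = \sum_i speig A i ^+ 2 * spweight A v i.
Proof.
move=> hA; rewrite -qform_adj (hermsymmxP _ hA) -{1 2}(mxfun_id hA).
by rewrite -[_ *m _]/(_ * _) mxfunM qform_mxfun.
Qed.

Definition speigvec A i : 'cV[R[i]]_n := (spectralmx A)^t* *m delta_mx i 0.

Lemma spweight_speigvec A i j : spweight A (speigvec A i) j = (i == j)%:R.
Proof.
rewrite /spweight mulmxA spectral_mulCV mul1mx mxE eqxx andbT eq_sym.
by case: eqP => _; rewrite /sqmod /=; ring.
Qed.

Lemma norm2_speigvec A i : norm2 (speigvec A i) = 1.
Proof.
apply/eqP; rewrite -(@eqrXn2 _ 2) ?norm2_ge0 // expr1n -(sum_spweight A).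
rewrite (bigD1 i) //= big1 ?addr0 => [|j ji]; rewrite spweight_speigvec.
  by rewrite eqxx.
by rewrite eq_sym (negbTE ji).
Qed.

Lemma qform_speigvec A i : A \is hermsymmx ->
  qform A (speigvec A i) = speig A i.
Proof.
move=> hA; rewrite qform_eig // (bigD1 i) //= big1 ?addr0 => [|j ji].
  by rewrite spweight_speigvec eqxx mulr1.
by rewrite spweight_speigvec eq_sym (negbTE ji) mulr0.
Qed.

End spectral_calculus.

Section operator_norm.
Local Open Scope sesquilinear_scope.
Local Open Scope complex_scope.
Context {R : realType} {n : nat}.
Implicit Types (A B H : 'M[R[i]]_n) (v : 'cV[R[i]]_n).

Lemma adj_mul_herm A : A^t* *m A \is hermsymmx.
Proof. by apply/hermsymmxP; rewrite trmx_mul map_mxM trmxCK. Qed.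

(** Makes the supremum in [opnorm] a genuine one, [sup] having a default value on unbounded sets.
    The constant is crude: the square root of the sum of the absolute eigenvalues of [A^t* *m A]. *)
Lemma norm2_mulmx_bounded A :
  exists2 c : R, 0 <= c & forall v, norm2 (A *m v) <= c * norm2 v.
Proof.
pose H := A^t* *m A; pose c := \sum_i `|speig H i|.
have c0 : 0 <= c by exact: sumr_ge0.
exists (Num.sqrt c) => [|v]; first exact: sqrtr_ge0.
rewrite -(@ler_pXn2r _ 2) ?nnegrE ?mulr_ge0 ?norm2_ge0 ?sqrtr_ge0 //.
rewrite exprMn (sqr_sqrtr c0) -qform_adj qform_eig ?adj_mul_herm //.
rewrite -(sum_spweight H) mulr_sumr; apply: ler_sum => i _.
rewrite ler_wpM2r ?spweight_ge0 //; apply: le_trans (ler_norm _) _.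
by rewrite /c (bigD1 i) //= lerDl sumr_ge0.
Qed.

Lemma norm20 : norm2 (0 : 'cV[R[i]]_n) = 0.
Proof.
apply/eqP; rewrite -sqrf_eq0 norm2E big1 // => j _.
by rewrite mxE /sqmod /= expr0n addr0.
Qed.

Lemma norm2_le_opnorm A v : norm2 v <= 1 -> norm2 (A *m v) <= opnorm A.
Proof.
move=> v1; have [c c0 Ac] := norm2_mulmx_bounded A.
apply: ub_le_sup; last by exists v.
exists c => _ [u u1 <-]; apply: le_trans (Ac u) _.
by rewrite -[leRHS]mulr1 ler_wpM2l.
Qed.

Lemma opnorm_ge0 A : 0 <= opnorm A.
Proof.
have := @norm2_le_opnorm A 0; rewrite norm20 => /(_ ler01).
exact/le_trans/norm2_ge0.
Qed.

Lemma opnorm_le A c : 0 <= c ->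
  (forall v, norm2 (A *m v) <= c * norm2 v) -> opnorm A <= c.
Proof.
move=> c0 Ac; apply: ge_sup.
  by exists (norm2 (A *m 0)), 0 => //=; rewrite norm20.
move=> _ [u u1 <-]; apply: le_trans (Ac u) _.
by rewrite -[leRHS]mulr1 ler_wpM2l.
Qed.

(** The [k]-th basis vector is the test vector. Through this bound, integrability of an operator
    norm passes to the entries. *)
Lemma sqmod_le_opnorm A j k : sqmod (A j k) <= opnorm A ^+ 2.
Proof.
have k1 : norm2 (delta_mx k 0 : 'cV[R[i]]_n) <= 1.
  rewrite -(@ler_pXn2r _ 2) ?nnegrE ?norm2_ge0 // norm2E expr1n.
  rewrite (bigD1 k) //= big1 ?addr0 => [|l lk].
    by rewrite mxE !eqxx /sqmod /= expr1n expr0n addr0.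
  by rewrite mxE (negbTE lk) /sqmod /= expr0n addr0.
apply: (@le_trans _ _ (norm2 (A *m delta_mx k 0) ^+ 2)).
  rewrite norm2E -colE (bigD1 j) //= mxE lerDl.
  by apply: sumr_ge0 => l _; exact: sqmod_ge0.
rewrite ler_pXn2r ?nnegrE ?norm2_ge0 ?opnorm_ge0 //.
exact: norm2_le_opnorm.
Qed.

Lemma normr_Re_le_opnorm A j k : `|complex.Re (A j k)| <= opnorm A.
Proof.
rewrite -(@ler_pXn2r _ 2) ?nnegrE ?opnorm_ge0 // real_normK ?num_real //.
by apply: le_trans (sqmod_le_opnorm A j k); rewrite lerDl sqr_ge0.
Qed.

Lemma normr_Im_le_opnorm A j k : `|complex.Im (A j k)| <= opnorm A.
Proof.
rewrite -(@ler_pXn2r _ 2) ?nnegrE ?opnorm_ge0 // real_normK ?num_real //.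
by apply: le_trans (sqmod_le_opnorm A j k); rewrite lerDr sqr_ge0.
Qed.

Lemma speig_le_opnorm H i : H \is hermsymmx -> `|speig H i| <= opnorm H.
Proof.
move=> hH; have := @norm2_le_opnorm H (speigvec H i).
rewrite norm2_speigvec => /(_ (lexx _)); apply: le_trans.
rewrite -(@ler_pXn2r _ 2) ?nnegrE ?norm2_ge0 // real_normK ?num_real //.
rewrite norm2_eig // (bigD1 i) //= spweight_speigvec eqxx mulr1 lerDl.
by apply: sumr_ge0 => j _; rewrite mulr_ge0 ?sqr_ge0 ?spweight_ge0.
Qed.

Lemma opnorm_le_speig H c : H \is hermsymmx -> 0 <= c ->
  (forall i, `|speig H i| <= c) -> opnorm H <= c.
Proof.
move=> hH c0 Hc; apply: opnorm_le => // v.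
rewrite -(@ler_pXn2r _ 2) ?nnegrE ?mulr_ge0 ?norm2_ge0 //.
rewrite exprMn norm2_eig // -(sum_spweight H) mulr_sumr.
apply: ler_sum => i _; rewrite ler_wpM2r ?spweight_ge0 //.
by rewrite -[leLHS]real_normK ?num_real // ler_pXn2r ?nnegrE.
Qed.

Lemma norm2_mulmx_le H v : H \is hermsymmx ->
  norm2 (H *m v) <= opnorm H * norm2 v.
Proof.
move=> hH; rewrite -(@ler_pXn2r _ 2) ?nnegrE ?mulr_ge0 ?opnorm_ge0 ?norm2_ge0 //.
rewrite exprMn norm2_eig // -(sum_spweight H) mulr_sumr.
apply: ler_sum => i _; rewrite ler_wpM2r ?spweight_ge0 //.
by rewrite -[leLHS]real_normK ?num_real // ler_pXn2r ?nnegrE ?opnorm_ge0 // speig_le_opnorm.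
Qed.

(** Connects [lambda_max], defined by [eigenvalue], with the spectral diagonal. A row eigenvector
    [v], written in the spectral basis as [u], is an eigenvector of a diagonal matrix, and any
    nonzero coordinate of [u] reads off the eigenvalue. *)
Lemma eigenvalue_herm H a : H \is hermsymmx ->
  eigenvalue H a%:C <-> exists i, a = speig H i.
Proof.
move=> hH; have HE := mxfun_id hH; split=> [/eigenvalueP[v vH v0]|[i ->]].
  pose u := v *m (spectralmx H)^t*.
  have u0 : u != 0.
    apply: contra_neq v0 => u0.
    by rewrite -[v]mulmx1 -(spectral_mulVC H) mulmxA -/u u0 mul0mx.
  have uE : u *m diag_mx (\row_i (speig H i)%:C) = a%:C *: u.
    have vHE : v *m H = u *m diag_mx (\row_i (speig H i)%:C) *m spectralmx H.
      by rewrite -[in LHS]HE /mxfun /spmx !mulmxA.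
    by rewrite {2}/u scalemxAl -vH vHE -(mulmxA _ (spectralmx H)) spectral_mulCV mulmx1.
  clearbody u; have [i ui] : exists i, u 0 i != 0.
    apply/existsP; apply: contraNT u0; rewrite negb_exists => /forallP u0.
    by apply/eqP/rowP => i; rewrite [RHS]mxE; have := u0 i; rewrite negbK => /eqP.
  exists i; have /rowP/(_ i) := uE.
  by rewrite mul_mx_diag !mxE mulrC => /(mulIf ui) [].
apply/eigenvalueP; exists (row i (spectralmx H)).
  have UH : spectralmx H *m H =
      diag_mx (\row_i (speig H i)%:C) *m spectralmx H.
    by rewrite -{2}HE /mxfun /spmx 2!mulmxA spectral_mulCV mul1mx.
  by rewrite -row_mul UH row_mul row_diag_mx mxE -scalemxAl -rowE.
apply/eqP => r0; have /matrixP/(_ i i) := spectral_mulCV H.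
rewrite [RHS]mxE eqxx [LHS]mxE big1 => [|j _]; first by move/eqP; rewrite eq_sym oner_eq0.
by have /rowP/(_ j) := r0; rewrite !mxE => ->; rewrite mul0r.
Qed.

Lemma lambda_maxP H : (0 < n)%N -> H \is hermsymmx ->
  (exists i, lambda_max H = speig H i) /\
  (forall i, speig H i <= lambda_max H).
Proof.
move=> n0 hH; pose i0 : 'I_n := Ordinal n0.
case: (@arg_maxP _ _ _ i0 xpredT (speig H) isT) => i _ imax.
have lE : lambda_max H = speig H i.
  apply/eqP; rewrite eq_le; apply/andP; split.
    apply: ge_sup; first by exists (speig H i); apply/eigenvalue_herm => //; exists i.
    by move=> a /= /(eigenvalue_herm _ hH)[j ->]; exact: imax.
  apply: ub_le_sup; last by apply/eigenvalue_herm => //; exists i.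
  by exists (speig H i) => a /= /(eigenvalue_herm _ hH)[j ->]; exact: imax.
by split=> [|j]; [exists i | rewrite lE; exact: imax].
Qed.

Lemma qform_le_lambda_max H v : (0 < n)%N -> H \is hermsymmx ->
  qform H v <= lambda_max H * norm2 v ^+ 2.
Proof.
move=> n0 hH; have [_ hmax] := lambda_maxP n0 hH.
rewrite qform_eig // -(sum_spweight H) mulr_sumr.
by apply: ler_sum => i _; rewrite ler_wpM2r ?spweight_ge0.
Qed.

End operator_norm.

(** * The Lie product formula and the Golden-Thompson inequality *)

Section golden_thompson.
Local Open Scope sesquilinear_scope.
Local Open Scope complex_scope.
Context {R : realType} {n : nat}.
Implicit Types A B : 'M[R[i]]_n.

Lemma Re_mxtrace_mul A B : complex.Re (\tr (A * B)) = \sum_j \sum_k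
  (complex.Re (A j k) * complex.Re (B k j) -
   complex.Im (A j k) * complex.Im (B k j)).
Proof.
rewrite Re_sum; apply: eq_bigr => j _; rewrite mxE Re_sum.
by apply: eq_bigr => k _; rewrite ReM.
Qed.

Lemma Re_mxfunE (f : R -> R) A j k : complex.Re (mxfun f A j k) =
  \sum_i f (speig A i) * complex.Re ((spectralmx A i j)^* * spectralmx A i k).
Proof. by rewrite mxfunE Re_sum; apply: eq_bigr => i _; rewrite ReM /= mul0r subr0. Qed.

Lemma Im_mxfunE (f : R -> R) A j k : complex.Im (mxfun f A j k) =
  \sum_i f (speig A i) * complex.Im ((spectralmx A i j)^* * spectralmx A i k).
Proof. by rewrite mxfunE Im_sum; apply: eq_bigr => i _; rewrite ImM /= mul0r addr0. Qed.

Lemma cvg_sumr (I : Type) (r : seq I) (f : nat -> I -> R) (g : I -> R) :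
  (forall i, f k i @[k --> \oo] --> g i) ->
  (\sum_(i <- r) f k i) @[k --> \oo] --> \sum_(i <- r) g i.
Proof.
move=> fg; elim: r => [|i r IH].
  by rewrite big_nil; under eq_fun do rewrite big_nil; exact: cvg_cst.
rewrite big_cons; under eq_fun do rewrite big_cons.
exact: cvgD.
Qed.

Lemma cvg_sum_mull (I : finType) (f : nat -> I -> R) (g c : I -> R) :
  (forall i, f k i @[k --> \oo] --> g i) ->
  (\sum_i f k i * c i) @[k --> \oo] --> \sum_i g i * c i.
Proof.
by move=> fg; apply: cvg_sumr => i; apply: cvgMr_tmp; exact: fg.
Qed.

(** The exponents are powers of two to match [mxtrace_exp2_le]. Being polynomial in the entries of
    [A], these approximations also yield the measurability of the exponential. *)
Definition mxexp_approx k A : 'M[R[i]]_n :=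
  (1 + (2 ^- k)%:C *: A) ^+ (2 ^ k).

Lemma mxexp_approxE k A : A \is hermsymmx ->
  mxexp_approx k A = mxfun (fun a => (1 + 2 ^- k * a) ^+ (2 ^ k)) A.
Proof. by move=> hA; rewrite /mxexp_approx mxfun_affine // mxfunX. Qed.

Lemma cvg_Re_mxexp A j l : A \is hermsymmx ->
  complex.Re (mxexp_approx k A j l) @[k --> \oo] --> complex.Re (mxexp A j l).
Proof.
move=> hA; under eq_fun do rewrite mxexp_approxE // Re_mxfunE.
rewrite Re_mxfunE; apply: cvg_sum_mull => i; exact: cvg_expR_pow2.
Qed.

Lemma cvg_Im_mxexp A j l : A \is hermsymmx ->
  complex.Im (mxexp_approx k A j l) @[k --> \oo] --> complex.Im (mxexp A j l).
Proof.
move=> hA; under eq_fun do rewrite mxexp_approxE // Im_mxfunE.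
rewrite Im_mxfunE; apply: cvg_sum_mull => i; exact: cvg_expR_pow2.
Qed.

Lemma cvg_Re_mxtrace_mul (F G : nat -> 'M[R[i]]_n) A B :
  (forall j l, complex.Re (F k j l) @[k --> \oo] --> complex.Re (A j l)) ->
  (forall j l, complex.Im (F k j l) @[k --> \oo] --> complex.Im (A j l)) ->
  (forall j l, complex.Re (G k j l) @[k --> \oo] --> complex.Re (B j l)) ->
  (forall j l, complex.Im (G k j l) @[k --> \oo] --> complex.Im (B j l)) ->
  complex.Re (\tr (F k * G k)) @[k --> \oo] --> complex.Re (\tr (A * B)).
Proof.
move=> rF iF rG iG; under eq_fun do rewrite Re_mxtrace_mul.
rewrite Re_mxtrace_mul; apply: cvg_sumr => j; apply: cvg_sumr => l.
by apply: cvgB; apply: cvgM.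
Qed.

Lemma cvg_Re_mxtrace (F : nat -> 'M[R[i]]_n) A :
  (forall j l, complex.Re (F k j l) @[k --> \oo] --> complex.Re (A j l)) ->
  complex.Re (\tr (F k)) @[k --> \oo] --> complex.Re (\tr A).
Proof.
move=> rF; under eq_fun do rewrite Re_sum.
by rewrite Re_sum; apply: cvg_sumr => j; exact: rF.
Qed.

Lemma row_bounded_real A : exists2 a : R, 0 <= a & row_bounded a%:C A.
Proof.
have s0 : 0 <= \sum_i \sum_j `|A i j|.
  by apply: sumr_ge0 => i _; apply: sumr_ge0.
exists (complex.Re (\sum_i \sum_j `|A i j|)).
  by move: s0; rewrite lecE => /andP[].
by rewrite RRe_real ?ger0_real //; exact: row_bounded_sum.
Qed.

Lemma lie_trotter A B :
  (complex.Re (\tr (mxexp_approx k (A + B))) -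
   complex.Re (\tr (((1 + (2 ^- k)%:C *: A) * (1 + (2 ^- k)%:C *: B)) ^+ (2 ^ k))))
   @[k --> \oo] --> 0.
Proof.
have [a a0 aA] := row_bounded_real A; have [b b0 bB] := row_bounded_real B.
(* With [t = 2 ^- k], [m = 2 ^ k] and [c = a + b + a * b], the error bound contains
   [m * (1 + t * c) ^ m * t ^ 2], which is at most [expR c * t] because [m * t = 1]. *)
pose K : R := n%:R * (expR (a + b + a * b) * (a * b)).
have bound k : `|complex.Re (\tr (mxexp_approx k (A + B))) -
   complex.Re (\tr (((1 + (2 ^- k)%:C *: A) * (1 + (2 ^- k)%:C *: B)) ^+ (2 ^ k)))|
   <= K * 2 ^- k.
  set t : R := 2 ^- k; have t0 : 0 < t by rewrite invr_gt0 exprn_gt0.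
  have t1 : t <= 1 by rewrite invf_le1 ?exprn_gt0 // exprn_ege1 // ler1n.
  have tk : (2 ^ k)%:R * t = 1.
    by rewrite /t natrX divff // expf_neq0 // pnatr_eq0.
  have := @row_bounded_trotter _ _ t%:C a%:C b%:C A B (2 ^ k).
  rewrite !lecR (ltW t0) t1 => /(_ isT a0 b0 aA bB).
  rewrite -/(mxexp_approx k (A + B)) linearB /=.
  move=> le1; rewrite -lecR -ReN -ReD.
  apply: le_trans (normc_ge_Re _) _; apply: le_trans le1 _.
  rewrite -[n%:R](rmorph_nat (real_complex R)).
  rewrite -[(2 ^ k)%:R](rmorph_nat (real_complex R)).
  rewrite -(rmorph1 (real_complex R)) -!(rmorphM, rmorphD, rmorphXn) /= lecR.
  have -> : n%:R * ((2 ^ k)%:R * (1 + t * (a + b + a * b)) ^+ (2 ^ k) *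
            (t ^+ 2 * (a * b))) =
      n%:R * ((1 + t * (a + b + a * b)) ^+ (2 ^ k) * (a * b)) * t *
      ((2 ^ k)%:R * t) by ring.
  rewrite tk mulr1 ler_wpM2r ?(ltW t0) // ler_wpM2l // ler_wpM2r ?mulr_ge0 //.
  have -> : a + b + a * b = (2 ^ k)%:R * (t * (a + b + a * b)).
    by rewrite mulrA tk mul1r.
  rewrite expRM_natl (mulrA _ t) tk mul1r.
  apply: lerXn2r; rewrite ?nnegrE ?expR_ge0 ?expR_ge1Dx //.
  by rewrite addr_ge0 // mulr_ge0 ?(ltW t0) // !addr_ge0 // mulr_ge0.
have Kt : K * 2 ^- k @[k --> \oo] --> 0.
  by rewrite -(mulr0 K); apply: cvgMl_tmp; exact: cvg_pow2V.
apply/norm_cvg0P; apply: squeeze_cvgr (@cvg_cst _ _ _ _ _) Kt.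
by near=> k; rewrite normr_ge0 bound.
Unshelve. all: by end_near. Qed.

(** The intermediate sequence [v] has the limit of [mxexp_approx k (A + B)] by [lie_trotter]; for
    each [k] it lies below the trace of the product of the two approximations by
    [mxtrace_exp2_le]. *)
Lemma golden_thompson A B : A \is hermsymmx -> B \is hermsymmx ->
  complex.Re (\tr (mxexp (A + B))) <= complex.Re (\tr (mxexp A * mxexp B)).
Proof.
move=> hA hB.
have hAB : A + B \is hermsymmx.
  by apply/hermsymmxP; rewrite adjmxD !(hermsymmxP _ _).
pose u k := complex.Re (\tr (mxexp_approx k (A + B))).
pose v k := complex.Re (\tr (((1 + (2 ^- k)%:C *: A) *
                              (1 + (2 ^- k)%:C *: B)) ^+ (2 ^ k))).
have uv : u k - v k @[k --> \oo] --> 0 by exact: lie_trotter.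
have ul : u k @[k --> \oo] --> complex.Re (\tr (mxexp (A + B))).
  by apply: cvg_Re_mxtrace => j l; exact: cvg_Re_mxexp.
have vl : v k @[k --> \oo] --> complex.Re (\tr (mxexp (A + B))).
  have -> : v = (fun k => u k - (u k - v k)).
    by apply/funext => k; rewrite subKr.
  by rewrite -[X in _ --> X]subr0; apply: cvgB.
have wl := cvg_Re_mxtrace_mul (fun j l => @cvg_Re_mxexp A j l hA)
  (fun j l => @cvg_Im_mxexp A j l hA) (fun j l => @cvg_Re_mxexp B j l hB)
  (fun j l => @cvg_Im_mxexp B j l hB).
apply: ler_cvg_to vl wl _; near=> k.
have affine_herm (D : 'M[R[i]]_n) : D \is hermsymmx ->
    (1 + (2 ^- k)%:C *: D)^t* = 1 + (2 ^- k)%:C *: D.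
  by move=> hD; rewrite mxfun_affine //; apply/hermsymmxP/mxfun_herm.
have [_ /(_ _ _ (affine_herm _ hA) (affine_herm _ hB))] :=
  @mxtrace_exp2_le R[i] n k.
by rewrite lecE => /andP[].
Unshelve. all: by end_near. Qed.

End golden_thompson.

(** * Measurability of spectral quantities *)

Section measurable_matrices.
Local Open Scope sesquilinear_scope.
Local Open Scope complex_scope.
Context {d0 : measure_display} {T0 : measurableType d0} {R : realType} {n : nat}.
Implicit Types M N : T0 -> 'M[R[i]]_n.

(** Entrywise form of [random_mx], stable under matrix operations; [random_mx_measurable] shows the
    two to be equivalent. *)
Definition mx_measurable M := forall j k,
  measurable_fun setT (fun w => complex.Re (M w j k)) /\
  measurable_fun setT (fun w => complex.Im (M w j k)).

Lemma mx_measurable_cst A : mx_measurable (fun=> A).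
Proof. by move=> j k; split; exact: measurable_cst. Qed.

Lemma mx_measurableD M N :
  mx_measurable M -> mx_measurable N -> mx_measurable (fun w => M w + N w).
Proof.
move=> mM mN j k; have [rM iM] := mM j k; have [rN iN] := mN j k.
split.
  under eq_fun do rewrite mxE ReD; exact: measurable_funD.
under eq_fun do rewrite mxE ImD; exact: measurable_funD.
Qed.

Lemma mx_measurableM M N :
  mx_measurable M -> mx_measurable N -> mx_measurable (fun w => M w * N w).
Proof.
move=> mM mN j k; split.
  under eq_fun do rewrite mxE Re_sum.
  apply: measurable_sum => l.
  have [rM iM] := mM j l; have [rN iN] := mN l k.
  under eq_fun do rewrite ReM.
  by apply: measurable_funB; apply: measurable_funM.
under eq_fun do rewrite mxE Im_sum.
apply: measurable_sum => l.
have [rM iM] := mM j l; have [rN iN] := mN l k.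
under eq_fun do rewrite ImM.
by apply: measurable_funD; apply: measurable_funM.
Qed.

Lemma mx_measurableX M k :
  mx_measurable M -> mx_measurable (fun w => M w ^+ k).
Proof.
move=> mM; elim: k => [|k IH].
  by under eq_fun do rewrite expr0; exact: mx_measurable_cst.
under eq_fun do rewrite exprS; exact: mx_measurableM.
Qed.

Lemma mx_measurableZ a M :
  mx_measurable M -> mx_measurable (fun w => a *: M w).
Proof.
move=> mM; have := mx_measurableM (mx_measurable_cst a%:M) mM.
by under eq_fun do rewrite -[_ * _]/(_ *m _) mul_scalar_mx.
Qed.

Lemma mx_measurableN M : mx_measurable M -> mx_measurable (fun w => - M w).
Proof.
by move=> /(mx_measurableZ (-1)); under eq_fun do rewrite scaleN1r.
Qed.

Lemma mx_measurableB M N :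
  mx_measurable M -> mx_measurable N -> mx_measurable (fun w => M w - N w).
Proof. by move=> mM mN; apply: mx_measurableD => //; exact: mx_measurableN. Qed.

Lemma mx_measurable_sum (I : Type) (r : seq I) (p : pred I)
    (M : I -> T0 -> 'M[R[i]]_n) :
  (forall i, p i -> mx_measurable (M i)) ->
  mx_measurable (fun w => \sum_(i <- r | p i) M i w).
Proof.
move=> mM; elim: r => [|i r IH].
  by under eq_fun do rewrite big_nil; exact: mx_measurable_cst.
have [pi|/negbTE npi] := boolP (p i).
  by under eq_fun do rewrite big_cons pi; apply: mx_measurableD => //; exact: mM.
by under eq_fun do rewrite big_cons npi.
Qed.

Lemma measurable_Re_mxtrace M : mx_measurable M ->
  measurable_fun setT (fun w => complex.Re (\tr (M w))).
Proof.
move=> mM; under eq_fun do rewrite Re_sum.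
by apply: measurable_sum => j; have [] := mM j j.
Qed.

Lemma measurable_qform M v : mx_measurable M ->
  measurable_fun setT (fun w => qform (M w) v).
Proof.
move=> mM; under eq_fun do rewrite qformE.
apply: measurable_sum => j; apply: measurable_sum => k.
have [rM iM] := mM j k; under eq_fun do rewrite ReM.
by apply: measurable_funB; apply: measurable_funM => //; exact: measurable_cst.
Qed.

(** The spectral basis comes from a choice and carries no measurability; the exponential is
    therefore treated as a pointwise limit of polynomials. *)
Lemma mx_measurable_exp M : mx_measurable M ->
  (forall w, M w \is hermsymmx) -> mx_measurable (fun w => mxexp (M w)).
Proof.
move=> mM hM.
have mA k : mx_measurable (fun w => mxexp_approx k (M w)).
  apply: mx_measurableX; apply: mx_measurableD; first exact: mx_measurable_cst.
  exact: mx_measurableZ.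
move=> j l; split.
  apply: (@measurable_fun_cvg _ _ _ _
    (fun k w => complex.Re (mxexp_approx k (M w) j l))).
    by move=> k; have [] := mA k j l.
  by move=> w _; exact: cvg_Re_mxexp.
apply: (@measurable_fun_cvg _ _ _ _
  (fun k w => complex.Im (mxexp_approx k (M w) j l))).
  by move=> k; have [] := mA k j l.
by move=> w _; exact: cvg_Im_mxexp.
Qed.

End measurable_matrices.

Section eigenvalue_estimates.
Local Open Scope sesquilinear_scope.
Local Open Scope complex_scope.
Context {R : realType} {n : nat}.
Implicit Types H : 'M[R[i]]_n.

Lemma hermZ (t : R) H : H \is hermsymmx -> t%:C *: H \is hermsymmx.
Proof.
move=> /hermsymmxP hH; apply/hermsymmxP/matrixP => j k.
move: hH => /matrixP/(_ j k); rewrite !mxE => hjk.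
by rewrite rmorphM; congr (_ * _) => //; exact: conjc_real.
Qed.

Lemma hermD (A B : 'M[R[i]]_n) : A \is hermsymmx -> B \is hermsymmx ->
  A + B \is hermsymmx.
Proof.
by move=> hA hB; apply/hermsymmxP; rewrite adjmxD !(hermsymmxP _ _).
Qed.

Lemma hermN H : H \is hermsymmx -> - H \is hermsymmx.
Proof.
by move=> /(@hermZ (-1)); rewrite rmorphN rmorph1 scaleN1r.
Qed.

Lemma herm0 : (0 : 'M[R[i]]_n) \is hermsymmx.
Proof. by apply/hermsymmxP; rewrite trmx0 map_mx0. Qed.

Lemma herm_sum (I : Type) (r : seq I) (p : pred I) (F : I -> 'M[R[i]]_n) :
  (forall i, F i \is hermsymmx) -> \sum_(i <- r | p i) F i \is hermsymmx.
Proof.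
move=> hF; apply: (big_ind (fun A => A \is hermsymmx)).
- exact: herm0.
- by move=> A B; exact: hermD.
- by move=> i _; exact: hF.
Qed.

(* The spectral decompositions of [H] and [t H] are chosen independently, so
   eigenvalues are compared through the characterisation of [eigenvalue]. *)
Lemma speigZ (t : R) H i : t != 0 -> H \is hermsymmx ->
  exists j, speig (t%:C *: H) j = t * speig H i.
Proof.
move=> t0 hH; have /eigenvalue_herm-/(_ hH)/eigenvalueP[v vH v0] :
  exists k, speig H i = speig H k by exists i.
have : eigenvalue (t%:C *: H) (t * speig H i)%:C%C.
  apply/eigenvalueP; exists v => //.
  by rewrite -scalemxAr vH scalerA rmorphM.
by move=> /(eigenvalue_herm _ (hermZ t hH)) [j ->]; exists j.
Qed.

End eigenvalue_estimates.

Section measurable_eigenvalues.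
Local Open Scope sesquilinear_scope.
Local Open Scope complex_scope.
Context {d0 : measure_display} {T0 : measurableType d0} {R : realType} {n : nat}.
Hypothesis n_gt0 : (0 < n)%N.
Implicit Types M N : T0 -> 'M[R[i]]_n.

Lemma lambda_maxZ (t : R) (H : 'M[R[i]]_n) : 0 < t -> H \is hermsymmx ->
  lambda_max (t%:C *: H) = t * lambda_max H.
Proof.
move=> t0 hH; have hT := hermZ t hH; have tn0 := lt0r_neq0 t0.
have [[i iE] iM] := lambda_maxP n_gt0 hH.
have [[j jE] jM] := lambda_maxP n_gt0 hT.
apply/eqP; rewrite eq_le; apply/andP; split.
  have [k kE] := speigZ j (invr_neq0 tn0) hT.
  rewrite scalerA -rmorphM mulVf // rmorph1 scale1r in kE.
  by rewrite jE -ler_pdivrMl // -kE.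
by have [k kE] := speigZ i tn0 hH; rewrite iE -kE.
Qed.

(** The lower half is the passage from eigenvalues to traces in the Laplace transform method; the
    two halves together give [cvg_lambda_max]. *)
Lemma lambda_max_trace (H : 'M[R[i]]_n) : H \is hermsymmx ->
  expR (lambda_max H) <= complex.Re (\tr (mxexp H)) <=
  n%:R * expR (lambda_max H).
Proof.
move=> hH; have [[i iE] iM] := lambda_maxP n_gt0 hH.
rewrite mxtrace_mxfun /=; apply/andP; split.
  by rewrite iE (bigD1 i) //= lerDl sumr_ge0 // => j _; rewrite expR_ge0.
rewrite -[n in n%:R]card_ord mulr_natl -sumr_const.
by apply: ler_sum => j _; rewrite ler_expR.
Qed.

(** A soft maximum: the factor [n] in the trace bound is killed by [k.+1%:R^-1]. It exhibits the
    largest eigenvalue as a limit of measurable functions, which its definition as a supremum does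
    not. *)
Lemma cvg_lambda_max (H : 'M[R[i]]_n) : H \is hermsymmx ->
  k.+1%:R^-1 * ln (complex.Re (\tr (mxexp (k.+1%:R%:C *: H)))) @[k --> \oo]
  --> lambda_max H.
Proof.
move=> hH; pose u (k : nat) : R := lambda_max H + k.+1%:R^-1 * ln n%:R.
have ul : u k @[k --> \oo] --> lambda_max H.
  rewrite -[X in _ --> X]addr0; apply: cvgD; first exact: cvg_cst.
  rewrite -(mul0r (ln n%:R)); apply: cvgMr_tmp; exact: cvg_harmonic.
apply: squeeze_cvgr (@cvg_cst _ _ _ _ _) ul; near=> k.
have k0 : 0 < k.+1%:R :> R by [].
have /andP[lo hi] := lambda_max_trace (hermZ k.+1%:R hH).
rewrite lambda_maxZ // in lo hi.
have n0 : 0 < n%:R :> R by rewrite ltr0n.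
set s := complex.Re _ in lo hi *; have s0 : 0 < s.
  by apply: lt_le_trans lo; rewrite expR_gt0.
rewrite ler_pdivlMl // -{1}[_ * _]expRK ler_ln ?posrE ?expR_gt0 // lo /=.
rewrite ler_pdivrMl // /u mulrDr mulrA mulfV ?lt0r_neq0 // mul1r addrC.
rewrite -[X in _ + X]expRK -lnM ?posrE ?expR_gt0 //.
by rewrite ler_ln ?posrE // mulr_gt0 // expR_gt0.
Unshelve. all: by end_near. Qed.

Lemma measurable_lambda_max M : mx_measurable M ->
  (forall w, M w \is hermsymmx) ->
  measurable_fun setT (fun w => lambda_max (M w)).
Proof.
move=> mM hM; apply: (@measurable_fun_cvg _ _ _ _ (fun k w =>
  k.+1%:R^-1 * ln (complex.Re (\tr (mxexp (k.+1%:R%:C *: M w)))))).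
  move=> k; apply: measurable_funM; first exact: measurable_cst.
  apply: measurableT_comp; first exact: measurable_ln.
  apply: measurable_Re_mxtrace; apply: mx_measurable_exp.
    exact: mx_measurableZ.
  by move=> w; exact: hermZ.
by move=> w _; exact: cvg_lambda_max.
Qed.

Lemma opnormE (H : 'M[R[i]]_n) : H \is hermsymmx ->
  opnorm H = Num.max (lambda_max H) (lambda_max (- H)).
Proof.
move=> hH; have hN := hermN hH.
have [[i iE] iM] := lambda_maxP n_gt0 hH.
have [[j jE] jM] := lambda_maxP n_gt0 hN.
have negE k : exists l, speig (- H) l = - speig H k.
  have := @speigZ R n (-1) H k; rewrite rmorphN rmorph1 scaleN1r mulN1r.
  by apply => //; rewrite oppr_eq0 oner_eq0.
have negE' k : exists l, speig H l = - speig (- H) k.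
  have := @speigZ R n (-1) (- H) k; rewrite rmorphN rmorph1 scaleN1r mulN1r opprK.
  by apply => //; rewrite oppr_eq0 oner_eq0.
have up k : `|speig H k| <= Num.max (lambda_max H) (lambda_max (- H)).
  rewrite ler_norml lerNl; apply/andP; split.
    by have [l <-] := negE k; rewrite le_max; apply/orP; right; exact: jM.
  by rewrite le_max; apply/orP; left; exact: iM.
apply/eqP; rewrite eq_le; apply/andP; split.
  apply: opnorm_le_speig => //; exact: le_trans (up i).
rewrite ge_max iE jE; apply/andP; split.
  by apply: le_trans (speig_le_opnorm i hH); exact: ler_norm.
have [l lE] := negE' j.
apply: le_trans (speig_le_opnorm l hH).
by rewrite lE normrN; exact: ler_norm.
Qed.

(** Stated for arbitrary [A] because, in the main argument, the norm of [X1 - E X1] is shown to be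
    measurable before [E X1] is known to be Hermitian: the latter rests on integrability, hence on
    the Orlicz bound for that norm. *)
Lemma sqr_opnorm (A : 'M[R[i]]_n) : opnorm A ^+ 2 = lambda_max (A^t* *m A).
Proof.
have hH := adj_mul_herm A; have [[i iE] _] := lambda_maxP n_gt0 hH.
have qE v : norm2 (A *m v) ^+ 2 <= lambda_max (A^t* *m A) * norm2 v ^+ 2.
  by rewrite -qform_adj qform_le_lambda_max.
have l0 : 0 <= lambda_max (A^t* *m A).
  by rewrite iE -qform_speigvec // qform_adj sqr_ge0.
apply/eqP; rewrite eq_le; apply/andP; split.
  rewrite -[leRHS](sqr_sqrtr l0) ler_pXn2r ?nnegrE ?opnorm_ge0 ?sqrtr_ge0 //.
  apply: opnorm_le => [|v]; first exact: sqrtr_ge0.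
  rewrite -(@ler_pXn2r _ 2) ?nnegrE ?mulr_ge0 ?norm2_ge0 ?sqrtr_ge0 //.
  by rewrite exprMn (sqr_sqrtr l0).
rewrite iE -qform_speigvec // qform_adj ler_pXn2r ?nnegrE ?norm2_ge0 ?opnorm_ge0 //.
by apply: norm2_le_opnorm; rewrite norm2_speigvec.
Qed.

Lemma mx_measurable_adj M : mx_measurable M -> mx_measurable (fun w => (M w)^t*).
Proof.
move=> mM j k; have [r0 i0] := mM k j; split.
  by under eq_fun do rewrite !mxE ReC.
under eq_fun do rewrite !mxE ImC; exact: measurable_funN.
Qed.

Lemma measurable_opnorm M : mx_measurable M ->
  measurable_fun setT (fun w => opnorm (M w)).
Proof.
move=> mM.
have -> : (fun w => opnorm (M w)) =
    (fun w => Num.sqrt (lambda_max ((M w)^t* * M w))).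
  by apply/funext => w; rewrite -sqr_opnorm sqrtr_sqr ger0_norm ?opnorm_ge0.
apply: measurableT_comp.
  exact: (continuous_measurable_fun (@sqrt_continuous R)).
apply: measurable_lambda_max => [|w]; last exact: adj_mul_herm.
by apply: mx_measurableM => //; exact: mx_measurable_adj.
Qed.

End measurable_eigenvalues.

(** * Expectations, laws and independence *)

Section expectation_of_products.
Context {d0 : measure_display} {T0 : measurableType d0} {R : realType}.
Variable P : probability T0 R.
Implicit Types f g U V : T0 -> R.

Definition integrable_real f := P.-integrable setT (EFin \o f).

Lemma integrable_real_le f g : measurable_fun setT f -> integrable_real g ->
  (forall w, `|f w| <= g w) -> integrable_real f.
Proof.
move=> mf ig fg; apply: le_integrable ig => //; first exact/measurable_EFinP.
move=> w _ /=; rewrite lee_fin; apply: le_trans (fg w) _; exact: ler_norm.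
Qed.

Lemma integrable_realD f g : integrable_real f -> integrable_real g ->
  integrable_real (fun w => f w + g w).
Proof. by move=> intf intg; exact: integrableD intf intg. Qed.

Lemma integrable_realZ k f : integrable_real f ->
  integrable_real (fun w => k * f w).
Proof. by move=> intf; exact: (integrableZl measurableT k intf). Qed.

Lemma integrable_real_cst k : integrable_real (fun=> k).
Proof. exact: finite_measure_integrable_cst. Qed.

Lemma integrable_real_sum (I : Type) (r : seq I) (f : I -> T0 -> R) :
  (forall i, integrable_real (f i)) ->
  integrable_real (fun w => \sum_(i <- r) f i w).
Proof.
move=> intf; elim: r => [|i r IH].
  by under eq_fun do rewrite big_nil; exact: integrable_real_cst.
by under eq_fun do rewrite big_cons; exact: integrable_realD.
Qed.

Lemma Rintegral_sum (I : Type) (r : seq I) (f : I -> T0 -> R) :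
  (forall i, integrable_real (f i)) ->
  (\int[P]_w \sum_(i <- r) f i w = \sum_(i <- r) \int[P]_w f i w)%R.
Proof.
move=> intf; elim: r => [|i r IH].
  under eq_Rintegral do rewrite big_nil.
  by rewrite Rintegral_cst // mul0r big_nil.
under eq_Rintegral do rewrite big_cons.
by rewrite RintegralD //; [rewrite IH big_cons | exact: intf | exact: (integrable_real_sum r intf)].
Qed.

Lemma Rintegral_prob_cst (k : R) : (\int[P]_w k)%R = k.
Proof. by rewrite Rintegral_cst //= probability_setT mulr1. Qed.

Lemma Rintegral_EFin f : integrable_real f ->
  (\int[P]_w (f w)%:E)%E = (\int[P]_w f w)%R%:E.
Proof. by move=> intf; rewrite fineK //; exact: integrable_fin_num. Qed.

Lemma integrable_real_ge0 f : measurable_fun setT f -> (forall w, 0 <= f w) ->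
  (\int[P]_w (f w)%:E < +oo)%E -> integrable_real f.
Proof.
move=> mf f0 foo; apply/integrableP; split; first exact/measurable_EFinP.
by under eq_integral do rewrite gee0_abs ?lee_fin //=.
Qed.

(** Independence on rectangles makes the law of [(U, V)] the product of the two laws. Tonelli for
    the absolute value gives integrability of the product, then Fubini the formula. *)
Lemma integrableM_independent U V :
  measurable_fun setT U -> measurable_fun setT V ->
  integrable_real U -> integrable_real V ->
  (forall A B, measurable A -> measurable B ->
     P (U @^-1` A `&` V @^-1` B) = (P (U @^-1` A) * P (V @^-1` B))%E) ->
  integrable_real (fun w => U w * V w) /\
  (\int[P]_w (U w * V w) = (\int[P]_w U w) * (\int[P]_w V w))%R.
Proof.
move=> mU mV iU iV indep.
pose U' : {mfun T0 >-> R} := HB.pack U (isMeasurableFun.Build _ _ _ _ _ mU).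
pose V' : {mfun T0 >-> R} := HB.pack V (isMeasurableFun.Build _ _ _ _ _ mV).
pose m1 : probability R R := distribution P U'.
pose m2 : probability R R := distribution P V'.
pose W w := (U w, V w).
have mW : measurable_fun setT W by exact: measurable_fun_pair.
pose W' : {mfun T0 >-> (R * R)%type} :=
  HB.pack W (isMeasurableFun.Build _ _ _ _ _ mW).
pose f (z : R * R) : \bar R := (z.1 * z.2)%:E.
have mf : measurable_fun setT f.
  by apply/measurable_EFinP; apply: measurable_funM.
have prodE := @product_measure_unique _ _ _ _ R m1 m2 (distribution P W')
  (fun B C mB mC => indep B C mB mC).
have intE (g : R * R -> \bar R) : measurable_fun setT g ->
    (forall z, 0 <= g z)%E ->
    (\int[m1 \x m2]_z g z = \int[P]_w g (W w))%E.
  move=> mg g0; rewrite -(ge0_integral_distribution W') //.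
  by apply: eq_measure_integral => A mA _; exact: prodE.
have normE g : integrable_real g -> exists b : R, (\int[P]_w `|g w|%:E)%E = b%:E.
  move=> ig; exists (\int[P]_w `|g w|)%R; rewrite Rintegral_EFin //.
  exact: integrable_norm ig.
have [a aE] := normE _ iU; have [b bE] := normE _ iV.
have mnorm : measurable_fun setT (fun y : R => `|y|%:E).
  by apply/measurable_EFinP; exact: normr_measurable.
have fxE x : (\int[m2]_y `|f (x, y)| = (`|x| * b)%:E)%E.
  rewrite EFinM -bE -(ge0_integral_distribution V' (f := fun y => `|y|%:E)) //.
  rewrite -ge0_integralZl_EFin //.
  by apply: eq_integral => y _; rewrite /f /= normrM EFinM.
have intf : (m1 \x m2)%E.-integrable setT f.
  apply/(integrable12ltyP m1 m2 mf).
  under eq_integral do rewrite fxE mulrC EFinM.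
  rewrite ge0_integralZl_EFin //.
  - by rewrite (ge0_integral_distribution U' (f := fun x => `|x|%:E)) // aE -EFinM ltry.
  - by rewrite -lee_fin -bE integral_ge0.
have iUV : integrable_real (fun w => U w * V w).
  apply/integrableP; split.
    by apply/measurable_EFinP; exact: measurable_funM.
  have /integrableP[_] := intf; rewrite intE //.
  by apply: measurableT_comp.
split=> //.
apply: EFin_inj; rewrite -Rintegral_EFin // EFinM.
have -> : (\int[P]_w (U w * V w)%:E = \int[distribution P W']_z f z)%E.
  by rewrite integral_distribution.
transitivity (\int[m1 \x m2]_z f z)%E.
  by apply/esym/eq_measure_integral => A mA _; exact: prodE.
rewrite -(integral12_prod_meas1 intf) /fubini_F.
transitivity (\int[m1]_x (x%:E * (\int[P]_w V w)%R%:E))%E.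
  apply: eq_integral => x _; rewrite -Rintegral_EFin //.
  rewrite -(integral_distribution (X := V') (f := EFin)) //.
  rewrite -integralZl //.
  by apply: integrable_pushforward.
under eq_integral do rewrite muleC.
rewrite integralZl //; last by apply: integrable_pushforward.
rewrite muleC; congr (_ * _)%E.
by rewrite (integral_distribution (X := U') (f := EFin)) // -Rintegral_EFin.
Qed.

End expectation_of_products.

Section matrix_borel.
Context {R : realType} {d : nat}.

(* A separate name, so that the instances below do not attach to every matrix
   type. *)
Definition mxpoints := 'M[R[i]]_d.
HB.instance Definition _ := Choice.on mxpoints.
HB.instance Definition _ := isPointed.Build mxpoints (0 : 'M[R[i]]_d).

Definition mx_generators : set (set mxpoints) :=
  [set B | exists j k, exists2 A : set R, measurable A &
         B = [set M : 'M[R[i]]_d | A (complex.Re (M j k))] \/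
         B = [set M : 'M[R[i]]_d | A (complex.Im (M j k))]].

(** Its measurable sets are by definition those of [mx_borel], so that general facts on measurable
    functions apply to the notions of the statement. *)
Definition mxspace := g_sigma_algebraType mx_generators.

Lemma mx_measurable_id : mx_measurable (fun M : mxspace => M : 'M[R[i]]_d).
Proof.
move=> j k; split=> _ A mA; rewrite setTI; apply: sub_sigma_algebra.
  by exists j, k, A => //; left.
by exists j, k, A => //; right.
Qed.

Context {d0 : measure_display} {T0 : measurableType d0}.
Implicit Type X : T0 -> 'M[R[i]]_d.

Lemma mx_measurableP X :
  mx_measurable X <-> measurable_fun setT (X : T0 -> mxspace).
Proof.
split=> [mX|mX j k].
  have h := @measurability _ _ T0 mxspace setT X mx_generators erefl.
  apply: h => _ [_ [j [k [A mA [->|->]]]] <-].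
    by have [rX _] := mX j k; exact: rX.
  by have [_ iX] := mX j k; exact: iX.
have [r0 i0] := mx_measurable_id j k.
split; first exact: (measurableT_comp r0 mX).
exact: (measurableT_comp i0 mX).
Qed.

Lemma random_mx_measurable X : random_mx X <-> mx_measurable X.
Proof.
split=> [rX|/mx_measurableP mX B mB].
  by apply/mx_measurableP => _ B mB; rewrite setTI; exact: rX.
by rewrite -[X in measurable X]setTI; exact: mX.
Qed.

Lemma mx_measurable_comp m (F : mxspace -> 'M[R[i]]_m) X :
  mx_measurable F -> mx_measurable X -> mx_measurable (fun w => F (X w)).
Proof.
move=> mF /mx_measurableP mX j k; have [r0 i0] := mF j k.
split; first exact: (measurableT_comp r0 mX).
exact: (measurableT_comp i0 mX).
Qed.

End matrix_borel.
Arguments mxspace : clear implicits.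

Section equality_in_law.
Context {d0 : measure_display} {T0 : measurableType d0} {R : realType}.
Variable P : probability T0 R.

Lemma Rintegral_same_law (U V : T0 -> R) :
  measurable_fun setT U -> measurable_fun setT V ->
  (forall A, measurable A -> P (U @^-1` A) = P (V @^-1` A)) ->
  integrable_real P U ->
  integrable_real P V /\ (\int[P]_w V w = \int[P]_w U w)%R.
Proof.
move=> mU mV UV iU.
pose U' : {mfun T0 >-> R} := HB.pack U (isMeasurableFun.Build _ _ _ _ _ mU).
pose V' : {mfun T0 >-> R} := HB.pack V (isMeasurableFun.Build _ _ _ _ _ mV).
have law (h : R -> \bar R) :
    (\int[distribution P U']_x h x = \int[distribution P V']_x h x)%E.
  by apply: eq_measure_integral => A mA _; exact: UV.
have mnorm : measurable_fun setT (fun y : R => `|y|%:E).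
  by apply/measurable_EFinP; exact: normr_measurable.
have iV : integrable_real P V.
  apply/integrableP; split; first exact/measurable_EFinP.
  have /integrableP[_] := iU.
  rewrite -[X in (X < _)%E -> _](ge0_integral_distribution U' (f := fun x => `|x|%:E)) //.
  by rewrite law ge0_integral_distribution.
split=> //; rewrite /Rintegral; congr fine.
rewrite -(integral_distribution (X := V') (f := EFin)) //.
by rewrite -(integral_distribution (X := U') (f := EFin)).
Qed.

End equality_in_law.

(** * Independence of one observation from the earlier ones *)

Section independence.
Context {d0 : measure_display} {T0 : measurableType d0} {R : realType}.
Variable P : probability T0 R.
Context {n d : nat}.
Variable X : 'I_n -> T0 -> 'M[R[i]]_d.
Hypothesis X_meas : forall i, random_mx (X i).
Hypothesis X_indep : mutually_independent P X.

(** Cylinder events in the observations of index below [k]. They are closed under intersection, and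
    their index set is a finite set so that [mutually_independent] applies to them verbatim. *)
Definition past_generators (k : nat) : set (set T0) :=
  [set A | exists2 B : 'I_n -> set 'M[R[i]]_d, (forall i, mx_borel (B i)) &
    A = \bigcap_(i in [set i | i \in [set j : 'I_n | (j < k)%N]%SET])
          (X i @^-1` B i)].

(** The same points as [T0], with the coarser sigma-algebra of the past. Measurability with respect
    to the past is then ordinary measurability of a function on [past k]. *)
Definition past (k : nat) := g_sigma_algebraType (past_generators k).

Lemma mx_borelT : mx_borel (setT : set 'M[R[i]]_d).
Proof. exact: (@measurableT _ (mxspace R d)). Qed.

Lemma mx_borelI (A B : set 'M[R[i]]_d) :
  mx_borel A -> mx_borel B -> mx_borel (A `&` B).
Proof. exact: (@measurableI _ (mxspace R d)). Qed.

Lemma past_measurable (k : nat) (i : 'I_n) : (i < k)%N ->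
  mx_measurable (X i : past k -> 'M[R[i]]_d).
Proof.
move=> ik; apply/mx_measurableP => _ B mB; rewrite setTI.
apply: sub_sigma_algebra; exists (fun j => if j == i then B else setT).
  by move=> j; case: eqP => // _; exact: mx_borelT.
apply/seteqP; split=> [w Xw j _ /=|w Xw].
  by case: eqP => // ->.
by have := Xw i; rewrite /= eqxx; apply; rewrite inE.
Qed.

Lemma past_setI_closed k : setI_closed (past_generators k).
Proof.
move=> _ _ [A mA ->] [B mB ->]; exists (fun i => A i `&` B i).
  by move=> i; exact: mx_borelI.
by rewrite -bigcapI.
Qed.

Lemma past_generator_measurable k A : past_generators k A -> measurable A.
Proof.
move=> [B mB ->]; apply: fin_bigcap_measurable => // i _; exact: X_meas.
Qed.

Lemma past_independent (k : 'I_n) (A : set T0) (C : set 'M[R[i]]_d) :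
  <<s past_generators k >> A -> mx_borel C ->
  measurable A /\ P (A `&` X k @^-1` C) = (P A * P (X k @^-1` C))%E.
Proof.
move=> pA mC; pose XC := X k @^-1` C; have mXC : measurable XC by exact: X_meas.
pose H := [set A : set T0 | measurable A /\ P (A `&` XC) = (P A * P XC)%E].
suff : <<s past_generators k >> `<=` H by apply.
apply: lambda_system_subset => //; first exact: past_setI_closed.
- apply/dynkin_lambda_system; split.
  + by split=> //; rewrite setTI probability_setT mul1e.
  + move=> B [mB BE]; split; first exact: measurableC.
    have -> : ~` B `&` XC = XC `\` (B `&` XC).
      by rewrite setDIr setDv setU0 setDE setIC.
    have XBX : XC `&` (B `&` XC) = B `&` XC by rewrite setIA setIAC setIid setIC.
    have -> : P (XC `\` (B `&` XC)) = (P XC - P (B `&` XC))%E.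
      rewrite -{2}XBX; apply: measureD => //; first exact: measurableI.
      by rewrite (le_lt_trans (probability_le1 P _)) // ltry.
    rewrite BE probability_setC //.
    rewrite -(fineK (fin_num_measure P _ mB)) -(fineK (fin_num_measure P _ mXC)).
    rewrite -EFinM -EFinB -[(1 - (fine _)%:E)%E]EFinB -EFinM.
    by rewrite mulrBl mul1r.
  + move=> F tF HF; have mF i : measurable (F i) by have [] := HF i.
    split; first exact: bigcup_measurable.
    rewrite setI_bigcupl measure_bigcup //; last 2 first.
      by move=> i _; exact: measurableI.
      exact: trivIset_setIr.
    rewrite measure_bigcup //.
    rewrite -(fineK (fin_num_measure P _ mXC)) muleC.
    rewrite -nneseriesZl //.
    apply: eq_eseriesr => i _; have [_ FE] := HF i.
    transitivity (P (F i) * P XC)%E; first exact: FE.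
    by rewrite muleC; congr (_ * _)%E; rewrite fineK // fin_num_measure.
- move=> _ [B mB ->]; split.
    by apply: past_generator_measurable; exists B.
  pose J := [set j : 'I_n | (j < k)%N]%SET.
  pose B' i := if i == k then C else B i.
  have kJ : k \notin J by rewrite inE ltnn.
  have := @X_indep (k |: J)%SET B'; rewrite big_setU1 //= /B' eqxx.
  have mB' i : mx_borel (B' i) by rewrite /B'; case: eqP.
  move=> /(_ mB'); rewrite muleC.
  have -> : (\prod_(i in J) P (X i @^-1` (if i == k then C else B i)))%E =
            (\prod_(i in J) P (X i @^-1` B i))%E.
    by apply: eq_bigr => i; rewrite inE; case: eqP => // ->; rewrite ltnn.
  rewrite -X_indep // => <-; congr (P _).
  apply/seteqP; split=> [w [Bw Cw] i /=|w Bw].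
    by rewrite !inE; case: eqP => [->|_ /= ik]; [|apply: Bw; rewrite /= inE].
  split=> [i /=|]; last by have := Bw k; rewrite /= eqxx; apply; rewrite !inE eqxx.
  rewrite inE => ik; have := Bw i; rewrite /=; case: eqP ik => [->|_ ik].
    by rewrite ltnn.
  by apply; rewrite !inE ik orbT.
Qed.

End independence.

Section trace_inequality.
Local Open Scope sesquilinear_scope.
Local Open Scope complex_scope.
Context {R : realType} {m : nat}.
Implicit Types A G L : 'M[R[i]]_m.

(** In the eigenbasis of [G] the trace is the sum of the eigenvalues of [G], all nonnegative,
    weighted by the diagonal entries of [L], each at most [lam]. *)
Lemma Re_mxtrace_mul_le G L (lam : R) : G \is hermsymmx ->
  (forall v, 0 <= qform G v) -> (forall v, qform L v <= lam * norm2 v ^+ 2) ->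
  complex.Re (\tr (G * L)) <= lam * complex.Re (\tr G).
Proof.
move=> hG G0 Ll; have GE := mxfun_id hG.
have -> : complex.Re (\tr G) = \sum_i speig G i.
  by rewrite -[in LHS]GE mxtrace_mxfun.
have -> : complex.Re (\tr (G * L)) = \sum_i speig G i * qform L (speigvec G i).
  rewrite -[in LHS]GE -[_ * _]/(_ *m _) /mxfun /spmx.
  rewrite -!mulmxA mxtrace_mulC -!mulmxA.
  rewrite /mxtrace Re_sum; apply: eq_bigr => i _.
  rewrite mul_diag_mx 2!mxE ReM /= mul0r subr0; congr (_ * _).
  rewrite /qform /speigvec trmx_mul map_mxM /= trmxCK trmx_delta map_delta_mx.
  congr complex.Re.
  by rewrite !mulmxA -colE [RHS]mxE -!mulmxA -rowE [RHS]mxE.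
rewrite mulr_sumr; apply: ler_sum => i _; rewrite mulrC ler_wpM2r //.
  by rewrite -qform_speigvec.
by apply: le_trans (Ll _) _; rewrite norm2_speigvec expr1n mulr1.
Qed.

Lemma qform_mxexp_ge0 A v : 0 <= qform (mxexp A) v.
Proof.
rewrite qform_mxfun; apply: sumr_ge0 => i _.
by rewrite mulr_ge0 ?expR_ge0 ?spweight_ge0.
Qed.

Lemma Re_mxtrace_mxexp_ge0 A : 0 <= complex.Re (\tr (mxexp A)).
Proof. by rewrite mxtrace_mxfun sumr_ge0 // => i _; exact: expR_ge0. Qed.

(** The eigenvalues of the exponential are positive, so each is below their sum. Integrability of
    the trace thus yields integrability of all entries. *)
Lemma opnorm_mxexp_le A : opnorm (mxexp A) <= complex.Re (\tr (mxexp A)).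
Proof.
apply: opnorm_le => [|v]; first exact: Re_mxtrace_mxexp_ge0.
rewrite -(@ler_pXn2r _ 2) ?nnegrE ?mulr_ge0 ?norm2_ge0 ?Re_mxtrace_mxexp_ge0 //.
rewrite exprMn -qform_adj (hermsymmxP _ (mxfun_herm _ _)).
rewrite -[_ *m _]/(_ * _) mxfunM qform_mxfun mxtrace_mxfun /=.
rewrite -(sum_spweight A) mulr_sumr; apply: ler_sum => i _.
rewrite ler_wpM2r ?spweight_ge0 // -expr2 ler_pXn2r ?nnegrE ?expR_ge0 //.
  by rewrite (bigD1 i) //= lerDl sumr_ge0 // => j _; exact: expR_ge0.
by apply: sumr_ge0 => j _; exact: expR_ge0.
Qed.

Lemma speig0 i : speig (0 : 'M[R[i]]_m) i = 0.
Proof. by rewrite -qform_speigvec ?herm0 // /qform mulmx0 mul0mx mxE. Qed.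

Lemma Re_mxtrace_mxexp0 : complex.Re (\tr (mxexp (0 : 'M[R[i]]_m))) = m%:R.
Proof.
rewrite mxtrace_mxfun /=; under eq_bigr do rewrite speig0 expR0.
by rewrite sumr_const card_ord.
Qed.

End trace_inequality.

Section matrix_expectation.
Local Open Scope sesquilinear_scope.
Local Open Scope complex_scope.
Context {d0 : measure_display} {T0 : measurableType d0} {R : realType}.
Variable P : probability T0 R.
Context {m : nat}.
Implicit Types M N : T0 -> 'M[R[i]]_m.

Definition mx_integrable M := forall j k,
  integrable_real P (fun w => complex.Re (M w j k)) /\
  integrable_real P (fun w => complex.Im (M w j k)).

Definition mxexpect M : 'M[R[i]]_m :=
  \matrix_(j, k) ((\int[P]_w complex.Re (M w j k))%R +i*
                  (\int[P]_w complex.Im (M w j k))%R).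

Lemma Re_mxexpect M j k :
  complex.Re (mxexpect M j k) = (\int[P]_w complex.Re (M w j k))%R.
Proof. by rewrite mxE. Qed.

Lemma Im_mxexpect M j k :
  complex.Im (mxexpect M j k) = (\int[P]_w complex.Im (M w j k))%R.
Proof. by rewrite mxE. Qed.

Lemma expectation_mxE M : expectation_mx P M = mxexpect M.
Proof. by apply/matrixP => j k; rewrite !mxE unlock. Qed.

Lemma mx_integrable_dominated M (g : T0 -> R) : mx_measurable M ->
  integrable_real P g -> (forall w, opnorm (M w) <= g w) -> mx_integrable M.
Proof.
move=> mM ig Mg j k; have [rM iM] := mM j k; split.
  apply: integrable_real_le ig _ => // w.
  exact: le_trans (normr_Re_le_opnorm _ _ _) (Mg w).
apply: integrable_real_le ig _ => // w.
exact: le_trans (normr_Im_le_opnorm _ _ _) (Mg w).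
Qed.

Lemma qform_mxexpect M v : mx_integrable M ->
  integrable_real P (fun w => qform (M w) v) /\
  qform (mxexpect M) v = (\int[P]_w qform (M w) v)%R.
Proof.
move=> iM.
have iE j k : integrable_real P
    (fun w => complex.Re (M w j k * ((v j 0)^* * v k 0))).
  have [rM imM] := iM j k; under eq_fun do rewrite ReM.
  under eq_fun do rewrite mulrC (mulrC (complex.Im _)) -mulNr.
  by apply: integrable_realD; exact: integrable_realZ.
split.
  under eq_fun do rewrite qformE.
  by apply: integrable_real_sum => j; exact: integrable_real_sum.
under eq_Rintegral do rewrite qformE.
rewrite Rintegral_sum => [|j]; last exact: integrable_real_sum.
rewrite qformE; apply: eq_bigr => j _; rewrite Rintegral_sum //.
apply: eq_bigr => k _; have [rM imM] := iM j k.
rewrite ReM mxE /=.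
under [RHS]eq_Rintegral do rewrite ReM.
rewrite RintegralB //=.
- by rewrite !RintegralZr.
- under eq_fun do rewrite mulrC; exact: integrable_realZ.
- under eq_fun do rewrite mulrC; exact: integrable_realZ.
Qed.

Lemma Re_mxtrace_mxexpect M : mx_integrable M ->
  complex.Re (\tr (mxexpect M)) = (\int[P]_w complex.Re (\tr (M w)))%R.
Proof.
move=> iM; rewrite Re_sum; under eq_Rintegral do rewrite Re_sum.
rewrite Rintegral_sum => [|j]; last by have [] := iM j j.
by apply: eq_bigr => j _; rewrite mxE.
Qed.

Lemma mxexpect_herm M : mx_integrable M -> (forall w, M w \is hermsymmx) ->
  mxexpect M \is hermsymmx.
Proof.
move=> iM hM; apply/hermsymmxP/matrixP => j k; rewrite !mxE.
have Mjk w : M w j k = (M w k j)^*.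
  by have /hermsymmxP/matrixP/(_ j k) := hM w; rewrite !mxE.
rewrite -[LHS]/(_ +i* _); congr (_ +i* _).
  by apply: eq_Rintegral => w _; rewrite [in RHS]Mjk ReC.
under [RHS]eq_Rintegral do rewrite Mjk ImC -mulN1r.
by rewrite RintegralZl ?mulN1r //; have [] := iM k j.
Qed.

End matrix_expectation.

(** * Expected trace exponential of a sum of independent matrices *)

Section trace_exponential_of_sums.
Local Open Scope sesquilinear_scope.
Local Open Scope complex_scope.
Context {d0 : measure_display} {T0 : measurableType d0} {R : realType}.
Variable P : probability T0 R.
Context {n d m : nat}.
Variable X : 'I_n -> T0 -> 'M[R[i]]_d.
Hypothesis X_meas : forall i, random_mx (X i).
Hypothesis X_indep : mutually_independent P X.
Variable F : mxspace R d -> 'M[R[i]]_m.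
Hypothesis F_meas : mx_measurable F.
Hypothesis F_herm : forall M, F M \is hermsymmx.
Variable lam : R.
Hypothesis lam_ge0 : 0 <= lam.
Hypothesis F_int : forall i,
  integrable_real P (fun w => complex.Re (\tr (mxexp (F (X i w))))).
Hypothesis F_mgf : forall i v,
  (\int[P]_w qform (mxexp (F (X i w))) v)%R <= lam * norm2 v ^+ 2.

Let S (k : nat) (w : T0) := \sum_(i < n | (i < k)%N) F (X i w).

Let S_herm k w : S k w \is hermsymmx.
Proof. exact: herm_sum. Qed.

Let S_measurable k : mx_measurable (S k).
Proof.
apply: mx_measurable_sum => i _; apply: mx_measurable_comp => //.
exact/random_mx_measurable.
Qed.

Let S_past_measurable (k : nat) : mx_measurable (S k : past X k -> _).
Proof.
apply: mx_measurable_sum => i ik; apply: mx_measurable_comp => //.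
exact: past_measurable.
Qed.

Let FX_measurable i : mx_measurable (fun w => F (X i w)).
Proof. by apply: mx_measurable_comp => //; exact/random_mx_measurable. Qed.

Let S_succ (k : 'I_n) w : S k.+1 w = S k w + F (X k w).
Proof.
rewrite /S (bigD1 k) //= addrC; congr (_ + _); apply: eq_bigl => i.
by rewrite ltnS ltn_neqAle andbC.
Qed.

Let exp_entries_integrable (M : T0 -> 'M[R[i]]_m) :
  mx_measurable M -> (forall w, M w \is hermsymmx) ->
  integrable_real P (fun w => complex.Re (\tr (mxexp (M w)))) ->
  mx_integrable P (fun w => mxexp (M w)).
Proof.
move=> mM hM iM; apply: (mx_integrable_dominated _ iM) => [|w].
  exact: mx_measurable_exp.
exact: opnorm_mxexp_le.
Qed.

Let independent_entries (k : 'I_n) (U : T0 -> R) (h : mxspace R d -> R) :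
  measurable_fun setT (U : past X k -> R) -> measurable_fun setT U ->
  measurable_fun setT h ->
  integrable_real P U -> integrable_real P (h \o X k) ->
  integrable_real P (fun w => U w * h (X k w)) /\
  (\int[P]_w (U w * h (X k w)) = (\int[P]_w U w) * (\int[P]_w h (X k w)))%R.
Proof.
move=> pU mU mh iU ih; apply: integrableM_independent => //.
  have /mx_measurableP mX := (random_mx_measurable _).1 (X_meas k).
  exact: (measurableT_comp mh mX).
move=> A B mA mB.
have pA : <<s past_generators X k >> (U @^-1` A).
  by rewrite -[_ @^-1` _]setTI; exact: pU.
have mhB : mx_borel (h @^-1` B : set 'M[R[i]]_d).
  by rewrite -[_ @^-1` _]setTI; exact: mh.
by have [_ ->] := past_independent X_meas X_indep pA mhB.
Qed.

(** After Golden-Thompson, the trace of [A w * B w] is a finite sum of products of an entry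
    depending on the past and an entry depending on [X k]. Independence factors each product, so the
    expected trace is that of the product of the expectations; this stands in for conditional
    expectation. The expectation of [A] is positive and that of [B] is at most [lam]. *)
Lemma expectation_trace_exp_sum_past (k : nat) : (k <= n)%N ->
  integrable_real P (fun w => complex.Re (\tr (mxexp (S k w)))) /\
  (\int[P]_w complex.Re (\tr (mxexp (S k w))))%R <= m%:R * lam ^+ k.
Proof.
elim: k => [_|k IH lt_kn].
  have -> : (fun w => complex.Re (\tr (mxexp (S 0 w)))) = fun=> m%:R.
    by apply/funext => w; rewrite /S big_pred0 ?Re_mxtrace_mxexp0.
  by rewrite Rintegral_prob_cst mulr1; split=> //; exact: integrable_real_cst.
have {IH} [iS leS] := IH (ltnW lt_kn); pose k' := Ordinal lt_kn.
pose A w := mxexp (S k w); pose B w := mxexp (F (X k' w)).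
have iA : mx_integrable P A by exact: exp_entries_integrable.
have iB : mx_integrable P B.
  exact: (exp_entries_integrable (FX_measurable k') (fun w => F_herm _) (F_int k')).
have mA : mx_measurable A by exact: mx_measurable_exp.
have pA : mx_measurable (A : past X k' -> _) by exact: mx_measurable_exp.
have mF : mx_measurable (fun M : mxspace R d => mxexp (F M)).
  exact: mx_measurable_exp.
have split_int j l : integrable_real P (fun w =>
     complex.Re (A w j l) * complex.Re (B w l j) -
     complex.Im (A w j l) * complex.Im (B w l j)) /\
  (\int[P]_w (complex.Re (A w j l) * complex.Re (B w l j) -
     complex.Im (A w j l) * complex.Im (B w l j)))%R =
  complex.Re (mxexpect P A j l) * complex.Re (mxexpect P B l j) -
  complex.Im (mxexpect P A j l) * complex.Im (mxexpect P B l j).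
  have [rA imA] := iA j l; have [rB imB] := iB l j.
  have [mrA miA] := mA j l; have [prA piA] := pA j l.
  have [mrF miF] := mF l j.
  have [i1 e1] := independent_entries prA mrA mrF rA rB.
  have [i2 e2] := independent_entries piA miA miF imA imB.
  split.
    apply: integrable_realD i1 _; under eq_fun do rewrite -mulN1r.
    exact: integrable_realZ i2.
  by rewrite !Re_mxexpect !Im_mxexpect -e1 -e2; exact: RintegralB.
have iAB : integrable_real P (fun w => complex.Re (\tr (A w * B w))).
  under eq_fun do rewrite Re_mxtrace_mul.
  apply: integrable_real_sum => j; apply: integrable_real_sum => l.
  by have [] := split_int j l.
have eAB : (\int[P]_w complex.Re (\tr (A w * B w)))%R =
    complex.Re (\tr (mxexpect P A * mxexpect P B)).
  under eq_Rintegral do rewrite Re_mxtrace_mul.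
  rewrite Rintegral_sum => [|j]; last first.
    by apply: integrable_real_sum => l; have [] := split_int j l.
  rewrite Re_mxtrace_mul; apply: eq_bigr => j _.
  rewrite Rintegral_sum => [|l]; last by have [] := split_int j l.
  by apply: eq_bigr => l _; have [] := split_int j l.
have GT w : complex.Re (\tr (mxexp (S k.+1 w))) <= complex.Re (\tr (A w * B w)).
  by rewrite (S_succ k'); exact: golden_thompson.
have iS1 : integrable_real P (fun w => complex.Re (\tr (mxexp (S k.+1 w)))).
  apply: integrable_real_le iAB _ => [|w].
    by apply: measurable_Re_mxtrace; exact: mx_measurable_exp.
  by rewrite ger0_norm ?Re_mxtrace_mxexp_ge0.
split=> //.
apply: (@le_trans _ _ (\int[P]_w complex.Re (\tr (A w * B w)))%R).
  exact: le_Rintegral.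
rewrite eAB; apply: (@le_trans _ _ (lam * complex.Re (\tr (mxexpect P A)))).
  apply: Re_mxtrace_mul_le => [|v|v].
  - by apply: mxexpect_herm => // w; exact: mxfun_herm.
  - have [_ ->] := qform_mxexpect v iA; apply: Rintegral_ge0 => w _.
    exact: qform_mxexp_ge0.
  - by have [_ ->] := qform_mxexpect v iB; exact: F_mgf.
by rewrite Re_mxtrace_mxexpect // exprS mulrCA ler_wpM2l.
Qed.

Lemma expectation_trace_exp_sum :
  integrable_real P (fun w => complex.Re (\tr (mxexp (\sum_i F (X i w))))) /\
  (\int[P]_w complex.Re (\tr (mxexp (\sum_i F (X i w)))))%R <= m%:R * lam ^+ n.
Proof.
have -> : (fun w => complex.Re (\tr (mxexp (\sum_i F (X i w))))) =
    (fun w => complex.Re (\tr (mxexp (S n w)))).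
  apply/funext => w; congr (complex.Re (\tr (mxexp _))).
  by apply: eq_bigl => i; rewrite ltn_ord.
exact: expectation_trace_exp_sum_past.
Qed.

End trace_exponential_of_sums.

(** * Scalar estimates *)

Section exponential_bounds.
Context {R : realType}.
Implicit Types x y z t u : R.

Lemma is_derive_ge0_le (f df : R -> R) x y : x <= y ->
  (forall z, is_derive z 1 f (df z)) ->
  (forall z, x < z < y -> 0 <= df z) -> f x <= f y.
Proof.
rewrite le_eqVlt => /orP[/eqP->//|xy] fdf df0.
have cf : {within `[x, y], continuous f}.
  apply: continuous_subspaceT => z.
  exact/differentiable_continuous/derivable1_diffP.
have [c cxy e] := MVT xy (fun z _ => fdf z) cf.
by rewrite -subr_ge0 e mulr_ge0 ?subr_ge0 ?(ltW xy) // df0.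
Qed.

(** Multiplied by [expR (- y)], the Taylor polynomial has a derivative that collapses to one term of
    constant sign. Both Taylor bounds follow from it. *)
Lemma is_derive_expN_taylor2 x :
  is_derive x 1 (fun y : R => (1 + y + y ^+ 2 / 2) * expR (- y))
                (- (x ^+ 2 / 2) * expR (- x)).
Proof.
have e1 : is_derive x 1 (fun y : R => expR (- y)) (- expR (- x)).
  have := @is_derive1_comp R expR -%R x _ _ (is_derive_expR _) (is_deriveNid _ _).
  by rewrite mulrN1.
apply: is_derive_eq.
by rewrite /GRing.scale /=; field.
Qed.

Lemma expR_le_taylor2 y : y <= 0 -> expR y <= 1 + y + y ^+ 2 / 2.
Proof.
move=> y0; pose f (z : R) := - ((1 + z + z ^+ 2 / 2) * expR (- z)).
have : f y <= f 0.
  apply: is_derive_ge0_le y0 (fun z => is_deriveN (is_derive_expN_taylor2 z)) _.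
  by move=> z _; rewrite mulNr opprK mulr_ge0 ?expR_ge0 // divr_ge0 ?sqr_ge0.
rewrite /f oppr0 expR0 expr0n mul0r !addr0 mulr1 lerN2 expRN.
by rewrite ler_pdivlMr ?expR_gt0 // mul1r.
Qed.

Lemma expR_le_taylor3 y : 0 <= y ->
  expR y <= 1 + y + y ^+ 2 / 2 + y ^+ 3 * expR y / 6.
Proof.
move=> y0; pose f (z : R) := (1 + z + z ^+ 2 / 2) * expR (- z) + z ^+ 3 / 6.
have fd z : is_derive z 1 f (z ^+ 2 / 2 * (1 - expR (- z))).
  have d1 := is_derive_expN_taylor2 z; apply: is_derive_eq.
  by rewrite /GRing.scale /=; field.
have : f 0 <= f y.
  apply: is_derive_ge0_le y0 fd _ => z /andP[z0 _].
  rewrite mulr_ge0 ?divr_ge0 ?sqr_ge0 // subr_ge0 expR_le1.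
  by rewrite oppr_le0 ltW.
rewrite /f oppr0 expR0 !expr0n !mul0r !addr0 mulr1 expRN => le1.
have := ler_pM2r (expR_gt0 y) 1 ((1 + y + y ^+ 2 / 2) / expR y + y ^+ 3 / 6).
rewrite le1 mul1r mulrDl divfK ?gt_eqF ?expR_gt0 // => leE.
by rewrite (_ : y ^+ 3 * expR y / 6 = y ^+ 3 / 6 * expR y) ?leE //; field.
Qed.

Lemma expX_le (k : nat) t : 0 <= t -> t ^+ k <= expR (k%:R * (t - 1)).
Proof.
move=> t0; rewrite expRM_natl lerXn2r ?nnegrE ?expR_ge0 //.
by have := expR_ge1Dx (t - 1); rewrite addrC subrK.
Qed.

Section orlicz_scalar_bounds.
Variables (K alpha Z : R).
Hypotheses (K_gt0 : 0 < K) (alpha_ge1 : 1 <= alpha) (Z_gt0 : 0 < Z).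
Let L := (Z / K) `^ alpha.
Hypothesis L_ge4 : 4 <= L.

(** With [r = W / Z > 1] the claim reads [L * r <= L * r ^ alpha], the right side being
    [(W / K) ^ alpha]. *)
Lemma orlicz_tail W : Z < W ->
  expR (L * (W / Z - 1)) <= expR (- L) * expR ((W / K) `^ alpha).
Proof.
move=> ZW; rewrite -expRD ler_expR mulrBr mulr1 addrC lerD2l.
have WZ : 1 < W / Z by rewrite ltr_pdivlMr ?mul1r.
have -> : W / K = (Z / K) * (W / Z) by field; rewrite !gt_eqF.
have ZK0 : 0 <= Z / K by rewrite divr_ge0 // ltW.
have WZ0 : 0 <= W / Z by rewrite ltW // (lt_trans ltr01).
rewrite powRM //.
rewrite -/L ler_wpM2l ?powR_ge0 // -{1}[W / Z]powRr1 //.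
by rewrite ler_powR // ltW.
Qed.

(** For [a <= 0] the second-order Taylor bound is enough. For [0 < a <= Z] the cubic remainder is
    absorbed by [a ^ 2 / Z ^ 2], and for [a > Z] by the Orlicz term. Taylor's factor 6 is weakened
    to 4, the value that produces the Bernstein form in [mgf_centered]. *)
Lemma expR_orlicz_bound theta a W : 0 <= theta -> theta * Z < 1 -> `|a| <= W ->
  expR (theta * a) <= 1 + theta * a + theta ^+ 2 * a ^+ 2 / 2 +
    (theta * Z) ^+ 3 / (4 * (1 - theta * Z)) *
    (a ^+ 2 / Z ^+ 2 + expR (- L) * expR ((W / K) `^ alpha)).
Proof.
move=> th0 u1 aW; set u := theta * Z in u1 *.
have u0 : 0 <= u by rewrite mulr_ge0 // ltW.
set rho := u ^+ 3 / _; set E := expR (- L) * _.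
have rho0 : 0 <= rho.
  by rewrite divr_ge0 ?exprn_ge0 // mulr_ge0 // subr_ge0 ltW.
have E0 : 0 <= E by rewrite mulr_ge0 ?expR_ge0.
have q0 : 0 <= a ^+ 2 / Z ^+ 2 by rewrite divr_ge0 ?sqr_ge0.
have [a0|a0] := leP a 0.
  have := expR_le_taylor2 (mulr_ge0_le0 th0 a0); rewrite exprMn => /le_trans; apply.
  by rewrite lerDl mulr_ge0 // addr_ge0.
have := expR_le_taylor3 (mulr_ge0 th0 (ltW a0)).
rewrite [X in _ + X / 2]exprMn => /le_trans; apply; rewrite lerD2l.
pose t := a / Z; have t0 : 0 < t by rewrite divr_gt0.
have aE : theta * a = u * t by rewrite /u /t; field; rewrite gt_eqF.
have rhoE : u ^+ 3 * expR u / 6 <= rho.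
  rewrite /rho -mulrA ler_wpM2l ?exprn_ge0 //.
  have := expR_ge1Dx (- u); rewrite expRN => e1.
  have e2 : expR u * (1 - u) <= 1.
    by rewrite mulrC -ler_pdivlMr ?expR_gt0 // mul1r.
  rewrite -[leRHS]mul1r ler_pdivlMr ?mulr_gt0 ?subr_gt0 //; lra.
rewrite aE exprMn; have [aZ|Za] := leP a Z.
  have t1 : t <= 1 by rewrite ler_pdivrMr ?mul1r.
  apply: (@le_trans _ _ (rho * t ^+ 2)); last first.
    by rewrite ler_wpM2l // /t expr_div_n lerDl.
  apply: (@le_trans _ _ (u ^+ 3 * expR u / 6 * t ^+ 2)); last first.
    by rewrite ler_wpM2r ?sqr_ge0.
  have e1 : expR (u * t) <= expR u by rewrite ler_expR ler_piMr.
  have e2 : t ^+ 3 <= t ^+ 2 by rewrite exprS ler_piMl ?sqr_ge0.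
  have e3 : t ^+ 3 * expR (u * t) <= t ^+ 2 * expR u.
    by rewrite ler_pM ?exprn_ge0 ?expR_ge0 ?(ltW t0).
  have := ler_wpM2l (exprn_ge0 3 u0) e3; lra.
have ZW : Z < W by apply: lt_le_trans Za (le_trans (ler_norm _) aW).
have t1 : 1 < t by rewrite ltr_pdivlMr ?mul1r.
apply: (@le_trans _ _ (rho * E)); last by rewrite ler_wpM2l // lerDr.
(* The exponent 4 is what [4 <= L] pays for: [t ^ 3] costs [3 * (t - 1)], and [expR (u * t)] costs
   another [t - 1] beyond [expR u]. *)
apply: (@le_trans _ _ (u ^+ 3 * expR u / 6 * expR (4 * (t - 1)))); last first.
  apply: ler_pM => //.
    by rewrite divr_ge0 // mulr_ge0 ?expR_ge0 ?exprn_ge0.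
  apply: le_trans (orlicz_tail ZW); rewrite ler_expR.
  apply: (@le_trans _ _ (L * (t - 1))).
    by rewrite ler_wpM2r // subr_ge0 ltW.
  rewrite ler_wpM2l ?powR_ge0 // lerD2r ler_pM2r ?invr_gt0 //.
  exact: le_trans (ler_norm _) aW.
have e1 := expX_le 3 (ltW t0).
have e2 : expR (u * t) <= expR u * expR (t - 1).
  rewrite -expRD ler_expR -subr_ge0.
  have -> : u + (t - 1) - u * t = (1 - u) * (t - 1) by ring.
  by rewrite mulr_ge0 // subr_ge0 ltW.
have e3 : t ^+ 3 * expR (u * t) <= expR u * expR (4 * (t - 1)).
  have -> : expR u * expR (4 * (t - 1)) =
      expR (3 * (t - 1)) * (expR u * expR (t - 1)).
    by rewrite -!expRD; congr expR; ring.
  by rewrite ler_pM ?exprn_ge0 ?expR_ge0 ?(ltW t0).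
have := ler_wpM2l (exprn_ge0 3 u0) e3; lra.
Qed.

(** Used with [q = |Y v| ^ 2] to bound a fourth moment by [Z ^ 2] times a second moment. Above [Z],
    the ratio [(W / Z) ^ 4] is at most [expR (4 * (W / Z - 1))], again covered by [4 <= L]. *)
Lemma sqr_orlicz_bound q W : 0 <= q -> q <= W ^+ 2 -> 0 <= W ->
  q ^+ 2 <= Z ^+ 2 * q + Z ^+ 4 * (expR (- L) * expR ((W / K) `^ alpha)).
Proof.
move=> q0 qW W0; set E := expR (- L) * _.
have E0 : 0 <= E by rewrite mulr_ge0 ?expR_ge0.
have [WZ|ZW] := leP W Z.
  rewrite expr2 -[leLHS]addr0 lerD ?mulr_ge0 ?exprn_ge0 ?(ltW Z_gt0) //.
  rewrite ler_wpM2r //; apply: le_trans qW _.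
  by rewrite ler_pXn2r ?nnegrE ?(ltW Z_gt0).
rewrite -[leLHS]add0r lerD ?mulr_ge0 ?exprn_ge0 ?(ltW Z_gt0) //.
apply: (@le_trans _ _ (W ^+ 4)).
  by rewrite (exprM W 2 2) ler_pXn2r ?nnegrE ?sqr_ge0.
have -> : W ^+ 4 = Z ^+ 4 * (W / Z) ^+ 4.
  by field; rewrite gt_eqF.
rewrite ler_wpM2l ?exprn_ge0 ?(ltW Z_gt0) //.
apply: le_trans (expX_le 4 _) _; first by rewrite divr_ge0 // ltW.
apply: le_trans (orlicz_tail ZW); rewrite ler_expR ler_wpM2r //.
by rewrite subr_ge0 ler_pdivlMr ?mul1r // ltW.
Qed.

End orlicz_scalar_bounds.

Lemma expR_le_orlicz (alpha y : R) : 1 <= alpha -> 0 <= y ->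
  expR y <= expR 1 * expR (y `^ alpha).
Proof.
move=> a1 y0; rewrite -expRD ler_expR; have [y1|y1] := leP y 1.
  by apply: le_trans y1 _; rewrite lerDl powR_ge0.
rewrite -[leLHS]add0r lerD // -{1}[y]powRr1 // ler_powR // ltW //.
Qed.

Lemma sqr_le_orlicz (alpha y : R) : 1 <= alpha -> 0 <= y ->
  y ^+ 2 <= 2 * expR (y `^ alpha).
Proof.
move=> a1 y0; have [y1|y1] := leP y 1.
  apply: (@le_trans _ _ 1); first by rewrite expr_le1.
  by have := expR_ge1Dx (y `^ alpha); have := powR_ge0 y alpha; lra.
apply: (@le_trans _ _ (2 * expR y)).
  have := expR_ge1Dxn 1 y0; rewrite (_ : 2`! = 2)%N // => h; lra.
rewrite ler_pM2l // ler_expR -{1}[y]powRr1 // ler_powR // ltW //.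
Qed.

(** The numerical margin of [truncation_tail], where [16 / expR 4] must not exceed one half. The
    proof raises [5 / 4 <= expR (1 / 4)] to the power 16. *)
Lemma expR4_ge32 : 32 <= expR 4 :> R.
Proof.
have -> : (4 : R) = 16%:R * 4^-1 by lra.
rewrite expRM_natl; apply: (@le_trans _ _ ((5 / 4) ^+ 16)); first lra.
rewrite lerXn2r ?nnegrE ?expR_ge0 //.
by have := expR_ge1Dx (4^-1 : R); lra.
Qed.

Section truncation_level.
Variables (K alpha s : R).
Hypotheses (K_gt0 : 0 < K) (alpha_ge1 : 1 <= alpha) (s_gt0 : 0 < s).
Let L := 4 * ulog (K * expR 1 / s).
Let Z := K * L `^ alpha^-1.

Lemma truncation_exponent_ge4 : 4 <= L.
Proof. by rewrite /L ler_peMr // /ulog le_max lexx orbT. Qed.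

Lemma truncation_gt0 : 0 < Z.
Proof.
by rewrite mulr_gt0 // powR_gt0 // (lt_le_trans _ truncation_exponent_ge4).
Qed.

Lemma truncationE : (Z / K) `^ alpha = L.
Proof.
have L4 := truncation_exponent_ge4.
rewrite /Z mulrC mulKf ?gt_eqF // -powRrM mulVf ?powRr1 //; first lra.
by rewrite gt_eqF // (lt_le_trans ltr01).
Qed.

Lemma truncation_root_le (l : R) : 1 <= l -> l `^ alpha^-1 <= l.
Proof.
move=> l1; rewrite -[leRHS]powRr1; last lra.
by rewrite ler_powR // invf_le1 // (lt_le_trans ltr01).
Qed.

Lemma truncation_ge : K <= Z.
Proof.
have L4 := truncation_exponent_ge4.
rewrite ler_peMr ?(ltW K_gt0) //.
have L1 : 1 <= L by lra.
have := @ler_powR _ L L1 0 alpha^-1; rewrite powRr0; apply.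
by rewrite invr_ge0 (le_trans ler01).
Qed.

(** This is where the factor 4 in the level is spent. As [alpha >= 1], [Z <= K * L]. Half of the
    exponent absorbs [L ^ 2], at most [16 * expR (L / 2 - 2)]; the other half gives
    [expR (- L / 2) <= s ^ 2 / (K * e) ^ 2]. What remains is [16 * expR (- 4) * s ^ 2]. *)
Lemma truncation_tail : Z ^+ 2 * expR (- L) <= s ^+ 2 / 2.
Proof.
have L4 := truncation_exponent_ge4.
have L0 : 0 <= L by lra.
have KZ : Z ^+ 2 <= K ^+ 2 * L ^+ 2.
  rewrite exprMn ler_wpM2l ?sqr_ge0 // ler_pXn2r ?nnegrE ?powR_ge0 //.
  apply: truncation_root_le; lra.
have LE : L ^+ 2 <= 16 * expR (2 * (L / 4 - 1)).
  have := @expX_le 2 (L / 4) (divr_ge0 L0 (ler0n _ 4)); rewrite expr_div_n; lra.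
have EL : expR (- (L / 2)) <= s ^+ 2 / (K ^+ 2 * expR 2).
  have p0 : 0 < K * expR 1 / s by rewrite !mulr_gt0 ?expR_gt0 ?invr_gt0.
  have -> : s ^+ 2 / (K ^+ 2 * expR 2) = expR (- (2%:R * ln (K * expR 1 / s))).
    rewrite expRN expRM_natl lnK ?posrE // (_ : 2 = 2%:R * 1 :> R) ?mulr1 //.
    by rewrite -[X in expR X]mulr1 expRM_natl; field;
       rewrite !gt_eqF ?expR_gt0.
  rewrite ler_expR lerN2 /L.
  have : ln (K * expR 1 / s) <= ulog (K * expR 1 / s) by rewrite le_max lexx.
  lra.
apply: (@le_trans _ _ (K ^+ 2 * (16 * expR (2 * (L / 4 - 1))) * expR (- L))).
  rewrite ler_wpM2r ?expR_ge0 //; apply: le_trans KZ _.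
  by rewrite ler_wpM2l ?sqr_ge0.
have -> : K ^+ 2 * (16 * expR (2 * (L / 4 - 1))) * expR (- L) =
   16 * K ^+ 2 * expR (- 2) * expR (- (L / 2)).
  have e : expR (2 * (L / 4 - 1)) * expR (- L) = expR (- 2) * expR (- (L / 2)).
    by rewrite -!expRD; congr expR; lra.
  transitivity (16 * K ^+ 2 * (expR (2 * (L / 4 - 1)) * expR (- L))); first ring.
  by rewrite e; ring.
apply: (@le_trans _ _ (16 * K ^+ 2 * expR (- 2) * (s ^+ 2 / (K ^+ 2 * expR 2)))).
  by rewrite ler_wpM2l // mulr_ge0 ?expR_ge0 // mulr_ge0 ?sqr_ge0.
have e4 := expR4_ge32.
have -> : 16 * K ^+ 2 * expR (- 2) * (s ^+ 2 / (K ^+ 2 * expR 2)) =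
    16 * s ^+ 2 / expR 4.
  rewrite expRN (_ : 4 = 2 + 2 :> R) ?expRD; last lra.
  by field; rewrite !gt_eqF ?expR_gt0.
rewrite ler_pdivrMr ?expR_gt0 //; have := ler_wpM2l (sqr_ge0 s) e4; lra.
Qed.

End truncation_level.
End exponential_bounds.

(** * Replacing the true level by the empirical one *)

Section plug_in.
Context {R : realType}.
Variables (K alpha s0 eps : R).
Hypotheses (K_gt0 : 0 < K) (alpha_ge1 : 1 <= alpha).
Hypotheses (eps_gt0 : 0 < eps) (eps_le : eps ^+ 2 <= 8^-1).

(** At the floored true deviation this is the truncation level [Z]; at a nonzero [sigma_hat] it is
    [K * z_hat]. *)
Definition plug_level (s : R) := K * (4 * ulog (K * expR 1 / s)) `^ alpha^-1.

Lemma ulog_ge1 (y : R) : 1 <= ulog y.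
Proof. by rewrite le_max lexx orbT. Qed.

Lemma le_ulog (a b : R) : 0 < a -> a <= b -> ulog a <= ulog b.
Proof.
move=> a0 ab; rewrite ge_max; apply/andP; split; last exact: ulog_ge1.
by rewrite le_max ler_ln ?posrE ?ab // (lt_le_trans a0).
Qed.

Lemma plug_level_anti a b : 0 < a -> a <= b -> plug_level b <= plug_level a.
Proof.
move=> a0 ab; have b0 := lt_le_trans a0 ab.
rewrite /plug_level ler_wpM2l ?(ltW K_gt0) //.
apply: ge0_ler_powR.
- by rewrite invr_ge0 (le_trans ler01).
- by rewrite nnegrE mulr_ge0 // (le_trans ler01) // ulog_ge1.
- by rewrite nnegrE mulr_ge0 // (le_trans ler01) // ulog_ge1.
rewrite ler_pM2l // le_ulog ?divr_gt0 ?mulr_gt0 ?expR_gt0 //.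
by rewrite ler_wpM2l ?mulr_ge0 ?expR_ge0 ?(ltW K_gt0) // lef_pV2 ?posrE.
Qed.

(** The smaller level at [h] has to be compensated. If [l <= 15 * m], the factor 15 does it.
    Otherwise [h / s >= expR (l - m) >= expR (14 / 15 * l)], and the gain [sqrt 2 * (h - s)] exceeds
    [6 * l * s], whereas the whole range term is at most [4 * l * s] because [K * eps <= s]. *)
Lemma plug_level_overestimate s h : K * eps <= s -> s <= h ->
  Num.sqrt 2 * s + plug_level s * eps <=
  Num.sqrt 2 * h + 15 * plug_level h * eps.
Proof.
move=> Ks sh; set w := Num.sqrt 2.
have w2 : w ^+ 2 = 2 by rewrite sqr_sqrtr.
have w0 : 0 <= w by exact: sqrtr_ge0.
have s_gt0 : 0 < s by apply: lt_le_trans Ks; rewrite mulr_gt0.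
have h_gt0 := lt_le_trans s_gt0 sh.
have Zh0 : 0 <= plug_level h by rewrite mulr_ge0 ?powR_ge0 ?(ltW K_gt0).
pose l := ulog (K * expR 1 / s); pose m := ulog (K * expR 1 / h).
have l1 : 1 <= l := ulog_ge1 _; have m1 : 1 <= m := ulog_ge1 _.
have [lm|ml] := leP l (15 * m).
  have ZZ : plug_level s <= 15 * plug_level h.
    rewrite /plug_level mulrCA ler_wpM2l ?(ltW K_gt0) // -/l -/m.
    apply: (@le_trans _ _ ((15 * (4 * m)) `^ alpha^-1)).
      apply: ge0_ler_powR; rewrite ?nnegrE ?invr_ge0 ?(le_trans ler01) //; lra.
    rewrite powRM //; last lra.
    rewrite ler_wpM2r ?powR_ge0 //; apply: truncation_root_le => //; lra.
  rewrite lerD ?ler_wpM2l // ler_wpM2r // ltW //.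
have lE : l = ln (K * expR 1 / s).
  rewrite /l /ulog; case: (leP 1 (ln (K * expR 1 / s))) => // l_lt1.
  suff : l <= 1 by lra.
  by rewrite /l /ulog ge_max lexx (ltW l_lt1).
have hs : s * expR (14 / 15 * l) <= h.
  have sl : K * expR 1 = s * expR l.
    by rewrite lE lnK ?posrE ?divr_gt0 ?mulr_gt0 ?expR_gt0 //; field; rewrite gt_eqF.
  have hm : K * expR 1 <= h * expR m.
    rewrite -[leLHS](divfK (lt0r_neq0 h_gt0)) [leLHS]mulrC ler_wpM2l ?(ltW h_gt0) //.
    rewrite -[leLHS]lnK ?posrE ?divr_gt0 ?mulr_gt0 ?expR_gt0 //.
    by rewrite ler_expR le_max lexx.
  rewrite -(ler_pM2r (expR_gt0 m)); apply: le_trans hm; rewrite sl -(mulrA s).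
  by rewrite ler_wpM2l ?(ltW s_gt0) // -expRD ler_expR; lra.
have Zl : plug_level s * eps <= 4 * l * s.
  apply: (@le_trans _ _ (4 * l * (K * eps))); last by rewrite ler_wpM2l //; lra.
  have Ke0 : 0 <= K * eps by rewrite mulr_ge0 // ltW.
  have pl : (4 * l) `^ alpha^-1 <= 4 * l.
    by apply: truncation_root_le => //; lra.
  have := ler_wpM2r Ke0 pl; rewrite /plug_level -/l; lra.
(* In this branch [l > 15], since [m >= 1]; the quadratic term of the exponential then already beats
   [6 * l]. *)
have ey : 1 + 6 * l <= expR (14 / 15 * l).
  have y0 : 0 <= 14 / 15 * l by lra.
  have := expR_ge1Dxn 1 y0; rewrite (_ : 2`! = 2)%N // => h2.
  apply: le_trans h2; rewrite lerD2l; nra.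
have hs2 : 6 * l * s <= h - s.
  have := ler_wpM2l (ltW s_gt0) ey; lra.
have w1 : 1 <= w.
  by rewrite leNgt; apply/negP => w_lt1; nra.
have t0 : 0 <= 15 * plug_level h * eps.
  by rewrite mulr_ge0 ?(ltW eps_gt0) // mulr_ge0.
have ws : 6 * l * s <= w * (h - s).
  apply: le_trans hs2 _; rewrite ler_peMl //; lra.
have ls0 : 0 <= l * s by rewrite mulr_ge0 ?(ltW s_gt0) //; lra.
lra.
Qed.

(** If [h < s], the level at [h] is at least [Z], which leaves [14 * g], [g = Z * eps], to cover
    [sqrt 2 * (s - h)]. If [s = K * eps] this is immediate. If [s = s0], a larger gap would exceed
    [98 / 10 * g], so [h ^ 2 <= s ^ 2 - 98 / 10 * s * g]; but [D ^ 2 <= 2 * s * g] and the lower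
    bound on [h ^ 2] give [h ^ 2 >= s ^ 2 - 4 * s * g]. *)
Lemma plug_in D h : 0 <= D -> 0 < h -> s0 <= 2 * K ->
  let s := Num.max s0 (K * eps) in
  D <= Num.sqrt 2 * s * eps + plug_level s * eps ^+ 2 ->
  s0 ^+ 2 - 2 * plug_level s * s * eps - D ^+ 2 <= h ^+ 2 ->
  D <= h * (Num.sqrt 2 * eps) + 15 * plug_level h * eps ^+ 2.
Proof.
move=> D0 h0 s0K s DB sh; set w := Num.sqrt 2 in DB *; set Z := plug_level s in DB sh.
have w2 : w ^+ 2 = 2 by rewrite sqr_sqrtr.
have w0 : 0 <= w by exact: sqrtr_ge0.
have s_gt0 : 0 < s by rewrite lt_max mulr_gt0 ?orbT.
have Ks : K * eps <= s by rewrite le_max lexx orbT.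
suff : w * s + Z * eps <= w * h + 15 * plug_level h * eps.
  by move/(ler_wpM2r (ltW eps_gt0)) => le1; apply: le_trans DB _; lra.
have [s_le_h|h_lt_s] := leP s h; first exact: plug_level_overestimate.
have ZZ : Z <= plug_level h by apply: plug_level_anti => //; exact: ltW.
have KZ : K <= Z by exact: truncation_ge.
have Z0 : 0 < Z by exact: lt_le_trans KZ.
have w_lt : w <= 142 / 100.
  by rewrite leNgt; apply/negP => w_gt; nra.
pose g := Z * eps; have g0 : 0 < g by rewrite mulr_gt0.
have Kg : K * eps <= g by rewrite ler_wpM2r // ltW.
suff wsh : w * (s - h) <= 14 * g.
  have := ler_wpM2r (ltW eps_gt0) ZZ; rewrite -/g => gh.
  have -> : 15 * plug_level h * eps = 15 * (plug_level h * eps) by ring.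
  rewrite -/g; lra.
have [s0s|s0s] := leP s0 (K * eps).
  have sE : s = K * eps by apply/max_idPr.
  apply: (@le_trans _ _ (w * s)); first by rewrite ler_wpM2l //; lra.
  rewrite sE; apply: (@le_trans _ _ (142 / 100 * (K * eps))); last lra.
  by rewrite ler_wpM2r // mulr_ge0 ?(ltW K_gt0) ?(ltW eps_gt0).
have sE : s = s0 by apply/max_idPl; exact: ltW.
rewrite leNgt; apply/negP => wsh.
have sh98 : 98 / 10 * g < s - h.
  have : w * (s - h) <= 142 / 100 * (s - h) by rewrite ler_wpM2r //; lra.
  lra.
(* A rational upper bound for [sqrt (1 / 8)]; with [seps] it makes every term of [D ^ 2] a small
   multiple of [s * g]. *)
have eps_lt : eps <= 36 / 100.
  rewrite leNgt; apply/negP => eps_gt; have := eps_le; nra.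
have seps : s * eps <= 2 * g.
  rewrite sE; apply: (@le_trans _ _ (2 * K * eps)); last lra.
  by rewrite ler_wpM2r // ltW.
have D2 : D ^+ 2 <= 2 * (s * g).
  pose p := s * eps; pose q := g * eps.
  have p0 : 0 <= p by rewrite mulr_ge0 // ltW.
  have q0 : 0 <= q by rewrite mulr_ge0 // ltW.
  have DB' : D <= w * p + q.
    by apply: le_trans DB _; rewrite /p /q /g; lra.
  have : D ^+ 2 <= (w * p + q) ^+ 2.
    have wpq0 : 0 <= w * p + q by apply: addr_ge0 => //; exact: mulr_ge0.
    by rewrite ler_pXn2r ?nnegrE.
  move/le_trans; apply.
  have pg : p <= 2 * g by [].
  have ps : p <= 36 / 100 * s by rewrite /p mulrC ler_wpM2r // ltW.
  have qg : q <= 36 / 100 * g by rewrite /q mulrC ler_wpM2r // ltW.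
  have -> : (w * p + q) ^+ 2 = 2 * (p * p) + 2 * (w * (p * q)) + q * q.
    transitivity (w ^+ 2 * (p * p) + 2 * (w * (p * q)) + q * q); first ring.
    by rewrite w2.
  have gs : g <= s / 9 by lra.
  have pp : p * p <= 36 / 100 * s * (2 * g) by exact: ler_pM.
  have pq : p * q <= 36 / 100 * s * (36 / 100 * g) by exact: ler_pM.
  have wpq : w * (p * q) <= 142 / 100 * (36 / 100 * s * (36 / 100 * g)).
    by apply: ler_pM => //; exact: mulr_ge0.
  have qq : q * q <= 36 / 100 * (s / 9) * (36 / 100 * g).
    by apply: ler_pM => //; lra.
  have sg0 : 0 < s * g by rewrite mulr_gt0.
  lra.
have sg0 : 0 < s * g by rewrite mulr_gt0.
have hs : h ^+ 2 <= s ^+ 2 - 98 / 10 * (s * g).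
  rewrite expr2; apply: (@le_trans _ _ ((s - 98 / 10 * g) * s)); last lra.
  by apply: ler_pM; lra.
move: sh; rewrite -sE /=.
have -> : 2 * Z * s * eps = 2 * (s * g) by rewrite /g; ring.
lra.
Qed.

End plug_in.

(** * Markov's inequality and the Orlicz norm *)

Section probability_bounds.
Context {d0 : measure_display} {T0 : measurableType d0} {R : realType}.
Variable P : probability T0 R.

Lemma markov_real (f : T0 -> R) (c t : R) : measurable_fun setT f ->
  (forall w, 0 <= f w) -> integrable_real P f -> (\int[P]_w f w)%R <= c ->
  0 < t -> (P [set w | (t <= f w)%R] <= (c / t)%:E)%E.
Proof.
move=> mf f0 intf fc t0.
pose f' : {mfun T0 >-> R} := HB.pack f (isMeasurableFun.Build _ _ _ _ _ mf).
have := @markov _ _ _ P f' id t t0 (@measurable_id _ _ _) (fun r h => h)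
  (fun x y _ _ h => h).
have -> : [set x | (t%:E <= `|(f' x)%:E|)%E] = [set w | t <= f w].
  by apply/seteqP; split=> w /=; rewrite lee_fin ger0_norm.
have -> : ('E_P[id \o (fun x : R => `|x|)%R \o f'] = (\int[P]_w f w)%R%:E)%E.
  rewrite unlock -Rintegral_EFin //.
  by apply: eq_integral => w _ /=; rewrite ger0_norm.
move=> le1; rewrite mulrC EFinM lee_pdivlMl //.
by apply: le_trans le1 _; rewrite lee_fin.
Qed.

End probability_bounds.

Section orlicz_moment.
Context {d0 : measure_display} {T0 : measurableType d0} {R : realType}.
Variable P : probability T0 R.
Variables (alpha K : R) (W : T0 -> R).
Hypotheses (alpha_ge1 : 1 <= alpha) (K_gt0 : 0 < K).
Hypotheses (W_meas : measurable_fun setT W) (W_ge0 : forall w, 0 <= W w).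
Hypothesis W_orlicz : (orlicz_norm P alpha W <= K%:E)%E.

Definition orlicz_exp (t : R) w := expR ((W w / t) `^ alpha).

Lemma measurable_orlicz_exp t : measurable_fun setT (orlicz_exp t).
Proof.
apply: measurableT_comp; first exact: measurable_expR.
apply: (@measurableT_comp _ _ _ _ _ _ (@powR R ^~ alpha)).
  exact: measurable_powR.
by apply: measurable_funM => //; exact: measurable_cst.
Qed.

Lemma orlicz_exp_le t u w : 0 < t -> t <= u -> orlicz_exp u w <= orlicz_exp t w.
Proof.
move=> t0 tu; have u0 := lt_le_trans t0 tu; rewrite ler_expR.
apply: ge0_ler_powR; first exact: le_trans alpha_ge1.
- by rewrite nnegrE divr_ge0 // ltW.
- by rewrite nnegrE divr_ge0 // ltW.
by rewrite ler_wpM2l // lef_pV2 ?posrE.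
Qed.

(** Above [K] there is an admissible [u < t] in the infimum; the bound 2 is the admissible 1 plus
    the 1 subtracted in [psi]. *)
Lemma orlicz_exp_above t : K < t -> (\int[P]_w (orlicz_exp t w)%:E <= 2%:E)%E.
Proof.
move=> Kt; have : (orlicz_norm P alpha W < t%:E)%E.
  by apply: le_lt_trans W_orlicz _; rewrite lte_fin.
move=> /ereal_inf_lt [_ [u [u0 leu] <-]]; rewrite lte_fin => ut.
apply: (@le_trans _ _ (\int[P]_w (orlicz_exp u w)%:E)%E).
  apply: ge0_le_integral => //.
  - by move=> w _; rewrite lee_fin expR_ge0.
  - exact/measurable_EFinP/measurable_orlicz_exp.
  - exact/measurable_EFinP/measurable_orlicz_exp.
  - by move=> w _; rewrite lee_fin orlicz_exp_le // ltW.
have -> : (\int[P]_w (orlicz_exp u w)%:E =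
    \int[P]_w (psi alpha (`|W w| / u))%:E + \int[P]_w (1%R)%:E)%E.
  transitivity (\int[P]_w ((psi alpha (`|W w| / u))%:E + (1%R)%:E))%E.
    apply: eq_integral => w _.
    by rewrite -EFinD /psi subrK ger0_norm.
  apply: ge0_integralD => //.
  - by move=> w _; rewrite lee_fin subr_ge0 -expR0 ler_expR powR_ge0.
  - apply/measurable_EFinP.
    have -> : (fun w => psi alpha (`|W w| / u)) = (fun w => orlicz_exp u w - 1).
      by apply/funext => w; rewrite /psi ger0_norm.
    by apply: measurable_funB; [exact: measurable_orlicz_exp | exact: measurable_cst].
have -> : (\int[P]_w (1%R)%:E = 1%:E)%E.
  by rewrite (Rintegral_EFin (integrable_real_cst P 1)) Rintegral_prob_cst.
move: leu; rewrite unlock => leu.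
by rewrite (_ : 2 = 1 + 1 :> R) // EFinD leeD2r.
Qed.

(* The infimum defining the Orlicz norm is attained, by monotone convergence
   along [K / (1 - (k + 2)^-1) `^ alpha^-1], which decreases to [K]. *)
Lemma orlicz_exp_norm : integrable_real P (orlicz_exp K) /\
  (\int[P]_w orlicz_exp K w)%R <= 2.
Proof.
(* Starting at [k + 2] keeps [rho 0 = 1 / 2] positive. The root in [t] turns [rho k] into a factor
   of the exponent, from which monotonicity and convergence in [k] are read off. *)
pose rho k : R := 1 - k.+2%:R^-1.
have rho0 k : 0 < rho k by rewrite subr_gt0 invf_lt1 ?ltr1n.
have rho1 k : rho k < 1 by rewrite ltrBlDr ltrDl invr_gt0.
pose t k := K / rho k `^ alpha^-1.
have a0 : 0 < alpha by exact: lt_le_trans alpha_ge1.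
have tE k w : orlicz_exp (t k) w = expR ((W w / K) `^ alpha * rho k).
  have WK0 : 0 <= W w / K by rewrite divr_ge0 // ltW.
  have -> : orlicz_exp (t k) w = expR ((W w / K * rho k `^ alpha^-1) `^ alpha).
    by rewrite /orlicz_exp /t invf_div mulrCA (mulrC (rho k `^ _)).
  rewrite powRM ?powR_ge0 //.
  by rewrite -powRrM mulVf ?gt_eqF // powRr1 // ltW.
have Kt k : K < t k.
  rewrite /t ltr_pdivlMr ?powR_gt0 // gtr_pMr //.
  have := @gt0_ltr_powR R alpha^-1; rewrite invr_gt0 => /(_ a0 (rho k) 1).
  by rewrite powR1 !nnegrE ler01 (ltW (rho0 k)) => /(_ isT isT (rho1 k)).
have rho_nd : {homo rho : m k / (m <= k)%N >-> m <= k}.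
  by move=> m k mk; rewrite lerD2l lerN2 lef_pV2 ?posrE // ler_nat.
have rho_l : rho k @[k --> \oo] --> (1 : R).
  suff : rho k @[k --> \oo] --> (1 - 0 : R) by rewrite subr0.
  apply: cvgB; first exact: cvg_cst.
  by rewrite (cvg_shiftS (@harmonic R)); exact: cvg_harmonic.
have y0 w : 0 <= (W w / K) `^ alpha by exact: powR_ge0.
have limE w : limn (fun k => (orlicz_exp (t k) w)%:E) = (orlicz_exp K w)%:E.
  apply/cvg_lim => //; apply: cvg_EFin; first exact: nearW.
  have -> : fine \o (fun k => (orlicz_exp (t k) w)%:E) =
      expR \o (fun k => (W w / K) `^ alpha * rho k).
    by apply/funext => k; exact: tE.
  have yl : (W w / K) `^ alpha * rho k @[k --> \oo] --> (W w / K) `^ alpha.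
    by rewrite -[X in _ --> X]mulr1; apply: cvgMl_tmp.
  exact: (cvg_comp _ _ yl (@continuous_expR R _)).
have mono : (\int[P]_w (orlicz_exp (t k) w)%:E @[k --> \oo] -->
             \int[P]_w (orlicz_exp K w)%:E)%E.
  under [X in _ --> X]eq_integral do rewrite -limE.
  apply: cvg_monotone_convergence => //.
  - by move=> k; apply/measurable_EFinP; exact: measurable_orlicz_exp.
  - by move=> k w _; rewrite lee_fin expR_ge0.
  - by move=> w _ k l kl; rewrite lee_fin !tE ler_expR ler_wpM2l // rho_nd.
have le2 : (\int[P]_w (orlicz_exp K w)%:E <= 2%:E)%E.
  by apply: cvge_to_le mono _; apply: nearW => k; exact: orlicz_exp_above.
have int_K : integrable_real P (orlicz_exp K).
  apply: integrable_real_ge0; first exact: measurable_orlicz_exp.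
    by move=> w; exact: expR_ge0.
  by apply: le_lt_trans le2 _; rewrite ltry.
by split=> //; rewrite -lee_fin -Rintegral_EFin.
Qed.

End orlicz_moment.

Section hermitian_part.
Local Open Scope sesquilinear_scope.
Local Open Scope complex_scope.
Context {R : realType} {n : nat}.
Implicit Types A B Y : 'M[R[i]]_n.

(* The functions fed to [expectation_trace_exp_sum] must be Hermitian on all of
   [mxspace], because the exponential is known to be Borel only there; composing
   with [herm_part] achieves this and changes nothing on the sample. *)
Definition herm_part A : 'M[R[i]]_n := (2^-1 : R)%:C *: (A + A^t*).

Lemma herm_part_herm A : herm_part A \is hermsymmx.
Proof. by apply: hermZ; apply/hermsymmxP; rewrite adjmxD trmxCK addrC. Qed.

Lemma herm_partE A : A \is hermsymmx -> herm_part A = A.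
Proof.
move=> /hermsymmxP hA; rewrite /herm_part hA -mulr2n -[A *+ 2]scaler_nat scalerA.
rewrite -(rmorph_nat (real_complex R)) -rmorphM mulVf ?pnatr_eq0 //.
by rewrite rmorph1 scale1r.
Qed.

Lemma mx_measurable_herm_part (d0 : measure_display) (T0 : measurableType d0)
    (M : T0 -> 'M[R[i]]_n) :
  mx_measurable M -> mx_measurable (fun w => herm_part (M w)).
Proof.
move=> mM; apply: mx_measurableZ; apply: mx_measurableD => //.
exact: mx_measurable_adj.
Qed.

Lemma hermB A B : A \is hermsymmx -> B \is hermsymmx -> A - B \is hermsymmx.
Proof. by move=> hA hB; exact: (hermD hA (hermN hB)). Qed.

Lemma hermX2 A : A \is hermsymmx -> A ^+ 2 \is hermsymmx.
Proof. by move=> /hermsymmxP hA; apply/hermsymmxP; rewrite adjmxX hA. Qed.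

Lemma qform_sqr Y v : Y \is hermsymmx -> qform (Y ^+ 2) v = norm2 (Y *m v) ^+ 2.
Proof. by move=> /hermsymmxP hY; rewrite -qform_adj hY expr2. Qed.

Lemma norm2Z (a : R) (v : 'cV[R[i]]_n) : norm2 (a%:C *: v) = `|a| * norm2 v.
Proof.
apply/eqP; rewrite -(@eqrXn2 _ 2) ?mulr_ge0 ?norm2_ge0 // exprMn.
rewrite real_normK ?num_real // !norm2E mulr_sumr; apply/eqP.
by apply: eq_bigr => j _; rewrite mxE sqmodZ.
Qed.

Lemma opnormZ_le (a : R) A : opnorm (a%:C *: A) <= `|a| * opnorm A.
Proof.
have hH := adj_mul_herm A.
apply: opnorm_le => [|v]; first by rewrite mulr_ge0 ?opnorm_ge0.
rewrite -scalemxAl norm2Z -mulrA ler_wpM2l //.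
have [v0|v0] := eqVneq (norm2 v) 0.
  have [c _ Ac] := norm2_mulmx_bounded A.
  by have := Ac v; rewrite v0 !mulr0.
have vgt0 : 0 < norm2 v by rewrite lt_neqAle eq_sym v0 norm2_ge0.
have := @norm2_le_opnorm R n A ((norm2 v)^-1%:C *: v).
rewrite -scalemxAr !norm2Z ger0_norm ?invr_ge0 ?norm2_ge0 // mulVf //.
by move=> /(_ (lexx _)); rewrite ler_pdivrMl // mulrC.
Qed.

Lemma opnorm_sqr_le Y : Y \is hermsymmx -> opnorm (Y ^+ 2) <= opnorm Y ^+ 2.
Proof.
move=> hY; apply: opnorm_le => [|v]; first exact: sqr_ge0.
rewrite [Y ^+ 2](_ : _ = Y *m Y) // -mulmxA.
apply: le_trans (norm2_mulmx_le _ hY) _.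
rewrite expr2 -mulrA ler_wpM2l ?opnorm_ge0 //; exact: norm2_mulmx_le.
Qed.

Lemma scalar_herm (a : R) : (a%:C%:M : 'M[R[i]]_n) \is hermsymmx.
Proof.
apply/hermsymmxP; rewrite tr_scalar_mx map_scalar_mx /=; congr (_%:M).
exact: conjc_real.
Qed.

Lemma speig_scalar (a : R) i : speig (a%:C%:M : 'M[R[i]]_n) i = a.
Proof.
rewrite -qform_speigvec ?scalar_herm // -(mxfun_cst a 0) qform_mxfun.
by rewrite -mulr_sumr sum_spweight norm2_speigvec expr1n mulr1.
Qed.

Lemma qform_mxexp_scalar (a : R) v :
  qform (mxexp (a%:C%:M : 'M[R[i]]_n)) v = expR a * norm2 v ^+ 2.
Proof.
rewrite qform_mxfun; under eq_bigr do rewrite speig_scalar.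
by rewrite -mulr_sumr sum_spweight.
Qed.

Lemma Re_mxtrace_mxexp_scalar (a : R) :
  complex.Re (\tr (mxexp (a%:C%:M : 'M[R[i]]_n))) = n%:R * expR a.
Proof.
rewrite mxtrace_mxfun /=; under eq_bigr do rewrite speig_scalar.
by rewrite sumr_const card_ord mulr_natl.
Qed.

Lemma Re_mxtrace_mxexp_le A : A \is hermsymmx ->
  complex.Re (\tr (mxexp A)) <= n%:R * expR (opnorm A).
Proof.
move=> hA; rewrite mxtrace_mxfun /= -[n in n%:R]card_ord mulr_natl -sumr_const.
apply: ler_sum => i _; rewrite ler_expR.
exact: le_trans (ler_norm _) (speig_le_opnorm i hA).
Qed.

Section exponential_moment.
Variables (K alpha Z : R).
Hypotheses (K_gt0 : 0 < K) (alpha_ge1 : 1 <= alpha) (Z_gt0 : 0 < Z).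
Let L := (Z / K) `^ alpha.
Hypothesis L_ge4 : 4 <= L.

(** The scalar bound is summed over the spectral measure of [c Y] at [v], with [theta = |c|] and
    [a = b / |c|] for each eigenvalue [b] of [c Y]. Working with the eigenvalues of [c Y] rather
    than of [Y] keeps all terms in one basis and carries the sign of [c]. *)
Lemma qform_mxexp_orlicz (c : R) Y v : Y \is hermsymmx ->
  0 < `|c| -> `|c| * Z < 1 ->
  qform (mxexp (c%:C *: Y)) v <= norm2 v ^+ 2 + c * qform Y v +
    c ^+ 2 / 2 * norm2 (Y *m v) ^+ 2 +
    (`|c| * Z) ^+ 3 / (4 * (1 - `|c| * Z)) *
    (norm2 (Y *m v) ^+ 2 / Z ^+ 2 +
     expR (- L) * expR ((opnorm Y / K) `^ alpha) * norm2 v ^+ 2).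
Proof.
move=> hY c0 c1; pose B := c%:C *: Y; have hB : B \is hermsymmx by exact: hermZ.
set rho := _ / (4 * _); set E := expR (- L) * _.
have NB : norm2 (B *m v) ^+ 2 = c ^+ 2 * norm2 (Y *m v) ^+ 2.
  by rewrite /B -scalemxAl norm2Z exprMn real_normK ?num_real.
have c2 : c ^+ 2 != 0 by rewrite sqrf_eq0 -normr_gt0.
have NY : norm2 (Y *m v) ^+ 2 = c ^- 2 * norm2 (B *m v) ^+ 2.
  by rewrite NB mulKf.
rewrite -qformZ -/B (mulrAC _ 2^-1) -NB NY.
rewrite qform_mxfun qform_eig // norm2_eig // -(sum_spweight B).
rewrite mulr_sumr !mulr_suml (mulr_sumr _ _ _ E) -!big_split mulr_sumr -!big_split /=.
apply: ler_sum => i _; set b := speig B i; set q := spweight B v i.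
have q0 : 0 <= q by exact: spweight_ge0.
have bW : `|b / `|c| | <= opnorm Y.
  rewrite normrM normfV normr_id ler_pdivrMr // mulrC.
  exact: le_trans (speig_le_opnorm i hB) (opnormZ_le _ _).
have := expR_orlicz_bound K_gt0 alpha_ge1 Z_gt0 L_ge4 (ltW c0) c1 bW.
rewrite mulrCA mulfV ?gt_eqF // mulr1 -/rho -/L -/E exprMn exprVn mulrCA mulfV ?mulr1; last first.
  by rewrite expf_neq0 // gt_eqF.
rewrite real_normK ?num_real // => /(ler_wpM2r q0) /le_trans; apply.
by rewrite le_eqVlt; apply/orP; left; apply/eqP; field; rewrite -?(normr_gt0 c) ?c0 ?gt_eqF.
Qed.

End exponential_moment.

End hermitian_part.

(** * The empirical Bernstein inequality *)

Section concentration.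
Local Open Scope sesquilinear_scope.
Local Open Scope complex_scope.
Context {d0 : measure_display} {T0 : measurableType d0} {R : realType}.
Variable P : probability T0 R.
Context {n d : nat}.
Hypotheses (d_gt0 : (0 < d)%N) (n_gt0 : (0 < n)%N).
Variables (alpha K : R).
Hypotheses (alpha_ge1 : 1 <= alpha) (K_gt0 : 0 < K).
Variable X : 'I_n -> T0 -> 'M[R[i]]_d.
Hypothesis X_herm : forall i w, X i w \is hermsymmx.
Hypothesis X_meas : forall i, random_mx (X i).
Hypothesis X_indep : mutually_independent P X.
Hypothesis X_id : identically_distributed P X.

Let X1 := X (Ordinal n_gt0).
Let EX : 'M[R[i]]_d := mxexpect P X1.
Let Y w := X1 w - EX.
Let W w := opnorm (Y w).
Hypothesis W_orlicz : (orlicz_norm P alpha W <= K%:E)%E.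

Let Psi := orlicz_exp alpha W K.

Let PsiE w : expR ((W w / K) `^ alpha) = Psi w.
Proof. by []. Qed.

Let mX i : mx_measurable (X i).
Proof. exact/random_mx_measurable. Qed.

Let mY : mx_measurable Y.
Proof. by apply: mx_measurableB; [exact: mX | exact: mx_measurable_cst]. Qed.

Let W_meas : measurable_fun setT W.
Proof. exact: measurable_opnorm. Qed.

Let W_ge0 w : 0 <= W w.
Proof. exact: opnorm_ge0. Qed.

Let Psi_int : integrable_real P Psi.
Proof. by have [] := orlicz_exp_norm alpha_ge1 K_gt0 W_meas W_ge0 W_orlicz. Qed.

Let Psi_le2 : (\int[P]_w Psi w)%R <= 2.
Proof. by have [] := orlicz_exp_norm alpha_ge1 K_gt0 W_meas W_ge0 W_orlicz. Qed.

Let WK_ge0 w : 0 <= W w / K.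
Proof. by rewrite divr_ge0 // ltW. Qed.

Let W_le w : W w <= K * expR 1 * Psi w.
Proof.
have := expR_le_orlicz alpha_ge1 (WK_ge0 w); rewrite PsiE => h1.
have h2 := expR_ge1Dx (W w / K).
have {h1 h2} : W w / K <= expR 1 * Psi w by lra.
by rewrite ler_pdivrMr // => /le_trans; apply; rewrite mulrC mulrA.
Qed.

Let W2_le w : W w ^+ 2 <= 2 * K ^+ 2 * Psi w.
Proof.
have := sqr_le_orlicz alpha_ge1 (WK_ge0 w); rewrite PsiE expr_div_n.
by rewrite ler_pdivrMr ?exprn_gt0 // => /le_trans; apply; rewrite mulrAC.
Qed.

Let iY : mx_integrable P Y.
Proof.
apply: (mx_integrable_dominated mY (g := fun w => K * expR 1 * Psi w)).
  exact: integrable_realZ.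
exact: W_le.
Qed.

(** Integrability of the sample is derived from the Orlicz bound: [EX] is some constant matrix in
    any case, so integrability of [X1 - EX] passes to [X1], and [EX] is then the true mean. *)
Let iX : mx_integrable P X1.
Proof.
move=> j k; have [rY imY] := iY j k; split.
  have -> : (fun w => complex.Re (X1 w j k)) =
      (fun w => complex.Re (Y w j k) + complex.Re (EX j k)).
    by apply/funext => w; rewrite [Y w j k]mxE [(- EX) j k]mxE ReD ReN subrK.
  by apply: integrable_realD => //; exact: integrable_real_cst.
have -> : (fun w => complex.Im (X1 w j k)) =
    (fun w => complex.Im (Y w j k) + complex.Im (EX j k)).
  by apply/funext => w; rewrite [Y w j k]mxE [(- EX) j k]mxE ImD ImN subrK.
by apply: integrable_realD => //; exact: integrable_real_cst.
Qed.

Let EX_herm : EX \is hermsymmx.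
Proof. by apply: mxexpect_herm => // w; exact: X_herm. Qed.

Let Y_herm w : Y w \is hermsymmx.
Proof. exact: (hermB (X_herm _ w) EX_herm). Qed.

Let qformY_int v : integrable_real P (fun w => qform (Y w) v) /\
  (\int[P]_w qform (Y w) v)%R = 0.
Proof.
have [iq qE] := qform_mxexpect v iX; have [iqY _] := qform_mxexpect v iY.
split; first exact: iqY.
transitivity (\int[P]_w (qform (X1 w) v - qform EX v))%R.
  by apply: eq_Rintegral => w _; rewrite /Y qformD qformN.
by rewrite (RintegralB measurableT iq (integrable_real_cst P _))
           Rintegral_prob_cst -qE subrr.
Qed.

Let N v w := norm2 (Y w *m v) ^+ 2.

Let N_sqr v w : N v w = qform (Y w ^+ 2) v.
Proof. exact: (esym (qform_sqr v (Y_herm w))). Qed.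

Let iY2 : mx_integrable P (fun w => Y w ^+ 2).
Proof.
apply: (@mx_integrable_dominated _ _ _ _ _ _ (fun w => 2 * K ^+ 2 * Psi w)).
- exact: mx_measurableX.
- exact: integrable_realZ.
- by move=> w; exact: (le_trans (opnorm_sqr_le (Y_herm w)) (W2_le w)).
Qed.

Let Sigma := mxexpect P (fun w => Y w ^+ 2).

Let Sigma_herm : Sigma \is hermsymmx.
Proof. exact: (mxexpect_herm iY2 (fun w => hermX2 (Y_herm w))). Qed.

Let N_int v : integrable_real P (N v) /\
  (\int[P]_w N v w)%R = qform Sigma v.
Proof.
have [iq qE] := qform_mxexpect v iY2; split.
  by have -> : N v = (fun w => qform (Y w ^+ 2) v) by apply/funext => w.
by rewrite qE; apply: eq_Rintegral => w _; exact: N_sqr.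
Qed.

Let N_ge0 v w : 0 <= N v w.
Proof. exact: sqr_ge0. Qed.

Definition true_sigma : R := Num.sqrt (lambda_max Sigma).
Let s0 := true_sigma.

Let top_index := sval (cid (lambda_maxP d_gt0 Sigma_herm).1).
Definition top_vector : 'cV[R[i]]_d := speigvec Sigma top_index.
Let v0 := top_vector.

Let N_top : (\int[P]_w N v0 w)%R = lambda_max Sigma.
Proof.
have [_ ->] := N_int v0; rewrite qform_speigvec //.
by rewrite /top_index; case: cid => i /= <-.
Qed.

Let v0_norm : norm2 v0 = 1.
Proof. exact: norm2_speigvec. Qed.

Let s0_sqr : s0 ^+ 2 = lambda_max Sigma.
Proof. by rewrite sqr_sqrtr // -N_top; apply: Rintegral_ge0 => w _. Qed.

Let N_le v : (\int[P]_w N v w)%R <= s0 ^+ 2 * norm2 v ^+ 2.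
Proof. by have [_ ->] := N_int v; rewrite s0_sqr qform_le_lambda_max. Qed.

Let N_le_W v w : norm2 v = 1 -> N v w <= W w ^+ 2.
Proof.
move=> v1; rewrite /N ler_pXn2r ?nnegrE ?norm2_ge0 ?opnorm_ge0 //.
by apply: norm2_le_opnorm; rewrite v1.
Qed.

(** Follows from [W ^ 2 <= 2 * K ^ 2 * Psi] and [E Psi <= 2]. In the final comparison it bounds
    [s * eps] by a multiple of [Z * eps]. *)
Lemma true_sigma_le : s0 <= 2 * K.
Proof.
have K2 : 0 <= 2 * K by rewrite mulr_ge0 // ltW.
rewrite -(@ler_pXn2r _ 2) ?nnegrE ?sqrtr_ge0 // s0_sqr -N_top.
have [iN _] := N_int v0.
apply: (@le_trans _ _ (\int[P]_w (2 * K ^+ 2 * Psi w))%R).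
  apply: (le_Rintegral measurableT iN (integrable_realZ _ Psi_int)) => w _.
  by apply: le_trans (W2_le w); exact: N_le_W.
rewrite (RintegralZl _ measurableT Psi_int) exprMn.
have := ler_wpM2l (sqr_ge0 K) Psi_le2; lra.
Qed.

Variable eps : R.
Hypothesis eps_gt0 : 0 < eps.
(* Flooring the standard deviation at [K * eps] covers [s0 = 0], and keeps
   [Z * eps] of order [s * (1 + ln (K / s))], which is what allows the empirical
   level to replace [Z] even when [sigma_hat] is much larger than [s0]. *)
Let s := Num.max s0 (K * eps).
Let Z := plug_level K alpha s.
Let L := (Z / K) `^ alpha.

Let s_gt0 : 0 < s.
Proof. by rewrite lt_max mulr_gt0 ?orbT. Qed.

Let Z_gt0 : 0 < Z.
Proof. exact: truncation_gt0. Qed.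

Let LE : L = 4 * ulog (K * expR 1 / s).
Proof. exact: truncationE. Qed.

Let L_ge4 : 4 <= L.
Proof. by rewrite LE; exact: truncation_exponent_ge4. Qed.

Let KZ : K <= Z.
Proof. exact: truncation_ge. Qed.

Let tail_le : Z ^+ 2 * expR (- L) <= s ^+ 2 / 2.
Proof. by rewrite LE; exact: truncation_tail. Qed.

Let s0s : s0 ^+ 2 <= s ^+ 2.
Proof.
by rewrite ler_pXn2r ?nnegrE ?sqrtr_ge0 ?(ltW s_gt0) // le_max lexx.
Qed.

(** At [u = |c| * Z] the exponent is [c ^ 2 * s ^ 2 / (2 * (1 - |c| * Z))], the Bernstein cumulant
    bound with variance [s ^ 2] and range [Z]. *)
Definition bernstein_factor (u : R) :=
  expR (s ^+ 2 / Z ^+ 2 * (u ^+ 2 / (2 * (1 - u)))).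

Let exp_W_le (c : R) w : `|c| * Z < 1 ->
  expR (`|c| * W w) <= expR 1 * Psi w.
Proof.
move=> cZ; apply: le_trans (expR_le_orlicz alpha_ge1 (WK_ge0 w)).
rewrite ler_expR [leRHS]mulrC ler_wpM2r // -[leRHS]mul1r ler_pdivlMr //.
by apply: le_trans (ltW cZ); rewrite ler_wpM2l.
Qed.

Let opnorm_cY (c : R) w : opnorm (c%:C *: Y w) <= `|c| * W w.
Proof. exact: opnormZ_le. Qed.

Let mexpY (c : R) : mx_measurable (fun w => mxexp (c%:C *: Y w)).
Proof.
exact: (mx_measurable_exp (mx_measurableZ _ mY) (fun w => hermZ c (Y_herm w))).
Qed.

Let trexp_int (c : R) : `|c| * Z < 1 ->
  integrable_real P (fun w => complex.Re (\tr (mxexp (c%:C *: Y w)))).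
Proof.
move=> cZ; apply: (@integrable_real_le _ _ _ _ _
    (fun w => d%:R * (expR 1 * Psi w))).
- exact: measurable_Re_mxtrace.
- by apply: integrable_realZ; exact: integrable_realZ.
move=> w; rewrite ger0_norm ?Re_mxtrace_mxexp_ge0 //.
apply: le_trans (Re_mxtrace_mxexp_le (hermZ c (Y_herm w))) _.
rewrite ler_wpM2l //; apply: le_trans (exp_W_le w cZ).
by rewrite ler_expR.
Qed.

(** The pointwise bound is integrated term by term. The linear term has mean zero, and the Orlicz
    tail, weighted by [expR (- L) <= s ^ 2 / (2 * Z ^ 2)], contributes at most as much as the cubic
    remainder below [Z] is allowed. *)
Lemma mgf_centered (c : R) v : 0 < `|c| -> `|c| * Z < 1 ->
  integrable_real P (fun w => qform (mxexp (c%:C *: Y w)) v) /\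
  (\int[P]_w qform (mxexp (c%:C *: Y w)) v)%R <=
    bernstein_factor (`|c| * Z) * norm2 v ^+ 2.
Proof.
move=> c0 cZ; set u := `|c| * Z.
have iE : mx_integrable P (fun w => mxexp (c%:C *: Y w)).
  apply: (mx_integrable_dominated (mexpY c) (trexp_int cZ)) => w.
  exact: opnorm_mxexp_le.
have [iq _] := qform_mxexpect v iE; split; first exact: iq.
pose rho := u ^+ 3 / (4 * (1 - u)).
have u0 : 0 < u by rewrite mulr_gt0.
have u1 : 0 < 1 - u by rewrite subr_gt0.
have rho0 : 0 <= rho.
  by apply: divr_ge0; [rewrite exprn_ge0 // ltW | rewrite mulr_ge0 // ltW].
have [iqY qY0] := qformY_int v; have [iN _] := N_int v.
pose g w := norm2 v ^+ 2 + (c * qform (Y w) v +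
   ((c ^+ 2 / 2 + rho / Z ^+ 2) * N v w +
    rho * expR (- L) * norm2 v ^+ 2 * Psi w)).
have i1 := integrable_realZ c iqY.
have i2 := integrable_realZ (c ^+ 2 / 2 + rho / Z ^+ 2) iN.
have i3 := integrable_realZ (rho * expR (- L) * norm2 v ^+ 2) Psi_int.
have i23 := integrable_realD i2 i3; have i123 := integrable_realD i1 i23.
have ig : integrable_real P g.
  by apply: integrable_realD i123; exact: integrable_real_cst.
apply: (@le_trans _ _ (\int[P]_w g w)%R).
  apply: (le_Rintegral measurableT iq ig) => w _.
  have := qform_mxexp_orlicz K_gt0 alpha_ge1 Z_gt0 L_ge4 v (Y_herm w) c0 cZ.
  rewrite -/u -/rho -/L -/(W w) PsiE -/(N v w) => /le_trans; apply.
  by rewrite /g le_eqVlt; apply/orP; left; apply/eqP; field; rewrite gt_eqF.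
rewrite /g (RintegralD measurableT (integrable_real_cst P _) i123).
rewrite Rintegral_prob_cst (RintegralD measurableT i1 i23).
rewrite (RintegralD measurableT i2 i3) (RintegralZl _ measurableT iqY).
rewrite (RintegralZl _ measurableT iN) (RintegralZl _ measurableT Psi_int).
rewrite qY0 mulr0 add0r.
have nv0 : 0 <= norm2 v ^+ 2 by exact: sqr_ge0.
apply: (@le_trans _ _ ((1 + s ^+ 2 / Z ^+ 2 * (u ^+ 2 / (2 * (1 - u)))) *
                       norm2 v ^+ 2)); last first.
  by rewrite ler_wpM2r // expR_ge1Dx.
have NS : (\int[P]_w N v w)%R <= s ^+ 2 * norm2 v ^+ 2.
  by apply: le_trans (N_le v) _; rewrite ler_wpM2r.
have a0 : 0 <= c ^+ 2 / 2 + rho / Z ^+ 2.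
  by apply: addr_ge0; apply: divr_ge0 => //; exact: sqr_ge0.
have b0 : 0 <= rho * expR (- L) * norm2 v ^+ 2.
  by apply: mulr_ge0 => //; apply: mulr_ge0 => //; exact: expR_ge0.
have h1 := ler_wpM2l a0 NS; have h2 := ler_wpM2l b0 Psi_le2.
have eL : expR (- L) <= s ^+ 2 / Z ^+ 2 / 2.
  by rewrite mulrAC ler_pdivlMr ?exprn_gt0 // mulrC.
have h3 : rho * expR (- L) * norm2 v ^+ 2 <=
          rho * (s ^+ 2 / Z ^+ 2 / 2) * norm2 v ^+ 2.
  by rewrite ler_wpM2r // ler_wpM2l.
(* This rests on [u ^ 2 / 2 + 2 * rho = u ^ 2 / (2 * (1 - u))], the identity that dictated the
   constant 4 in [rho]. *)
have -> : (1 + s ^+ 2 / Z ^+ 2 * (u ^+ 2 / (2 * (1 - u)))) * norm2 v ^+ 2 =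
  norm2 v ^+ 2 + ((c ^+ 2 / 2 + rho / Z ^+ 2) * (s ^+ 2 * norm2 v ^+ 2) +
   rho * (s ^+ 2 / Z ^+ 2 / 2) * norm2 v ^+ 2 * 2).
  have -> : c ^+ 2 = u ^+ 2 / Z ^+ 2.
    by rewrite /u exprMn mulfK ?real_normK ?num_real // expf_neq0 // gt_eqF.
  by rewrite /rho; field; rewrite !gt_eqF.
lra.
Qed.

Let law_transport (h : mxspace R d -> R) i : measurable_fun setT h ->
  integrable_real P (h \o X1) ->
  integrable_real P (h \o X i) /\
  (\int[P]_w h (X i w) = \int[P]_w h (X1 w))%R.
Proof.
move=> mh ih.
have mhX j : measurable_fun setT (h \o X j).
  exact: (measurableT_comp mh ((mx_measurableP _).1 (mX j))).
have law A : measurable A -> P ((h \o X1) @^-1` A) = P ((h \o X i) @^-1` A).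
  move=> mA; have mhA : mx_borel (h @^-1` A : set 'M[R[i]]_d).
    by rewrite -[_ @^-1` _]setTI; exact: mh.
  exact: X_id mhA.
exact: (Rintegral_same_law (mhX _) (mhX i) law ih).
Qed.

Let dev w := sample_mean (X ^~ w) - EX.

Let dev_sum w : \sum_i (X i w - EX) = (n%:R : R)%:C *: dev w.
Proof.
rewrite /dev /sample_mean scalerBr scalerA -(rmorph_nat (real_complex R)).
rewrite divff ?scale1r; last first.
  by rewrite (fmorph_eq0 (real_complex R)) pnatr_eq0 -lt0n.
rewrite sumrB sumr_const card_ord; congr (_ - _).
by rewrite -[EX *+ n]scaler_nat -(rmorph_nat (real_complex R)).
Qed.

Let dev_herm w : dev w \is hermsymmx.
Proof.
apply: hermB EX_herm; rewrite /sample_mean -(rmorph_nat (real_complex R)).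
by rewrite -fmorphV; apply: hermZ; apply: herm_sum => i; exact: X_herm.
Qed.

Let centered (c : R) (M : mxspace R d) : 'M[R[i]]_d :=
  c%:C *: (herm_part M - EX).

Let centered_meas c : mx_measurable (centered c).
Proof.
exact: (mx_measurableZ _ (mx_measurableB
  (mx_measurable_herm_part mx_measurable_id) (mx_measurable_cst _))).
Qed.

Let centered_herm c M : centered c M \is hermsymmx.
Proof. exact: (hermZ c (hermB (herm_part_herm M) EX_herm)). Qed.

Let centeredE c i w : centered c (X i w) = c%:C *: (X i w - EX).
Proof. by rewrite /centered herm_partE. Qed.

Let trace_exp_dev (c : R) : 0 < `|c| -> `|c| * Z < 1 ->
  let f w := complex.Re (\tr (mxexp ((c * n%:R)%:C *: dev w))) in
  integrable_real P f /\
  (\int[P]_w f w)%R <= d%:R * bernstein_factor (`|c| * Z) ^+ n.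
Proof.
move=> c0 cZ f.
have mexp : mx_measurable (fun M => mxexp (centered c M)).
  exact: (mx_measurable_exp (centered_meas c) (centered_herm c)).
have i1 i : integrable_real P
    (fun w => complex.Re (\tr (mxexp (centered c (X i w))))).
  have [] := @law_transport (fun M => complex.Re (\tr (mxexp (centered c M)))) i.
  - exact: measurable_Re_mxtrace mexp.
  - have -> : (fun M => complex.Re (\tr (mxexp (centered c M)))) \o X1 =
        (fun w => complex.Re (\tr (mxexp (c%:C *: Y w)))).
      by apply/funext => w /=; rewrite centeredE.
    exact: trexp_int.
  - by [].
have i2 i v : (\int[P]_w qform (mxexp (centered c (X i w))) v)%R <=
    bernstein_factor (`|c| * Z) * norm2 v ^+ 2.
  have [im le_m] := mgf_centered v c0 cZ.
  have XY : (fun M => qform (mxexp (centered c M)) v) \o X1 =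
      (fun w => qform (mxexp (c%:C *: Y w)) v).
    by apply/funext => w /=; rewrite centeredE.
  have [] := @law_transport (fun M => qform (mxexp (centered c M)) v) i.
  - exact: measurable_qform mexp.
  - by rewrite XY.
  move=> _ ->; apply: le_trans le_m; rewrite le_eqVlt; apply/orP; left; apply/eqP.
  by apply: eq_Rintegral => w _; rewrite centeredE.
have := @expectation_trace_exp_sum _ _ _ P _ _ _ X X_meas X_indep (centered c)
  (centered_meas c) (centered_herm c) (bernstein_factor (`|c| * Z))
  (expR_ge0 _) i1 i2.
have -> : (fun w => complex.Re (\tr (mxexp (\sum_i centered c (X i w))))) = f.
  apply/funext => w; rewrite /f; congr (complex.Re (\tr (mxexp _))).
  under eq_bigr do rewrite centeredE.
  by rewrite -scaler_sumr dev_sum scalerA rmorphM.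
by [].
Qed.

Let mdev : mx_measurable dev.
Proof.
apply: mx_measurableB (mx_measurable_cst _); apply: mx_measurableZ.
by apply: mx_measurable_sum => i _; exact: mX.
Qed.

Definition deviation_bound := Num.sqrt 2 * s * eps + Z * eps ^+ 2.

Lemma upper_tail (tau : R) : `|tau| = 1 -> exists2 bad : set T0,
  measurable bad /\ (P bad <= (d%:R * expR (- (n%:R * eps ^+ 2)))%:E)%E &
  forall w, ~ bad w -> lambda_max (tau%:C *: dev w) <= deviation_bound.
Proof.
(* The value [theta = b / (1 + b * Z)] optimises the Bernstein exponent: then
   [1 - theta * Z = q^-1], and at [deviation_bound] the exponent is exactly [- n * eps ^ 2]. *)
move=> tau1; pose r := Num.sqrt (2 : R); pose b := r * eps / s.
have r2 : r ^+ 2 = 2 by rewrite sqr_sqrtr.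
have r0 : 0 < r by rewrite sqrtr_gt0.
have b0 : 0 < b by rewrite divr_gt0 ?mulr_gt0.
pose q := 1 + b * Z; have q1 : 1 < q by rewrite ltrDl mulr_gt0.
have q0 : 0 < q by exact: lt_trans q1.
pose theta := b / q; have theta0 : 0 < theta by rewrite divr_gt0.
have cE : `|tau * theta| = theta by rewrite normrM tau1 mul1r gtr0_norm.
have uE : 1 - theta * Z = q^-1.
  by rewrite /theta /q; field; rewrite -/q gt_eqF.
have c0 : 0 < `|tau * theta| by rewrite cE.
have cZ : `|tau * theta| * Z < 1.
  by rewrite cE -subr_gt0 uE invr_gt0.
have [] := trace_exp_dev c0 cZ; set f := (fun w => _) => fint fle.
have mf : measurable_fun setT f.
  apply: measurable_Re_mxtrace; apply: mx_measurable_exp => [|w].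
    exact: mx_measurableZ mdev.
  exact: hermZ (dev_herm w).
have n0 : 0 < n%:R :> R by rewrite ltr0n.
pose t := theta * n%:R; have t0 : 0 < t by rewrite mulr_gt0.
exists [set w | expR (t * deviation_bound) <= f w].
  split.
    rewrite -[X in measurable X]setTI.
    have := measurable_fun_ler (measurable_cst (expR (t * deviation_bound))) mf.
    by move=> /(_ measurableT [set true]); apply.
  apply: le_trans (markov_real mf (fun w => Re_mxtrace_mxexp_ge0 _) fint fle
    (expR_gt0 _)) _.
  rewrite lee_fin le_eqVlt; apply/orP; left; apply/eqP.
  rewrite /bernstein_factor -expRM_natl -mulrA -expRN -expRD.
  congr (_ * expR _); rewrite cE uE /t /deviation_bound -/r.
  have bs : b * s = r * eps by rewrite /b divfK // gt_eqF.
  have -> : s ^+ 2 / Z ^+ 2 * ((theta * Z) ^+ 2 / (2 * q^-1)) =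
      (b * s) ^+ 2 / (2 * q).
    by rewrite /theta; field; rewrite !gt_eqF.
  have -> : theta * n%:R * (r * s * eps + Z * eps ^+ 2) =
      n%:R * ((b * s) * r * eps + b * Z * eps ^+ 2) / q.
    by rewrite /theta; field; rewrite gt_eqF.
  rewrite bs exprMn r2.
  have -> : r * eps * r * eps = 2 * eps ^+ 2 by rewrite -r2; ring.
  have -> : b * Z = q - 1 by rewrite /q addrC addKr.
  by field; rewrite gt_eqF.
move=> w /negP; rewrite -ltNge => f_lt.
have hT := hermZ tau (dev_herm w).
have := lambda_max_trace d_gt0 (hermZ t hT).
rewrite (lambda_maxZ d_gt0 t0 hT).
have te : t * tau = tau * theta * n%:R by rewrite /t; ring.
have -> : t%:C *: (tau%:C *: dev w) = (tau * theta * n%:R)%:C *: dev w.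
  by rewrite scalerA -rmorphM te.
rewrite -/(f w) => /andP[/le_lt_trans/(_ f_lt) + _].
by rewrite ltr_expR ltr_pM2l // => /ltW.
Qed.

Let sqn (M : mxspace R d) : R := qform ((herm_part M - EX) ^+ 2) v0.

Let sqn_meas : measurable_fun setT sqn.
Proof.
apply: measurable_qform; apply: mx_measurableX.
exact: (mx_measurableB (mx_measurable_herm_part mx_measurable_id)
  (mx_measurable_cst _)).
Qed.

Let sqnE i w : sqn (X i w) = norm2 ((X i w - EX) *m v0) ^+ 2.
Proof.
rewrite /sqn herm_partE; last exact: X_herm.
exact: (qform_sqr v0 (hermB (X_herm i w) EX_herm)).
Qed.

(** For a nonnegative variable, [expR (- y) <= 1 - y + y ^ 2 / 2] requires only a second moment.
    Here it is the fourth moment of [|Y v0|], at most [2 * Z ^ 2 * s ^ 2] by [sqr_orlicz_bound] and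
    [tail_le]. *)
Let sqn_mgf (q : R) : 0 < q ->
  integrable_real P (fun w => expR (- q * sqn (X1 w))) /\
  (\int[P]_w expR (- q * sqn (X1 w)))%R <=
    expR (- q * s0 ^+ 2 + q ^+ 2 * Z ^+ 2 * s ^+ 2).
Proof.
move=> q0; have [iN _] := N_int v0.
have qN w : - q * N v0 w <= 0 by rewrite mulNr oppr_le0 mulr_ge0 // ltW.
have -> : (fun w => expR (- q * sqn (X1 w))) = (fun w => expR (- q * N v0 w)).
  by apply/funext => w; rewrite sqnE.
have mN : measurable_fun setT (N v0).
  have -> : N v0 = sqn \o X1 by apply/funext => w /=; rewrite sqnE.
  exact: (measurableT_comp sqn_meas ((mx_measurableP _).1 (mX _))).
have ie : integrable_real P (fun w => expR (- q * N v0 w)).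
  apply: integrable_real_le (integrable_real_cst P 1) _ => [|w].
    apply: measurableT_comp; first exact: measurable_expR.
    by apply: measurable_funM mN; exact: measurable_cst.
  by rewrite ger0_norm ?expR_ge0 // expR_le1.
split; first exact: ie.
pose a := - q + q ^+ 2 / 2 * Z ^+ 2; pose c := q ^+ 2 / 2 * (Z ^+ 4 * expR (- L)).
have i1 := integrable_realZ a iN; have i2 := integrable_realZ c Psi_int.
have i12 := integrable_realD i1 i2.
have i0 := integrable_real_cst P 1.
apply: (@le_trans _ _ (\int[P]_w (1 + (a * N v0 w + c * Psi w)))%R).
  apply: (le_Rintegral measurableT ie (integrable_realD i0 i12)) => w _.
  apply: le_trans (expR_le_taylor2 (qN w)) _.
  have := sqr_orlicz_bound K_gt0 alpha_ge1 Z_gt0 L_ge4 (N_ge0 v0 w)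
    (N_le_W w v0_norm) (W_ge0 w).
  rewrite -/L PsiE => le4.
  have q2 : 0 <= q ^+ 2 / 2 by rewrite divr_ge0 // sqr_ge0.
  have := ler_wpM2l q2 le4; rewrite /a /c; lra.
rewrite (RintegralD measurableT i0 i12) Rintegral_prob_cst.
rewrite (RintegralD measurableT i1 i2) (RintegralZl _ measurableT iN).
rewrite (RintegralZl _ measurableT Psi_int) N_top -s0_sqr.
apply: le_trans (expR_ge1Dx _); rewrite lerD2l.
have c0 : 0 <= c.
  apply: mulr_ge0; first by rewrite divr_ge0 // sqr_ge0.
  by apply: mulr_ge0; [rewrite exprn_ge0 // ltW | exact: expR_ge0].
have h1 := ler_wpM2l c0 Psi_le2.
have q2 : 0 <= q ^+ 2 * Z ^+ 2 by rewrite mulr_ge0 ?sqr_ge0.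
have h2 := ler_wpM2l q2 tail_le; have h3 := ler_wpM2l q2 s0s.
have cE : c * 2 = q ^+ 2 * Z ^+ 2 * (Z ^+ 2 * expR (- L)).
  by rewrite /c; field.
rewrite cE in h1; rewrite /a; lra.
Qed.

(** Packing the scalar into a 1 by 1 matrix lets [expectation_trace_exp_sum] handle this scalar sum
    as well. *)
Let scaled_sqn (q : R) (M : mxspace R d) : 'M[R[i]]_1 := (- q * sqn M)%:C%:M.

Let scaled_sqn_meas q : mx_measurable (scaled_sqn q).
Proof.
have mq : measurable_fun setT (fun M => - q * sqn M).
  by apply: measurable_funM sqn_meas; exact: measurable_cst.
move=> j k; rewrite !ord1; split.
  by under eq_fun do rewrite mxE eqxx mulr1n /=.
by under eq_fun do rewrite mxE eqxx mulr1n /=; exact: measurable_cst.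
Qed.

Lemma lower_tail : exists2 bad : set T0,
  measurable bad /\ (P bad <= (expR (- (n%:R * eps ^+ 2)))%:E)%E &
  forall w, ~ bad w -> s0 ^+ 2 - 2 * Z * s * eps <=
    n%:R^-1 * \sum_i norm2 ((X i w - EX) *m v0) ^+ 2.
Proof.
(* The minimiser of [q ^ 2 * (Z * s) ^ 2 - 2 * q * Z * s * eps], whose minimum is [- eps ^ 2]. *)
pose q := eps / (Z * s); have q0 : 0 < q by rewrite divr_gt0 // mulr_gt0.
pose lam := expR (- q * s0 ^+ 2 + q ^+ 2 * Z ^+ 2 * s ^+ 2).
have mh : measurable_fun setT (fun M => expR (- q * sqn M)).
  apply: measurableT_comp; first exact: measurable_expR.
  by apply: measurable_funM sqn_meas; exact: measurable_cst.
have [i1 le1] := sqn_mgf q0.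
have tr i : integrable_real P (fun w => expR (- q * sqn (X i w))) /\
    (\int[P]_w expR (- q * sqn (X i w)))%R <= lam.
  by have [ii ->] := law_transport i mh i1; split.
have i2 i : integrable_real P
    (fun w => complex.Re (\tr (mxexp (scaled_sqn q (X i w))))).
  have -> : (fun w => complex.Re (\tr (mxexp (scaled_sqn q (X i w))))) =
      (fun w => 1%:R * expR (- q * sqn (X i w))).
    by apply/funext => w; rewrite Re_mxtrace_mxexp_scalar.
  by apply: integrable_realZ; have [] := tr i.
have i3 i v : (\int[P]_w qform (mxexp (scaled_sqn q (X i w))) v)%R <=
    lam * norm2 v ^+ 2.
  have [ii le_i] := tr i.
  have -> : (\int[P]_w qform (mxexp (scaled_sqn q (X i w))) v)%R =
      (\int[P]_w expR (- q * sqn (X i w)))%R * norm2 v ^+ 2.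
    rewrite -(RintegralZr _ measurableT ii); apply: eq_Rintegral => w _.
    exact: qform_mxexp_scalar.
  by rewrite ler_wpM2r ?sqr_ge0.
have [] := @expectation_trace_exp_sum _ _ _ P _ _ _ X X_meas X_indep
  (scaled_sqn q) (scaled_sqn_meas q) (fun M => scalar_herm _) lam
  (expR_ge0 _) i2 i3.
pose f w := expR (- q * \sum_i sqn (X i w)).
have -> : (fun w => complex.Re (\tr (mxexp (\sum_i scaled_sqn q (X i w))))) = f.
  apply/funext => w.
  have -> : \sum_i scaled_sqn q (X i w) = (- q * \sum_i sqn (X i w))%:C%:M.
    by rewrite mulr_sumr !rmorph_sum.
  by rewrite Re_mxtrace_mxexp_scalar mul1r.
rewrite mul1r => fint fle.
have mf : measurable_fun setT f.
  apply: measurableT_comp; first exact: measurable_expR.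
  apply: measurable_funM; first exact: measurable_cst.
  apply: measurable_sum => i.
  exact: (measurableT_comp sqn_meas ((mx_measurableP _).1 (mX i))).
have n0 : 0 < n%:R :> R by rewrite ltr0n.
pose m := s0 ^+ 2 - 2 * Z * s * eps; pose t := expR (- q * (n%:R * m)).
exists [set w | t <= f w].
  split.
    rewrite -[X in measurable X]setTI.
    have := measurable_fun_ler (measurable_cst t) mf.
    by move=> /(_ measurableT [set true]); apply.
  apply: le_trans (markov_real mf (fun w => expR_ge0 _) fint fle
    (expR_gt0 _)) _.
  rewrite lee_fin le_eqVlt; apply/orP; left; apply/eqP.
  rewrite /lam -expRM_natl -expRN -expRD; congr expR.
  have qZs : q * (Z * s) = eps by rewrite /q divfK // gt_eqF // mulr_gt0.
  rewrite /m -qZs; ring.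
move=> w /negP; rewrite -ltNge /f /t ltr_expR ltr_nM2l ?oppr_lt0 // => lt1.
rewrite ler_pdivlMl //; under eq_bigr do rewrite -sqnE; exact: ltW.
Qed.

(** Recentring at [EX]. The factors do not commute, but each of the two cross sums equals
    [n * dev ^ 2] separately. *)
Let sample_cov_split w : sample_cov (X ^~ w) =
  (n%:R^-1 : R)%:C *: \sum_i (X i w - EX) ^+ 2 - dev w ^+ 2.
Proof.
have nE : (n%:R : R[i])^-1 = (n%:R^-1 : R)%:C.
  by rewrite -(rmorph_nat (real_complex R)) -fmorphV.
have n0 : n%:R != 0 :> R by rewrite pnatr_eq0 -lt0n.
have sE : \sum_i (X i w - EX) = dev w *+ n.
  by rewrite dev_sum rmorph_nat scaler_nat.
rewrite /sample_cov nE.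
have -> : \sum_i (X i w - sample_mean (X ^~ w)) ^+ 2 =
    \sum_i (X i w - EX) ^+ 2 - dev w ^+ 2 *+ n.
  transitivity (\sum_i ((X i w - EX) ^+ 2 - (X i w - EX) * dev w -
                (dev w * (X i w - EX) - dev w ^+ 2))).
    apply: eq_bigr => i _.
    have -> : X i w - sample_mean (X ^~ w) = (X i w - EX) - dev w.
      by rewrite /dev opprB addrA subrK.
    by rewrite !expr2 mulrBl !mulrBr.
  rewrite !sumrB -mulr_suml -mulr_sumr sE sumr_const card_ord.
  by rewrite mulrnAl mulrnAr -expr2 subrr subr0.
rewrite scalerBr; congr (_ - _).
by rewrite -[dev w ^+ 2 *+ n]scaler_nat scalerA -(rmorph_nat (real_complex R)) -rmorphM mulVf //
           rmorph1 scale1r.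
Qed.

Let cov w := sample_cov (X ^~ w).

Let cov_herm w : cov w \is hermsymmx.
Proof.
rewrite /cov sample_cov_split; apply: hermB (hermX2 (dev_herm w)).
apply: hermZ; apply: herm_sum => i.
exact: (hermX2 (hermB (X_herm i w) EX_herm)).
Qed.

Let qform_cov w v : qform (cov w) v =
  n%:R^-1 * \sum_i norm2 ((X i w - EX) *m v) ^+ 2 - norm2 (dev w *m v) ^+ 2.
Proof.
rewrite /cov sample_cov_split qformD qformN qformZ.
rewrite (qform_sqr v (dev_herm w)); congr (_ * _ - _).
have q0 : qform (0 : 'M[R[i]]_d) v = 0.
  by rewrite /qform mulmx0 mul0mx mxE.
rewrite (big_morph (qform ^~ v) (fun A B => qformD A B v) q0).
by apply: eq_bigr => i _; exact: (qform_sqr v (hermB (X_herm i w) EX_herm)).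
Qed.

(** The quadratic form of the sample covariance at [v0]. This vector is deterministic, so the
    average is one of i.i.d. scalars, the one controlled by [lower_tail]. *)
Let lambda_cov_ge w :
  n%:R^-1 * \sum_i norm2 ((X i w - EX) *m v0) ^+ 2 - opnorm (dev w) ^+ 2 <=
  lambda_max (cov w).
Proof.
have := qform_le_lambda_max v0 d_gt0 (cov_herm w).
rewrite v0_norm expr1n mulr1 qform_cov; apply: le_trans.
rewrite lerD2l lerN2 ler_pXn2r ?nnegrE ?norm2_ge0 ?opnorm_ge0 //.
by apply: norm2_le_opnorm; rewrite v0_norm.
Qed.

(** Ensures that the square of [sigma_hat] is the largest eigenvalue of the sample covariance,
    [Num.sqrt] being zero on negative numbers. *)
Let lambda_cov_ge0 w : 0 <= lambda_max (cov w).
Proof.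
have [[i ->] _] := lambda_maxP d_gt0 (cov_herm w).
rewrite -(qform_speigvec i (cov_herm w)) /cov /sample_cov.
have nE : (n%:R : R[i])^-1 = (n%:R^-1 : R)%:C.
  by rewrite -(rmorph_nat (real_complex R)) -fmorphV.
set v := speigvec _ _; rewrite nE qformZ mulr_ge0 // ?invr_ge0 //.
have q0 : qform (0 : 'M[R[i]]_d) v = 0.
  by rewrite /qform mulmx0 mul0mx mxE.
rewrite (big_morph (qform ^~ v) (fun A B => qformD A B v) q0).
apply: sumr_ge0 => j _.
have hm : X j w - sample_mean (X ^~ w) \is hermsymmx.
  have -> : X j w - sample_mean (X ^~ w) = (X j w - EX) - dev w.
    by rewrite /dev opprB addrA subrK.
  exact: (hermB (hermB (X_herm j w) EX_herm) (dev_herm w)).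
by rewrite (qform_sqr v hm) sqr_ge0.
Qed.

Let sig w := sigma_hat (X ^~ w).

Let mcov : mx_measurable cov.
Proof.
have mm : mx_measurable (fun w => sample_mean (X ^~ w)).
  by apply: mx_measurableZ; apply: mx_measurable_sum => i _; exact: mX.
apply: mx_measurableZ; apply: mx_measurable_sum => i _.
by apply: mx_measurableX; apply: mx_measurableB; [exact: mX | exact: mm].
Qed.

Let msig : measurable_fun setT sig.
Proof.
apply: measurableT_comp.
  exact: (continuous_measurable_fun (@sqrt_continuous R)).
exact: (measurable_lambda_max d_gt0 mcov cov_herm).
Qed.

(** The alternative [sigma_hat = 0] stands for [z_hat = +oo], which keeps the event expressed over
    [R]. *)
Definition empirical_event := [set w | sigma_hat (X ^~ w) = 0 \/
  opnorm (sample_mean (X ^~ w) - EX) <=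
  sigma_hat (X ^~ w) * (Num.sqrt 2 * eps) +
  15 * plug_level K alpha (sigma_hat (X ^~ w)) * eps ^+ 2].

(** Where [sigma_hat] is positive, the logarithm of the quotient is a difference of logarithms,
    visibly measurable; where it vanishes, the event holds whatever the level is. The result allows
    the event to be bounded through its complement. *)
Lemma measurable_empirical_event : measurable empirical_event.
Proof.
pose lev w := K * (4 * Num.max (ln (K * expR 1) - ln (sig w)) 1) `^ alpha^-1.
have mlev : measurable_fun setT lev.
  apply: measurable_funM; first exact: measurable_cst.
  apply: (@measurableT_comp _ _ _ _ _ _ (@powR R ^~ alpha^-1)).
    exact: measurable_powR.
  apply: measurable_funM; first exact: measurable_cst.
  apply: measurable_maxr; last exact: measurable_cst.
  apply: measurable_funB; first exact: measurable_cst.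
  by apply: measurableT_comp msig; exact: measurable_ln.
pose A := [set w | sig w == 0].
pose B := [set w | opnorm (dev w) <=
  sig w * (Num.sqrt 2 * eps) + 15 * lev w * eps ^+ 2].
have -> : empirical_event = A `|` B.
  apply/seteqP; split=> w; rewrite /empirical_event /A /B /= -/(sig w).
    move=> [->|opn]; first by left.
    have [->|s0w] := eqVneq (sig w) 0; first by left.
    have sw : 0 < sig w by rewrite lt_neqAle eq_sym s0w sqrtr_ge0.
    right; move: opn; rewrite /plug_level /ulog /lev -/(dev w).
    by rewrite ln_div ?posrE // mulr_gt0 // expR_gt0.
  have [->|s0w] := eqVneq (sig w) 0; first by left.
  have sw : 0 < sig w by rewrite lt_neqAle eq_sym s0w sqrtr_ge0.
  move=> [//|opn]; right; move: opn; rewrite /plug_level /ulog /lev -/(dev w).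
  by rewrite ln_div ?posrE // mulr_gt0 // expR_gt0.
have mT (b : T0 -> bool) : measurable_fun setT b -> measurable [set w | b w].
  by move=> mb; rewrite -[X in measurable X]setTI; exact: (mb measurableT [set true]).
apply: measurableU; apply: mT.
  by apply: measurable_fun_eqr msig _; exact: measurable_cst.
apply: measurable_fun_ler; first exact: (measurable_opnorm d_gt0 mdev).
apply: measurable_funD; first by apply: measurable_funM msig _; exact: measurable_cst.
apply: measurable_funM; last exact: measurable_cst.
by apply: measurable_funM mlev; exact: measurable_cst.
Qed.

Hypothesis eps_le : eps ^+ 2 <= 8^-1.

Lemma empirical_bernstein :
  ((1 - 3 * d%:R * expR (- (n%:R * eps ^+ 2)))%:E <= P empirical_event)%E.
Proof.
have [bad1 [m1 P1] good1] := @upper_tail 1 (normr1 _).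
have [bad2 [m2 P2] good2] := @upper_tail (-1) (normrN1 _).
have [bad3 [m3 P3] good3] := lower_tail.
have mE := measurable_empirical_event.
set x := n%:R * eps ^+ 2 in P1 P2 P3 *.
have sub : ~` empirical_event `<=` bad1 `|` bad2 `|` bad3.
  move=> w; apply: contra_notP => /not_orP[/not_orP[/good1 u1 /good2 u2] /good3 l3].
  rewrite /empirical_event /= -/(sig w) -/(dev w).
  have [->|s0w] := eqVneq (sig w) 0; [by left | right].
  have sw : 0 < sig w by rewrite lt_neqAle eq_sym s0w sqrtr_ge0.
  have opn : opnorm (dev w) <= deviation_bound.
    rewrite (opnormE d_gt0 (dev_herm w)) ge_max; apply/andP; split.
      by move: u1; rewrite rmorph1 scale1r.
    by move: u2; rewrite rmorphN rmorph1 scaleN1r.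
  have pl := plug_in K_gt0 alpha_ge1 eps_gt0 eps_le (opnorm_ge0 (dev w)) sw
    true_sigma_le.
  apply: (pl opn).
  rewrite -/s -/Z [leRHS](sqr_sqrtr (lambda_cov_ge0 w)).
  by apply: le_trans (lambda_cov_ge w); rewrite lerD2r.
have PC : (P (~` empirical_event) <= (3 * d%:R * expR (- x))%:E)%E.
  apply: le_trans (le_measure P _ _ sub) _; rewrite ?inE.
  - exact: measurableC.
  - by apply: measurableU => //; exact: measurableU.
  apply: le_trans (measureU2 _ _ _) _ => //; first exact: measurableU.
  apply: (@le_trans _ _ ((d%:R * expR (- x))%:E + (d%:R * expR (- x))%:E +
                         (expR (- x))%:E)%E).
    apply: leeD => //; apply: le_trans (measureU2 _ _ _) _ => //.
    exact: leeD.
  rewrite -!EFinD lee_fin.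
  (* The lower-tail event costs [expR (- x)] without the dimension; [1 <= d] lifts the total
     [2 * d + 1] to [3 * d]. *)
  have d1 : 1 <= d%:R :> R by rewrite ler1n.
  have := ler_wpM2r (expR_ge0 (- x)) d1; lra.
have -> : P empirical_event = (1 - P (~` empirical_event))%E.
  by rewrite -probability_setC ?setCK //; exact: measurableC.
by rewrite EFinB leeB.
Qed.

End concentration.

Theorem corollary3p5 (R : realType) (disp : measure_display)
    (T : measurableType disp) (P : probability T R)
    (d n : nat) (d_gt0 : (0 < d)%N) (n_gt0 : (0 < n)%N)
    (alpha sigma K : R) (alpha_ge1 : 1 <= alpha)
    (sigma_gt0 : 0 < sigma) (K_gt0 : 0 < K)
    (X : 'I_n -> T -> 'M[R[i]]_d)
    (X_herm : forall i w, X i w \is hermsymmx)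
    (X_meas : forall i, random_mx (X i))
    (X_indep : mutually_independent P X)
    (X_id : identically_distributed P X) :
  let X1 := X (Ordinal n_gt0) in
  let EX1 := expectation_mx P X1 in
  let Sigma := expectation_mx P (fun w => (X1 w - EX1) ^+ 2) in
  lambda_max Sigma <= sigma ^+ 2 ->
  (orlicz_norm P alpha (fun w => opnorm (X1 w - EX1)) <= K%:E)%E ->
  forall x : R, 0 < x -> 8 * x <= n%:R ->
  ((1 - 3 * d%:R * expR (- x))%:E <=
   P [set w | let sample := fun i => X i w in
        (opnorm (sample_mean sample - EX1))%:E <=
        (sigma_hat sample * Num.sqrt (2 * (x / n%:R)))%:E +
        (15 * K)%:E * z_hat alpha K sample * (x / n%:R)%:E])%E.
Proof.
move=> X1 EX1 Sigma _; rewrite /EX1 expectation_mxE => W_orlicz x x0 nx.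
have n0 : 0 < n%:R :> R by rewrite ltr0n.
(* With this choice [n * eps ^ 2 = x], and [8 * x <= n] becomes [eps ^ 2 <= 1 / 8]. *)
pose eps := Num.sqrt (x / n%:R).
have xn0 : 0 < x / n%:R by rewrite divr_gt0.
have eps0 : 0 < eps by rewrite sqrtr_gt0.
have eps2 : eps ^+ 2 = x / n%:R by rewrite sqr_sqrtr // ltW.
have eps_le : eps ^+ 2 <= 8^-1 by rewrite eps2 ler_pdivrMr // ler_pdivlMl.
have := empirical_bernstein d_gt0 alpha_ge1 K_gt0 X_herm X_meas X_indep X_id
  W_orlicz eps0 eps_le.
have nE : n%:R * (x / n%:R) = x by rewrite mulrC divfK // gt_eqF.
rewrite eps2 nE => /le_trans; apply.
rewrite le_eqVlt; apply/orP; left; apply/eqP; congr (P _).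
apply/seteqP; split=> w; rewrite /empirical_event /= eps2 /z_hat /plug_level.
all: have [sig0|sig0] := eqVneq (sigma_hat (X ^~ w)) 0.
(* For [sigma_hat = 0] the range term is [+oo], its finite factors being positive, and the
   inequality holds trivially. *)
- move=> _; rewrite gt0_muley ?lte_fin ?mulr_gt0 // gt0_mulye ?lte_fin //.
  by rewrite addey // leey.
- move=> [/eqP|]; first by rewrite (negbTE sig0).
  by rewrite -!EFinM -EFinD lee_fin sqrtrM // !mulrA.
- by left.
- by move=> H; right; move: H; rewrite -!EFinM -EFinD lee_fin sqrtrM // !mulrA.
Qed.
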